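(* Let $\Omega\subset\mathbb{R}^p$ be a domain, let $f\in AP(T_\Omega)$, $f\not\equiv 0$, and let $D_0$ be a connected component of $\Omega\setminus A_f$. Then there is a vector $c(D_0)\in G(f)$ such that for every domain $D'\Subset D_0$ there is a function $g\in AP(T_{D'})$, bounded on $T_{D'}$, with $$f(z)=\exp\{g(z)+i\langle z,c(D_0)\rangle\},\qquad z\in T_{D'}.$$ In particular the mean motion $c(D_0)=-\operatorname{grad}J_f(y)$, $y\in D_0$, belongs to $G(f)$.
   Context: For a domain $\Omega\subset\mathbb{R}^p$, $T_\Omega=\{z=x+iy:\ x\in\mathbb{R}^p,\ y\in\Omega\}\subset\mathbb{C}^p$. The topology $\tau(T_\Omega)$ is that of uniform convergence on every $T_D$ with $D\Subset\Omega$ ($D$ relatively compact in $\Omega$). $AP(T_\Omega)$ is the class of holomorphic functions $f$ on $T_\Omega$ such that the family of translates $\{f(z+t)\}_{t\in\mathbb{R}^p}$ is relatively compact in $\tau(T_\Omega)$ (equivalently, $f$ is a $\tau(T_\Omega)$-limit of finite exponential sums $\sum c_\lambda e^{i\langle z,\lambda\rangle}$, $\lambda\in\mathbb{R}^p$, $c_\lambda\in\mathbb{C}$). The amoeba $A_f$ of $f$ is the closure in $\Omega$ of the set $\{y\in\Omega:\ \exists x\in\mathbb{R}^p,\ f(x+iy)=0\}$. The spectrum of $f$ is $\operatorname{sp} f=\{\lambda\in\mathbb{R}^p:\ \lim_{s\to\infty}(2s)^{-p}\int_{|x_j|<s,\,j=1,\dots,p}e^{-i\langle x+iy,\lambda\rangle}f(x+iy)\,dx\neq0\}$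 (for some, equivalently any, $y\in\Omega$); it is at most countable. $G(f)$ is the additive subgroup of $\mathbb{R}^p$ generated by $\operatorname{sp}f$ (all finite integer combinations of spectral elements). The Jessen function is $J_f(y)=\lim_{s\to\infty}(2s)^{-p}\int_{|x_j|<s,\,j=1,\dots,p}\log|f(x+iy)|\,dx$, $y\in\Omega$; the limit exists and is convex, and it is affine on any domain $D$ with $f\neq0$ on $T_D$. For such a domain $D$ (in particular a connected component of $\Omega\setminus A_f$ or of $D''\setminus A_f$ for $D''\subset\Omega$), the mean motion of $f$ in $D$ is $c(D)=-\operatorname{grad}J_f(y)$, $y\in D$; equivalently it is the unique vector $c\in\mathbb{R}^p$ such that on each $T_{D'}$, $D'\Subset D$, $f=\exp\{g+i\langle z,c\rangle\}$ with $g$ holomorphic and bounded. *)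

(* Defs.v *)
From HB Require Import structures.
From mathcomp Require Import all_boot all_order all_algebra.
From mathcomp Require Import all_classical all_reals all_analysis.
From mathcomp Require Import complex.
Import Order.TTheory GRing.Theory Num.Theory.
Import numFieldNormedType.Exports.
Set Implicit Arguments. Unset Strict Implicit. Unset Printing Implicit Defensive.
Local Open Scope ring_scope.
Local Open Scope classical_set_scope.

(* The complex field R[i] as a normed module over itself (copy of the
   generic instances that MathComp-Analysis provides for R^o), so that
   [differentiable] on 'rV[R[i]]_p -> R[i] is complex (Frechet)
   differentiability, i.e. holomorphy. *)
HB.instance Definition _ (R : rcfType) := PseudoPointedMetric.copy R[i] R[i]^o.
HB.instance Definition _ (R : rcfType) := GRing.ComAlgebra.copy R[i] R[i]^o.
HB.instance Definition _ (R : rcfType) := Vector.copy R[i] R[i]^o.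
HB.instance Definition _ (R : rcfType) := NormedModule.copy R[i] R[i]^o.

Definition cabs (R : realType) (w : R[i]) : R :=
  Num.sqrt (complex.Re w ^+ 2 + complex.Im w ^+ 2).

Definition cexp (R : realType) (w : R[i]) : R[i] :=
  Complex (expR (complex.Re w) * cos (complex.Im w))
          (expR (complex.Re w) * sin (complex.Im w)).

Definition mkz (R : realType) (p : nat) (x y : 'rV[R]_p) : 'rV[R[i]]_p :=
  \row_j Complex (x 0 j) (y 0 j).

Definition cvec (R : realType) (p : nat) (t : 'rV[R]_p) : 'rV[R[i]]_p :=
  mkz t 0.

Definition imv (R : realType) (p : nat) (z : 'rV[R[i]]_p) : 'rV[R]_p :=
  \row_j complex.Im (z 0 j).

Definition cip (R : realType) (p : nat) (z : 'rV[R[i]]_p) (c : 'rV[R]_p) : R[i] :=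
  \sum_(j < p) z 0 j * Complex (c 0 j) 0.

Definition tube (R : realType) (p : nat) (Om : set 'rV[R]_p) : set 'rV[R[i]]_p :=
  [set z | Om (imv z)].

Definition domain (R : realType) (p : nat) (D : set 'rV[R]_p) : Prop :=
  open D /\ connected D.

Definition relcpt_in (R : realType) (p : nat) (D Om : set 'rV[R]_p) : Prop :=
  compact (closure D) /\ closure D `<=` Om.

Definition tau_fam (R : realType) (p : nat) (Om : set 'rV[R]_p)
  : set (set 'rV[R[i]]_p) :=
  [set A | exists D, relcpt_in D Om /\ A = tube D].

Definition holo_on (R : realType) (p : nat) (U : set 'rV[R[i]]_p)
  (f : 'rV[R[i]]_p -> R[i]) : Prop :=
  open U /\ forall z, U z -> differentiable f z.

Definition translate (R : realType) (p : nat) (Om : set 'rV[R]_p)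
  (f : 'rV[R[i]]_p -> R[i]) (t : 'rV[R]_p)
  : {family tau_fam Om, 'rV[R[i]]_p -> R[i]} :=
  fun z => f (z + cvec t).

Definition AP (R : realType) (p : nat) (Om : set 'rV[R]_p)
  (f : 'rV[R[i]]_p -> R[i]) : Prop :=
  holo_on (tube Om) f /\ compact (closure (range (translate Om f))).

Fixpoint cube_int (R : realType) (p : nat) (s : R) : ('rV[R]_p -> R) -> R :=
  match p with
  | 0 => fun F => F 0
  | p'.+1 => fun F =>
      Rintegral lebesgue_measure `[- s, s]
        (fun t : R => cube_int s (fun x : 'rV[R]_p' => F (row_mx (\row_(_ < 1) t) x)))
  end.

Definition cube_mean (R : realType) (p : nat) (s : R) (F : 'rV[R]_p -> R) : R :=
  (2 * s) ^- p * cube_int s F.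

Definition ccube_mean (R : realType) (p : nat) (s : R) (F : 'rV[R]_p -> R[i]) : R[i] :=
  Complex (cube_mean s (fun x => complex.Re (F x)))
          (cube_mean s (fun x => complex.Im (F x))).

Definition spectrum (R : realType) (p : nat) (Om : set 'rV[R]_p)
  (f : 'rV[R[i]]_p -> R[i]) : set 'rV[R]_p :=
  [set lam | exists y, Om y /\ exists l : R[i], l != 0 /\
     (fun s : R => ccube_mean s (fun x =>
         cexp (- (Complex 0 1) * cip (mkz x y) lam) * f (mkz x y))) @ +oo --> l].

Definition Gf (R : realType) (p : nat) (Om : set 'rV[R]_p)
  (f : 'rV[R[i]]_p -> R[i]) : set 'rV[R]_p :=
  [set c | exists (n : nat) (lam : 'I_n -> 'rV[R]_p) (k : 'I_n -> int),
     (forall i, spectrum Om f (lam i)) /\ c = \sum_(i < n) (lam i *~ k i)].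

Definition amoeba (R : realType) (p : nat) (Om : set 'rV[R]_p)
  (f : 'rV[R[i]]_p -> R[i]) : set 'rV[R]_p :=
  closure [set y | Om y /\ exists x, f (mkz x y) = 0] `&` Om.

Definition jessen (R : realType) (p : nat) (f : 'rV[R[i]]_p -> R[i])
  (y : 'rV[R]_p) : R :=
  lim ((fun s : R => cube_mean s (fun x => ln (cabs (f (mkz x y))))) @ +oo).

(* Main.v *)
Require Import Defs.
From HB Require Import structures.
From mathcomp Require Import all_boot all_order all_algebra.
From mathcomp Require Import all_classical all_reals all_analysis.
From mathcomp Require Import complex ring lra zify.
Import Order.TTheory GRing.Theory Num.Theory.
Import numFieldNormedType.Exports.
Set Implicit Arguments. Unset Strict Implicit. Unset Printing Implicit Defensive.
Local Open Scope ring_scope.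
Local Open Scope classical_set_scope.

(** On a horizontal slice [y] off the amoeba, Harnack's inequality bounds [|f|]
    from below, so [f] has a uniformly continuous logarithm there. Its imaginary
    part is a quasimorphism up to bounded error, hence of the form [<x, c>] plus a
    bounded function (Bohr, Hyers). If a translation by [t] moves [f] by little,
    then [exp(i <t, c>)] is close to 1. Finite Fourier analysis on fine grids and an
    ultralimit show that all [t] for which finitely many [exp(i <t, l_k>)], with
    [l_k] in the spectrum, are close to 1 move [f] by little. High powers of the
    kernel [prod_k (1 + cos <x, l_k>) / 2] concentrate on this set of [t], while
    their frequencies are integer combinations of the [l_k]; so [c] must be such a
    combination. Normalising the bounded part of the logarithm to have mean zero
    makes the local decompositions unique, so they glue along the connected
    component; the Jessen function is then read off as the mean of the logarithm. *)

(** * Complex modulus, exponential and logarithm *)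

(** The delicate passage is from almost periods to the spectrum: finitely many spectral elements
    must control all almost periods of a slice up to a given error. On a finite torus, translation
    and Fourier coefficients are linked by an exact identity, and total boundedness of the
    translates bounds the number of important frequencies independently of the mesh; this uniformity
    is what lets a finite list of frequencies survive the ultralimit. Frequencies whose coefficients
    fall below a threshold [ka] are dropped. For the others the lower bound [ka] makes the limits
    continuous characters, hence exponentials, and puts them in the spectrum. The kernel of
    [bohr_span] yields integer and not merely rational combinations, because its expansion contains
    integer combinations only. Cauchy's theorem enters twice: through the gradient bound behind the
    lower bound for [|f|], and through the fact that the mean of the logarithm does not depend on
    the imaginary part, which is why one constant factor serves the whole component. *)

Section cabs_theory.
Variable R : realType.
Implicit Types (z w : R[i]) (x y : R).

Lemma cabsE z : cabs z = Normc.normc z. Proof. by case: z. Qed.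

Lemma normrcE z : `|z| = (cabs z)%:C%C. Proof. by rewrite normc_def. Qed.

Lemma cabs_ge0 z : 0 <= cabs z. Proof. exact: sqrtr_ge0. Qed.

Lemma cabs0 : cabs (0 : R[i]) = 0. Proof. by rewrite cabsE Normc.normc0. Qed.

Lemma cabs1 : cabs (1 : R[i]) = 1. Proof. by rewrite cabsE Normc.normc1. Qed.

Lemma cabs_eq0 z : (cabs z == 0) = (z == 0).
Proof.
apply/eqP/eqP => [|->]; last exact: cabs0.
by rewrite cabsE; apply: Normc.eq0_normc.
Qed.

Lemma cabs_gt0 z : (0 < cabs z) = (z != 0).
Proof. by rewrite lt_def cabs_eq0 cabs_ge0 andbT. Qed.

Lemma cabsM z w : cabs (z * w) = cabs z * cabs w.
Proof. by rewrite !cabsE Normc.normcM. Qed.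

Lemma cabsV z : cabs z^-1 = (cabs z)^-1.
Proof. by rewrite !cabsE Normc.normcV. Qed.

Lemma cabsX z n : cabs (z ^+ n) = cabs z ^+ n.
Proof. by elim: n => [|n IH]; rewrite ?expr0 ?cabs1 // !exprS cabsM IH. Qed.

Lemma cabsD z w : cabs (z + w) <= cabs z + cabs w.
Proof. by rewrite !cabsE le_normcD. Qed.

Lemma cabsN z : cabs (- z) = cabs z.
Proof. by rewrite !cabsE normcN. Qed.

Lemma cabsB z w : cabs (z - w) <= cabs z + cabs w.
Proof. by rewrite -(cabsN w) cabsD. Qed.

Lemma cabsC z w : cabs (z - w) = cabs (w - z).
Proof. by rewrite -cabsN opprB. Qed.

Lemma cabs_dist u v z : cabs (u - v) <= cabs (u - z) + cabs (z - v).
Proof. by rewrite -[u - v](subrKA z) cabsD. Qed.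

Lemma cabs_lB z w : cabs z - cabs w <= cabs (z - w).
Proof. by rewrite lerBlDr -{1}(subrK w z) cabsD. Qed.

Lemma cabs_sum (I : Type) (r : seq I) (P : pred I) (F : I -> R[i]) :
  cabs (\sum_(i <- r | P i) F i) <= \sum_(i <- r | P i) cabs (F i).
Proof.
elim/big_ind2 : _ => [|x1 x2 y1 y2 h1 h2|//]; first by rewrite cabs0.
by apply: le_trans (cabsD _ _) _; rewrite lerD.
Qed.

Lemma cabs_conj z : cabs (z^*%C) = cabs z.
Proof. by case: z => a b; rewrite /cabs /= sqrrN. Qed.

Lemma cabsR x : cabs x%:C%C = `|x|.
Proof. by rewrite /cabs /= expr0n addr0 sqrtr_sqr. Qed.

Lemma cabs_nat n : cabs (n%:R : R[i]) = n%:R.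
Proof. by rewrite -(rmorph_nat (real_complex R)) cabsR ger0_norm. Qed.

Lemma cabs_i : cabs ('i%C : R[i]) = 1.
Proof. by rewrite /cabs /= expr0n add0r expr1n sqrtr1. Qed.

Lemma cabs_sqr z : cabs z ^+ 2 = complex.Re z ^+ 2 + complex.Im z ^+ 2.
Proof. by rewrite sqr_sqrtr // addr_ge0 // sqr_ge0. Qed.

Lemma normRe_le z : `|complex.Re z| <= cabs z.
Proof.
rewrite -(@ler_pXn2r _ 2) ?nnegrE ?cabs_ge0 // cabs_sqr real_normK ?num_real //.
by rewrite lerDl sqr_ge0.
Qed.

Lemma normIm_le z : `|complex.Im z| <= cabs z.
Proof.
rewrite -(@ler_pXn2r _ 2) ?nnegrE ?cabs_ge0 // cabs_sqr real_normK ?num_real //.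
by rewrite lerDr sqr_ge0.
Qed.

Lemma cabs_le_ReIm z : cabs z <= `|complex.Re z| + `|complex.Im z|.
Proof.
rewrite {1}[z]complexE; apply: le_trans (cabsD _ _) _.
by rewrite cabsM cabs_i mul1r !cabsR.
Qed.

Lemma Re_le z : complex.Re z <= cabs z.
Proof. exact: le_trans (ler_norm _) (normRe_le _). Qed.

Lemma cReD z w : complex.Re (z + w) = complex.Re z + complex.Re w.
Proof. by case: z; case: w. Qed.
Lemma cImD z w : complex.Im (z + w) = complex.Im z + complex.Im w.
Proof. by case: z; case: w. Qed.
Lemma cReN z : complex.Re (- z) = - complex.Re z. Proof. by case: z. Qed.
Lemma cImN z : complex.Im (- z) = - complex.Im z. Proof. by case: z. Qed.
Lemma cReB z w : complex.Re (z - w) = complex.Re z - complex.Re w.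
Proof. by rewrite cReD cReN. Qed.
Lemma cImB z w : complex.Im (z - w) = complex.Im z - complex.Im w.
Proof. by rewrite cImD cImN. Qed.
Lemma cReM z w : complex.Re (z * w) =
  complex.Re z * complex.Re w - complex.Im z * complex.Im w.
Proof. by case: z; case: w. Qed.
Lemma cImM z w : complex.Im (z * w) =
  complex.Re z * complex.Im w + complex.Im z * complex.Re w.
Proof. by case: z => a b; case: w => c d /=. Qed.
Lemma cRe_sum (I : Type) (r : seq I) (P : pred I) (F : I -> R[i]) :
  complex.Re (\sum_(i <- r | P i) F i) = \sum_(i <- r | P i) complex.Re (F i).
Proof. by apply: (big_morph _ cReD). Qed.
Lemma cIm_sum (I : Type) (r : seq I) (P : pred I) (F : I -> R[i]) :
  complex.Im (\sum_(i <- r | P i) F i) = \sum_(i <- r | P i) complex.Im (F i).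
Proof. by apply: (big_morph _ cImD). Qed.

Lemma cP z w : complex.Re z = complex.Re w -> complex.Im z = complex.Im w -> z = w.
Proof. by case: z; case: w => a b c d /= -> ->. Qed.

Lemma mulcJ z : z * z^*%C = (cabs z ^+ 2)%:C%C.
Proof. by rewrite -sqr_normc normrcE -rmorphXn. Qed.

Lemma small_eq0 (x : R) : (forall e, 0 < e -> `|x| <= e) -> x = 0.
Proof.
move=> h; apply/eqP; rewrite -normr_le0 leNgt; apply/negP => x0.
by have := h (`|x| / 2) (divr_gt0 x0 (ltr0Sn _ 1)); lra.
Qed.

Lemma csmall_eq0 z : (forall e, 0 < e -> cabs z <= e) -> z = 0.
Proof.
move=> h; apply/eqP; rewrite -cabs_eq0; apply/eqP/small_eq0 => e e0.
by rewrite ger0_norm ?cabs_ge0 ?h.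
Qed.

End cabs_theory.

Section cexp_theory.
Variable R : realType.
Implicit Types (z w : R[i]) (x y : R).

Lemma ler_dist_derive (f df : R -> R) K a b :
  (forall x, is_derive x 1 f (df x)) ->
  (forall x, `|x - a| <= `|b - a| -> `|df x| <= K) ->
  `|f b - f a| <= K * `|b - a|.
Proof.
move=> fd dfK.
have fc : continuous f.
  by move=> x; apply/differentiable_continuous/derivable1_diffP; case: (fd x).
have main c d : c <= d -> (forall x, c <= x <= d -> `|df x| <= K) ->
    `|f d - f c| <= K * `|d - c|.
  move=> cd h; have [x xcd ->] := @MVT_segment R f df c d cd
     (fun x _ => fd x) (continuous_subspaceT fc).
  by rewrite normrM ler_wpM2r // h // -in_itv.
have [ab|/ltW ba] := leP a b.
  apply: main => // x /andP[ax xb]; apply: dfK.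
  by rewrite !ger0_norm ?subr_ge0 // lerB.
rewrite distrC [`|b - a|]distrC; apply: main => // x /andP[bx xa]; apply: dfK.
by rewrite !ler0_norm ?subr_le0 // lerN2 lerB.
Qed.

Lemma ler_norm_sin x : `|sin x| <= `|x|.
Proof.
have := @ler_dist_derive sin cos 1 0 x (fun x => is_derive_sin x)
  (fun x _ => cos_max x).
by rewrite sin0 !subr0 mul1r.
Qed.

Lemma ler_norm_1Bcos x : `|1 - cos x| <= x ^+ 2.
Proof.
have -> : 1 - cos x = (sin (x / 2)) ^+ 2 *+ 2.
  rewrite [in LHS](_ : x = x / 2 *+ 2); last by rewrite mulr2n; lra.
  by rewrite cos_mulr2n sin2cos2 !mulr2n; ring.
rewrite ger0_norm ?mulrn_wge0 ?sqr_ge0 //.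
rewrite -(real_normK (num_real (sin (x / 2)))).
have := ler_norm_sin (x / 2); rewrite normrM [`|2^-1|]ger0_norm ?invr_ge0 //.
move=> h; have := normr_ge0 (sin (x / 2)); rewrite -(real_normK (num_real x)).
by rewrite mulr2n; nra.
Qed.

Lemma ler_norm_sinB x : `|sin x - x| <= `|x| ^+ 3.
Proof.
pose f (x : R) := sin x - x.
have df (u : R) : is_derive u 1 f (cos u - 1) by rewrite /f; apply: is_deriveB.
have := @ler_dist_derive f _ (x ^+ 2) 0 x df; rewrite /f sin0 !subr0.
rewrite -(real_normK (num_real x)) -exprSr; apply => u; rewrite subr0 => ux.
rewrite distrC (le_trans (ler_norm_1Bcos u)) // -(real_normK (num_real u)).
by rewrite ler_pXn2r ?nnegrE.
Qed.

(** From [expR (- x) >= 1 - x] one gets [expR x <= 1 / (1 - x)], which [1 + x + 2 x^2] dominates as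
    long as [x <= 1 / 2]. *)
Lemma expR_le2 x : `|x| <= 1 / 2 -> `|expR x - 1 - x| <= x ^+ 2 *+ 2.
Proof.
rewrite ler_norml => /andP[x1 x2].
have h1 := expR_ge1Dx x; have h2 := expR_ge1Dx (- x).
have h3 : expR x * expR (- x) = 1 by rewrite -expRD subrr expR0.
have h4 := expR_gt0 x; rewrite ger0_norm; last by lra.
rewrite mulr2n.
have h5 : expR x * (1 - x) <= 1 by rewrite -h3 ler_pM2l //; lra.
have h6 : (1 + x + x ^+ 2 + x ^+ 2) * (1 - x) >= 1.
  have : 0 <= x ^+ 2 * (1 - 2 * x) by rewrite mulr_ge0 ?sqr_ge0 //; lra.
  lra.
have : expR x * (1 - x) <= (1 + x + x ^+ 2 + x ^+ 2) * (1 - x) by lra.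
by rewrite ler_pM2r; lra.
Qed.

Lemma cexp0 : cexp (0 : R[i]) = 1.
Proof. by rewrite /cexp /= expR0 cos0 sin0 mulr1 mulr0. Qed.

Lemma cexpD z w : cexp (z + w) = cexp z * cexp w.
Proof.
apply: cP; rewrite /cexp ?cReM ?cImM /= cReD cImD expRD ?cosD ?sinD; ring.
Qed.

Lemma cabs_cexp z : cabs (cexp z) = expR (complex.Re z).
Proof.
by rewrite /cabs /= !exprMn -mulrDr cos2Dsin2 mulr1 sqrtr_sqr ger0_norm ?expR_ge0.
Qed.

Lemma cexp_neq0 z : cexp z != 0.
Proof. by rewrite -cabs_gt0 cabs_cexp expR_gt0. Qed.

Lemma cexpN z : cexp (- z) = (cexp z)^-1.
Proof.
apply: (mulfI (cexp_neq0 z)).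
by rewrite -cexpD subrr cexp0 divff // cexp_neq0.
Qed.

Lemma cexpB z w : cexp (z - w) = cexp z / cexp w.
Proof. by rewrite cexpD cexpN. Qed.

Lemma cexpMn z n : cexp (z *+ n) = cexp z ^+ n.
Proof. by elim: n => [|n IH]; rewrite ?cexp0 // mulrS exprS cexpD IH. Qed.

Lemma cexp_sum (I : Type) (r : seq I) (P : pred I) (F : I -> R[i]) :
  cexp (\sum_(i <- r | P i) F i) = \prod_(i <- r | P i) cexp (F i).
Proof. by apply: (big_morph _ cexpD cexp0). Qed.

(** The uniqueness principle behind all continuation arguments: two logarithms of one number whose
    imaginary parts differ by less than a full period coincide. At the half angle [u < pi],
    [cos (2 u) = 1] would force [sin u = 0], while the sine is positive on [(0, pi)]. *)
Lemma cexp_eq1 z : cexp z = 1 -> `|complex.Im z| < pi *+ 2 -> z = 0.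
Proof.
move=> e1 Im2; have Re0 : complex.Re z = 0.
  by apply: expR_inj; rewrite -cabs_cexp e1 cabs1 expR0.
move: e1; rewrite /cexp Re0 expR0 !mul1r => -[c1 _].
apply: cP => //=; apply/eqP; rewrite -normr_eq0; apply/negPn/negP => n0.
pose u := `|complex.Im z| / 2.
have u0 : 0 < u by rewrite divr_gt0 // lt_def n0 normr_ge0.
have upi : u < pi by rewrite /u ltr_pdivrMr // mulr_natr.
have := sin_gt0_pi (introT andP (conj u0 upi)).
have : cos (u *+ 2) = 1.
  by rewrite -mulr_natr /u divfK ?pnatr_eq0 // cos_norm.
rewrite cos_mulr2n => h; have := cos2Dsin2 u; move: h; rewrite mulr2n => h1 h2.
have -> : sin u = 0 by apply/eqP; rewrite -sqrf_eq0; apply/eqP; lra.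
by rewrite ltxx.
Qed.

Lemma cexp_order2 z : cabs z <= 1 / 2 -> cabs (cexp z - 1 - z) <= cabs z ^+ 2 *+ 6.
Proof.
move=> z2; set a := complex.Re z; set b := complex.Im z.
have a2 : `|a| <= 1 / 2 := le_trans (normRe_le z) z2.
have b2 : `|b| <= 1 / 2 := le_trans (normIm_le z) z2.
apply: le_trans (cabs_le_ReIm _) _.
rewrite !cReB !cImB /= -/a -/b subr0 cabs_sqr -/a -/b.
have ea := expR_le2 a2; have cb := ler_norm_1Bcos b; have sb := ler_norm_sinB b.
have c1 := cos_max b; have s1 := ler_norm_sin b.
have -> : expR a * cos b - 1 - a = (expR a - 1 - a) * cos b - (1 + a) * (1 - cos b).
  by ring.
have -> : expR a * sin b - b = (expR a - 1) * sin b + (sin b - b) by ring.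
have e1 : `|expR a - 1| <= `|a| *+ 2.
  rewrite -[X in `|X|](subrK a) (le_trans (ler_normD _ _)) //.
  rewrite mulr2n lerD2r (le_trans ea) // -(real_normK (num_real a)).
  by have := normr_ge0 a; rewrite mulr2n; nra.
have k1 : `|(expR a - 1 - a) * cos b - (1 + a) * (1 - cos b)| <=
     a ^+ 2 *+ 2 + 2 * b ^+ 2.
  apply: le_trans (ler_normB _ _) _; rewrite !normrM; apply: lerD.
    by rewrite -[leRHS]mulr1 ler_pM.
  rewrite ler_pM // (le_trans (ler_normD _ _)) // normr1; lra.
have k2 : `|(expR a - 1) * sin b + (sin b - b)| <=
     `|a| *+ 2 * `|b| + `|b| ^+ 3.
  apply: le_trans (ler_normD _ _) _; rewrite !normrM; apply: lerD => //.
  by rewrite ler_pM.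
apply: le_trans (lerD k1 k2) _.
rewrite -(real_normK (num_real a)) -(real_normK (num_real b)).
have := normr_ge0 a; have := normr_ge0 b; move: (`|a|) (`|b|) a2 b2 => A B A2 B2 B0 A0.
have : A * B * 2 <= A ^+ 2 + B ^+ 2 by have := sqr_ge0 (A - B); lra.
have : B ^+ 3 <= B ^+ 2 by rewrite -[leRHS]mulr1 exprSr ler_wpM2l ?sqr_ge0 //; lra.
rewrite !mulr2n !mulrS; have := sqr_ge0 A; have := sqr_ge0 B; lra.
Qed.

(** It inverts [cexp] only where the real part is positive, so its uses keep the argument near 1.
    Elsewhere the value is junk, but its imaginary part stays below [pi / 2] everywhere, which is
    why [normIm_clog] is unconditional. *)
Definition clog w : R[i] :=
  Complex (ln (cabs w)) (atan (complex.Im w / complex.Re w)).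

Lemma cexp_clog w : 0 < complex.Re w -> cexp (clog w) = w.
Proof.
case: w => a b /= a0; have w0 : 0 < cabs (Complex a b).
  by apply: lt_le_trans a0 (Re_le (Complex a b)).
rewrite /cexp /clog /= lnK ?posrE //.
have cE : cos (atan (b / a)) = a / cabs (Complex a b).
  rewrite cos_atan /cabs /=.
  have -> : 1 + (b / a) ^+ 2 = (a ^+ 2 + b ^+ 2) / a ^+ 2.
    by field; rewrite gt_eqF.
  rewrite sqrtrM ?addr_ge0 ?sqr_ge0 // sqrtrV ?sqr_ge0 // sqrtr_sqr ger0_norm ?ltW //.
  by rewrite invfM invrK mulrC.
have cn0 : cos (atan (b / a)) != 0 by rewrite cE mulf_neq0 ?invr_neq0 ?gt_eqF.
have sE : sin (atan (b / a)) = b / cabs (Complex a b).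
  have := atanK (b / a); rewrite /tan => /(congr1 ( *%R^~ (cos (atan (b / a))))).
  by rewrite divfK // cE => ->; field; rewrite !gt_eqF.
by rewrite cE sE; congr Complex; rewrite mulrC divfK // gt_eqF.
Qed.

Lemma normIm_clog w : `|complex.Im (clog w)| < pi / 2.
Proof. by rewrite /= ltr_norml atan_gtNpi2 atan_ltpi2. Qed.

Lemma ler_norm_atan x : `|atan x| <= `|x|.
Proof.
have := @ler_dist_derive atan (fun x => (1 + x ^+ 2)^-1) 1 0 x
  (fun x => is_derive1_atan x).
rewrite atan0 !subr0 mul1r; apply => y _.
rewrite ger0_norm ?invr_ge0 ?addr_ge0 ?sqr_ge0 // invf_le1 ?ltr_wpDr ?sqr_ge0 //.
by rewrite lerDl sqr_ge0.
Qed.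

Lemma Re_near1 w : cabs (w - 1) <= 1 / 2 -> 1 / 2 <= complex.Re w.
Proof.
move=> h; have := le_trans (normRe_le _) h; rewrite cReB /= ler_norml.
by move=> /andP[]; lra.
Qed.

Lemma Re_near1_gt0 w : cabs (w - 1) <= 1 / 2 -> 0 < complex.Re w.
Proof. by move=> /Re_near1; lra. Qed.

Lemma cabs_clog w : cabs (w - 1) <= 1 / 2 -> cabs (clog w) <= 4 * cabs (w - 1).
Proof.
move=> h; have h2 := Re_near1 h.
apply: le_trans (cabs_le_ReIm _) _; rewrite /clog /=.
have dI : `|complex.Im w| <= cabs (w - 1).
  by have := normIm_le (w - 1); rewrite cImB /= subr0.
have w1 := cabs_lB w 1; have w2 := cabs_lB 1 w.
rewrite cabs1 cabsC in w2; rewrite cabs1 in w1.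
have l1 : `|ln (cabs w)| <= 2 * cabs (w - 1).
  have c0 : 0 < cabs w by apply: lt_le_trans (Re_le w); lra.
  have d0 := cabs_ge0 (w - 1).
  have u1 : ln (cabs w) <= cabs (w - 1).
    have := @le_ln1Dx _ (cabs w - 1).
    rewrite addrCA subrr addr0 => /(_ _)/le_trans; apply => //; lra.
  have u2 : - ln (cabs w) <= 2 * cabs (w - 1).
    rewrite -lnV ?posrE //; have := @le_ln1Dx _ ((cabs w)^-1 - 1).
    rewrite addrCA subrr addr0 => /(_ _)/le_trans; apply.
      by rewrite ltrBDr addNr invr_gt0.
    have -> : (cabs w)^-1 - 1 = (1 - cabs w) / cabs w.
      by rewrite mulrBl divff ?mul1r // gt_eqF.
    have w3 : 1 <= 2 * cabs w by have := Re_le w; lra.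
    by rewrite ler_pdivrMr //; apply: le_trans w2 _; nra.
  by rewrite ler_norml; apply/andP; split; lra.
have l2 : `|atan (complex.Im w / complex.Re w)| <= 2 * cabs (w - 1).
  apply: le_trans (ler_norm_atan _) _.
  rewrite normrM normfV [`|complex.Re w|]ger0_norm; last by lra.
  rewrite ler_pdivrMr; last by lra.
  by apply: le_trans dI _; have := cabs_ge0 (w - 1); nra.
by lra.
Qed.

(** This is [cexp_order2] at [clog w], whose modulus is at most [4 * cabs (w - 1)]: the radius 1/8
    brings it down to 1/2, and 96 is 6 times the square of 4. *)
Lemma clog_order2 w : cabs (w - 1) <= 1 / 8 ->
  cabs (clog w - (w - 1)) <= 96 * cabs (w - 1) ^+ 2.
Proof.
move=> h; have c4 : cabs (clog w) <= 4 * cabs (w - 1) by apply: cabs_clog; lra.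
have := @cexp_order2 (clog w); rewrite cexp_clog; last by apply: Re_near1_gt0; lra.
move=> /(_ _)/le_trans H; rewrite cabsC; apply: H; first by lra.
rewrite -mulr_natr; have : cabs (clog w) ^+ 2 <= (4 * cabs (w - 1)) ^+ 2.
  by rewrite ler_pXn2r ?nnegrE ?cabs_ge0 // mulr_ge0 // cabs_ge0.
rewrite exprMn; lra.
Qed.

Lemma clog1 : clog (1 : R[i]) = 0.
Proof.
by apply/eqP; rewrite -cabs_eq0 -normr_le0 ger0_norm ?cabs_ge0 //
  (le_trans (@cabs_clog 1 _)) // subrr cabs0 ?mulr0 //; lra.
Qed.

(** Both sides have the same exponential, and three imaginary parts below [pi / 2] cannot add up to
    a full period. *)
Lemma clog_div u v : cabs (u - 1) <= 1 / 2 -> cabs (v - 1) <= 1 / 2 ->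
  cabs (v / u - 1) <= 1 / 2 -> clog v - clog u = clog (v / u).
Proof.
move=> hu hv huv; apply/eqP; rewrite -subr_eq0; apply/eqP/cexp_eq1.
  rewrite !cexpB !cexp_clog ?divff // ?Re_near1_gt0 // mulf_neq0 ?invr_eq0 //.
    by rewrite -cabs_gt0; apply: lt_le_trans (Re_le _); apply: Re_near1_gt0.
  by rewrite -cabs_gt0; apply: lt_le_trans (Re_le _); apply: Re_near1_gt0.
rewrite !cImB; have := normIm_clog u; have := normIm_clog v; have := normIm_clog (v / u).
move: (pi_gt0 R); rewrite !ltr_norml [pi *+ 2]mulr2n => ? /andP[? ?] /andP[? ?] /andP[? ?].
by apply/andP; split; lra.
Qed.

End cexp_theory.

(** * Lifting of paths through the exponential *)

Section path_lifting.
Variable R : realType.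
Implicit Types (g l : R -> R[i]).

Definition uc01 g := forall e, 0 < e -> exists2 d : R, 0 < d &
  forall s s' : R, 0 <= s <= 1 -> 0 <= s' <= 1 -> `|s - s'| < d ->
    cabs (g s - g s') <= e.

Lemma archi_inv (d : R) : 0 < d -> exists N, N.+1%:R^-1 < d.
Proof.
move=> d0; exists (Num.bound d^-1); rewrite invf_plt ?posrE //.
apply: lt_trans (archi_boundP _) _; first by rewrite invr_ge0 ltW.
by rewrite ltr_nat.
Qed.

(** Connectedness of the unit interval, reduced to finitely many steps of length [1 / N.+1] shorter
    than [d]. *)
Lemma chain01 (P : R -> Prop) (d : R) : 0 < d -> P 0 ->
  (forall s s', 0 <= s <= 1 -> 0 <= s' <= 1 -> `|s - s'| < d -> P s -> P s') ->
  P 1.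
Proof.
move=> d0 P0 step; have [N Nd] := archi_inv d0.
have N0 : 0 < N.+1%:R :> R by rewrite ltr0n.
have in01 k : (k <= N.+1)%N -> 0 <= (k%:R / N.+1%:R : R) <= 1.
  by move=> kN; rewrite divr_ge0 //= ler_pdivrMr // mul1r ler_nat.
suff H k : (k <= N.+1)%N -> P (k%:R / N.+1%:R).
  by have := H _ (leqnn _); rewrite divff // gt_eqF.
elim: k => [|k IH] kN; first by rewrite mul0r.
apply: step (IH (ltnW kN)); rewrite ?in01 // ?(ltnW kN) //.
by rewrite -mulrBl -natr1 opprD addNKr mulN1r normrN ger0_norm ?invr_ge0 // ltW.
Qed.

Lemma ratio_close (m e : R) (a b : R[i]) :
  0 < m -> m <= cabs b -> cabs (a - b) <= e * m -> cabs (a / b - 1) <= e.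
Proof.
move=> m0 mb ab; have b0 : b != 0 by rewrite -cabs_gt0 (lt_le_trans m0).
rewrite -[1](divff b0) -mulrBl cabsM cabsV ler_pdivrMr ?cabs_gt0 //.
apply: (le_trans ab); rewrite ler_wpM2l //.
have : 0 <= e * m := le_trans (cabs_ge0 _) ab.
by rewrite pmulr_lge0.
Qed.

(** The ratio of ratios is the product of [a / a'] and [b' / b], each within [e] of 1; the error
    [e^2 + 2 e] is at most [3 e] because [e <= 1]. *)
Lemma ratio2_close (m e : R) (a b a' b' : R[i]) : 0 < m -> e <= 1 ->
  m <= cabs b -> m <= cabs a' -> m <= cabs b' ->
  cabs (a - a') <= e * m -> cabs (b - b') <= e * m ->
  cabs (a / b / (a' / b') - 1) <= 3 * e.
Proof.
move=> m0 e1 mb ma' mb' aa bb.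
have h1 := ratio_close m0 ma' aa.
have h2 : cabs (b' / b - 1) <= e by apply: (ratio_close m0 mb); rewrite cabsC.
have b0 : b != 0 by rewrite -cabs_gt0 (lt_le_trans m0).
have b'0 : b' != 0 by rewrite -cabs_gt0 (lt_le_trans m0).
have a'0 : a' != 0 by rewrite -cabs_gt0 (lt_le_trans m0).
have -> : a / b / (a' / b') - 1 = (a / a' - 1) * (b' / b - 1) +
   ((a / a' - 1) + (b' / b - 1)) by field; rewrite b0 b'0 a'0.
apply: le_trans (cabsD _ _) _; rewrite cabsM.
have := cabsD (a / a' - 1) (b' / b - 1).
have := cabs_ge0 (a / a' - 1); have := cabs_ge0 (b' / b - 1); nra.
Qed.

(** The lift is one explicit formula rather than a gluing over subintervals: for each [s], the
    logarithms of the ratios of consecutive values of [g] at fractions of [s] are summed, and the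
    product of these ratios telescopes to [g s / g 0]. Uniform continuity in [s] then follows term
    by term. *)
Lemma path_lift g (m : R) (l0 : R[i]) : uc01 g -> 0 < m ->
  (forall s : R, 0 <= s <= 1 -> m <= cabs (g s)) -> cexp l0 = g 0 ->
  exists l, [/\ l 0 = l0, uc01 l & forall s : R, 0 <= s <= 1 -> cexp (l s) = g s].
Proof.
move=> guc m0 gm l0E; have [d d0 gd] := guc (1 / 4 * m) ltac:(by lra).
have [N Nd] := archi_inv d0; have N0 : 0 < N.+1%:R :> R by rewrite ltr0n.
pose pt s k : R := s * (k%:R / N.+1%:R).
pose r s k := g (pt s k.+1) / g (pt s k).
pose l s := l0 + \sum_(k < N.+1) clog (r s k).
have in01 s k : 0 <= s <= 1 -> (k <= N.+1)%N -> 0 <= pt s k <= 1.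
  move=> /andP[s0 s1] kN; rewrite mulr_ge0 ?divr_ge0 //= mulr_ile1 ?divr_ge0 //.
  by rewrite ler_pdivrMr // mul1r ler_nat.
have gn0 s : 0 <= s <= 1 -> g s != 0.
  by move=> /gm h; rewrite -cabs_gt0 (lt_le_trans m0).
have r1 s k : 0 <= s <= 1 -> (k <= N)%N -> cabs (r s k - 1) <= 1 / 4.
  move=> s01 kN; apply: (ratio_close m0); first by rewrite gm ?in01 // leqW.
  apply: gd; rewrite ?in01 // ?leqW // -mulrBr -mulrBl -natr1 addrAC subrr add0r.
  move/andP: s01 => [s0 s1]; rewrite mul1r normrM !ger0_norm ?invr_ge0 //.
  by apply: le_lt_trans Nd; rewrite ler_piMl ?invr_ge0.
have pt0 s : pt s 0%N = 0 by rewrite /pt mul0r mulr0.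
exists l; split.
- rewrite /l big1 ?addr0 // => k _; rewrite /r /pt !mul0r divff ?clog1 // gn0 //.
  by rewrite lexx ler01.
(* The bound 1/6 keeps the ratios of ratios within [3 * e1 <= 1 / 2] of 1, as [clog_div] needs; the
   other bound makes each of the [N.+1] terms at most [4 * (3 * e1) <= e / N.+1]. *)
- move=> e e0; pose e1 := Order.min (1 / 6) (e / (12 * N.+1%:R)).
  have e10 : 0 < e1 by rewrite lt_min divr_gt0 //= divr_gt0 // mulr_gt0.
  have [d' d'0 gd'] := guc (e1 * m) (mulr_gt0 e10 m0).
  exists d' => // s s' s01 s'01 ss.
  have -> : l s - l s' = \sum_(k < N.+1) (clog (r s k) - clog (r s' k)).
    by rewrite /l sumrB; ring.
  apply: le_trans (cabs_sum _ _ _) _.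
  have -> : e = \sum_(k < N.+1) (e / N.+1%:R).
    by rewrite sumr_const card_ord -[RHS]mulr_natr divfK // gt_eqF.
  apply: ler_sum => -[k kN] _ /=.
  have close j : (j <= N.+1)%N -> cabs (g (pt s j) - g (pt s' j)) <= e1 * m.
    move=> jN; apply: gd'; rewrite ?in01 // -mulrBl normrM.
    apply: le_lt_trans ss; rewrite ler_piMr // ger0_norm ?divr_ge0 //.
    by rewrite ler_pdivrMr // mul1r ler_nat.
  have e16 : e1 <= 1 / 6 by rewrite ge_min lexx.
  have h3 : cabs (r s k / r s' k - 1) <= 3 * e1.
    have kN' := ltnW kN.
    apply: (ratio2_close m0); [lra|apply: gm|apply: gm|apply: gm|apply: close|apply: close] => //;
      exact: in01.
  have e12 : e1 <= e / (12 * N.+1%:R) by rewrite ge_min lexx orbT.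
  rewrite clog_div; last by lra.
  + apply: le_trans (cabs_clog _) _; first by lra.
    have -> : e / N.+1%:R = 12 * (e / (12 * N.+1%:R)) by field; rewrite gt_eqF.
    apply: (@le_trans _ _ (12 * e1)); first by lra.
    by rewrite ler_pM2l.
  + by apply: le_trans (r1 s' k s'01 kN) _; lra.
  + by apply: le_trans (r1 s k s01 kN) _; lra.
- move=> s s01; rewrite /l cexpD cexp_sum l0E.
  have H n : (n <= N.+1)%N -> g 0 * \prod_(k < n) cexp (clog (r s k)) = g (pt s n).
    elim: n => [|n IH] nN; first by rewrite big_ord0 mulr1 pt0.
    rewrite big_ord_recr /= mulrA IH ?(ltnW nN) // cexp_clog; last first.
      by apply: Re_near1_gt0; apply: le_trans (r1 s n s01 nN) _; lra.
    by rewrite /r mulrC divfK // gn0 // in01 // ltnW.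
  by rewrite H // /pt divff ?mulr1 // gt_eqF.
Qed.

(** The defect between [l'] and [l + clog (g' / g)] is a multiple of the period. A short step
    changes its imaginary part by at most [1 / 4 + 1 / 4 + pi / 2 + pi / 2], less than a period, so
    it stays zero along the path. *)
Lemma path_compare g g' l l' :
  uc01 l -> uc01 l' ->
  (forall s : R, 0 <= s <= 1 -> cexp (l s) = g s) ->
  (forall s : R, 0 <= s <= 1 -> cexp (l' s) = g' s) ->
  (forall s : R, 0 <= s <= 1 -> cabs (g' s / g s - 1) <= 1 / 2) ->
  l' 0 = l 0 + clog (g' 0 / g 0) -> l' 1 = l 1 + clog (g' 1 / g 1).
Proof.
move=> luc l'uc lE l'E gg h0.
have [d d0 ld] := luc (1 / 4) ltac:(by lra).
have [d' d'0 l'd] := l'uc (1 / 4) ltac:(by lra).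
apply: (@chain01 (fun s => l' s = l s + clog (g' s / g s)) (Order.min d d')) => //.
  by rewrite lt_min d0.
move=> s s' s01 s'01; rewrite lt_min => /andP[sd sd'] h.
apply/eqP; rewrite -subr_eq0; apply/eqP/cexp_eq1.
  rewrite opprD addrA !cexpB lE // l'E // cexp_clog ?divff ?Re_near1_gt0 ?gg //.
  by rewrite mulf_neq0 ?invr_eq0 // -?lE -?l'E // cexp_neq0.
have -> : l' s' - (l s' + clog (g' s' / g s')) =
  (l s - l s') - (l' s - l' s') - clog (g' s' / g s') + clog (g' s / g s).
  by rewrite h; ring.
rewrite cImD !cImB -cImB -[X in _ - X - _]cImB.
have := le_trans (normIm_le _) (ld s s' s01 s'01 sd).
have := le_trans (normIm_le _) (l'd s s' s01 s'01 sd').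
have := normIm_clog (g' s' / g s'); have := normIm_clog (g' s / g s).
have := pi_ge2 R; move: (complex.Im (clog _)) (complex.Im (clog _))
  (complex.Im (l s - l s')) (complex.Im (l' s - l' s')) => a b c e.
rewrite !ltr_norml !ler_norml [pi *+ 2]mulr2n.
move=> ? /andP[? ?] /andP[? ?] /andP[? ?] /andP[? ?].
by apply/andP; split; lra.
Qed.

(** With [g x] the values of a function along a ray ending at [x], the end values [L x] form a
    logarithm on a star-shaped set. Each path is lifted separately; the second conclusion says that
    neighbouring choices agree. It serves for rectangles, for the real space and for tubes over
    balls. *)
Lemma lift_family (X : Type) (K : set X) (g : X -> R -> R[i]) (l0 : X -> R[i]) :
  (forall x, K x -> uc01 (g x)) ->
  (forall x, K x -> exists2 m, 0 < m & forall s : R, 0 <= s <= 1 -> m <= cabs (g x s)) ->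
  (forall x, K x -> cexp (l0 x) = g x 0) ->
  exists L : X -> R[i], (forall x, K x -> cexp (L x) = g x 1) /\
    (forall x x', K x -> K x' ->
      (forall s : R, 0 <= s <= 1 -> cabs (g x' s / g x s - 1) <= 1 / 2) ->
      l0 x' = l0 x + clog (g x' 0 / g x 0) ->
      L x' = L x + clog (g x' 1 / g x 1)).
Proof.
move=> guc gm l0E.
have H x : exists l, K x ->
    [/\ l 0 = l0 x, uc01 l & forall s : R, 0 <= s <= 1 -> cexp (l s) = g x s].
  have [Kx|] := pselect (K x); last by move=> nK; exists (fun=> 0).
  have [m m0 hm] := gm x Kx.
  by have [l hl] := path_lift (guc x Kx) m0 hm (l0E x Kx); exists l.
have [l hl] := choice H.
exists (fun x => l x 1); split => [x /hl[_ _ ->//]|x x' Kx Kx' gg h0].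
  by rewrite lexx ler01.
have [a b c] := hl x Kx; have [a' b' c'] := hl x' Kx'.
by apply: (path_compare b b' c c' gg); rewrite a a'.
Qed.

End path_lifting.

(** * Integrals of continuous functions over segments *)

Section integral.
Variable R : realType.
Implicit Types (h k : R -> R) (a b c t x y : R).
Local Notation mu := (@lebesgue_measure R).

Definition rcont h x := forall e, 0 < e -> exists2 d : R, 0 < d &
  forall y, `|y - x| < d -> `|h y - h x| <= e.

Lemma rcont_continuous h x : rcont h x -> {for x, continuous h}.
Proof.
move=> hx; apply/cvgrPdist_le => e e0; have [d d0 hd] := hx e e0.
by exists d => //= y yd; rewrite distrC hd // distrC.
Qed.

Definition rint a b h : R := Rintegral mu `[a, b] h.

Definition contin a b h := forall x, a <= x <= b -> rcont h x.

Lemma contin_within a b h : contin a b h -> {within `[a, b], continuous h}.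
Proof.
move=> H; apply: continuous_in_subspaceT => x /set_mem /= xab.
by apply/rcont_continuous/H; rewrite in_itv /= in xab.
Qed.

Lemma contin_integrable a b h : contin a b h -> mu.-integrable `[a, b] (EFin \o h).
Proof.
move=> H; apply: continuous_compact_integrable; first exact: segment_compact.
exact: contin_within.
Qed.

Lemma contin_sub a b a' b' h : a <= a' -> b' <= b -> contin a b h -> contin a' b' h.
Proof. by move=> aa bb H x /andP[xa xb]; apply: H; rewrite (le_trans aa) //= (le_trans xb). Qed.

Lemma rcontD h k x : rcont h x -> rcont k x -> rcont (fun y => h y + k y) x.
Proof.
move=> hx kx e e0; have e20 : 0 < e / 2 by rewrite divr_gt0.
have [d d0 H] := hx _ e20; have [d' d'0 K] := kx _ e20.
exists (Order.min d d') => [|y]; first by rewrite lt_min d0.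
rewrite lt_min => /andP[/H yh /K yk].
have -> : h y + k y - (h x + k x) = (h y - h x) + (k y - k x) by ring.
by apply: le_trans (ler_normD _ _) _; lra.
Qed.

Lemma rcontZ h c x : rcont h x -> rcont (fun y => c * h y) x.
Proof.
move=> hx e e0; have c1 : 0 < `|c| + 1 by rewrite ltr_wpDl.
have [d d0 H] := hx _ (divr_gt0 e0 c1); exists d => // y /H yh.
rewrite -mulrBr normrM.
have -> : e = (`|c| + 1) * (e / (`|c| + 1)) by rewrite mulrC divfK // gt_eqF.
by apply: ler_pM => //; rewrite lerDl.
Qed.

Lemma rcont_cst c x : rcont (fun=> c) x.
Proof. by move=> e e0; exists 1 => // y _; rewrite subrr normr0 ltW. Qed.

Lemma rintD a b h k : contin a b h -> contin a b k ->
  rint a b (fun x => h x + k x) = rint a b h + rint a b k.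
Proof. by move=> hc kc; rewrite /rint RintegralD //; exact: contin_integrable. Qed.

Lemma rintZ a b h c : contin a b h -> rint a b (fun x => c * h x) = c * rint a b h.
Proof. by move=> hc; rewrite /rint RintegralZl //; exact: contin_integrable. Qed.

Lemma rint_cst a b c : a <= b -> rint a b (fun=> c) = c * (b - a).
Proof.
move=> ab; rewrite /rint Rintegral_cst //= lebesgue_measure_itv /= lte_fin.
by move: ab; rewrite le_eqVlt => /predU1P[->|->]; rewrite ?ltxx ?subrr.
Qed.

Lemma eq_rint a b h k : (forall x, a <= x <= b -> h x = k x) -> rint a b h = rint a b k.
Proof.
move=> hk; apply: eq_Rintegral => x /set_mem /= xab; apply: hk.
by rewrite in_itv /= in xab.
Qed.

Lemma le_rint a b h k : contin a b h -> contin a b k ->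
  (forall x, a <= x <= b -> h x <= k x) -> rint a b h <= rint a b k.
Proof.
move=> hc kc hk; apply: le_Rintegral; rewrite //; exact: contin_integrable.
Qed.

Lemma norm_rint a b h k : contin a b h -> contin a b k ->
  (forall x, a <= x <= b -> `|h x| <= k x) -> `|rint a b h| <= rint a b k.
Proof.
move=> hc kc hk; rewrite ler_norml; apply/andP; split.
  rewrite -mulN1r -rintZ //; apply: le_rint => //.
    by move=> x xab; apply/rcontZ/kc.
  by move=> x /hk; rewrite mulN1r ler_norml => /andP[].
by apply: le_rint => // x /hk; rewrite ler_norml => /andP[].
Qed.

Lemma norm_rint_le a b h K : a <= b -> contin a b h ->
  (forall x, a <= x <= b -> `|h x| <= K) -> `|rint a b h| <= K * (b - a).
Proof.
move=> ab hc hK; rewrite -rint_cst //; apply: norm_rint => //.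
by move=> x _; apply: rcont_cst.
Qed.

Lemma rint_split a m b h : a <= m -> m <= b -> contin a b h ->
  rint a b h = rint a m h + rint m b h.
Proof.
move=> am mb hc; have := @Rintegral_itvB R h (BLeft a) (BRight b) m
  (contin_integrable hc); rewrite !bnd_simp => /(_ am mb) H.
rewrite /rint -[X in _ = _ + X]Rintegral_itv_obnd_cbnd.
  by apply/eqP; rewrite addrC -subr_eq H.
apply: integrableS (contin_integrable (contin_sub am (lexx b) hc)) => //.
exact: subset_itv_oc_cc.
Qed.

(** A primitive [F] of [h] on a larger interval evaluates both integrals to [F (b + t) - F (a + t)].
    The margins of 1 in [A] and [B] keep both intervals inside the open interval where [F] is
    differentiable. *)
Lemma rint_shift a b h t : a <= b -> (forall x, rcont h x) ->
  rint a b (fun x => h (x + t)) = rint (a + t) (b + t) h.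
Proof.
rewrite le_eqVlt => /predU1P[<- _|ab hc].
  by rewrite /rint !set_itv1 !Rintegral_set1.
pose A := Order.min a (a + t) - 1; pose B := Order.max b (b + t) + 1.
have AB u : a <= u <= b \/ a + t <= u <= b + t -> A < u < B.
  rewrite /A /B; have := ltexx; case: (leP a (a + t)); case: (leP b (b + t)); lra.
pose F x := rint A x h.
have hcc : continuous h by move=> x; exact: rcont_continuous.
have FD x : A < x < B -> is_derive x 1 F (h x).
  move=> /andP[Ax xB].
  have := @continuous_FTC1_closed R h A x B xB.
  have hi : mu.-integrable `[A, B] (EFin \o h) by apply: contin_integrable => y _.
  move=> /(_ hi Ax (hcc x)) [dF F'x]; split; first exact: dF.
  by rewrite -derive1E; exact: F'x.
have key c (h' : R -> R) (G : R -> R) : c < c + (b - a) ->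
    (forall x, c <= x <= c + (b - a) -> is_derive x 1 G (h' x)) ->
    (forall x, rcont h' x) ->
    rint c (c + (b - a)) h' = G (c + (b - a)) - G c.
  move=> cc GD h'c; rewrite /rint /Rintegral (@continuous_FTC2 R h' G) //.
  - by apply: contin_within => x _.
  - have Gc x : c <= x <= c + (b - a) -> {for x, continuous G}.
      by move=> /GD xx; apply/differentiable_continuous/derivable1_diffP; case: xx.
    split.
    + by move=> x; rewrite in_itv /= => /andP[/ltW c1 /ltW c2]; have [|//] := GD x; rewrite c1.
    + by apply: cvg_at_right_filter; apply: Gc; rewrite lexx ltW.
    + by apply: cvg_at_left_filter; apply: Gc; rewrite lexx andbT ltW.
  - move=> x; rewrite in_itv /= => /andP[/ltW c1 /ltW c2].
    by rewrite derive1E; have [|? ->] := GD x; rewrite ?c1.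
have -> : rint (a + t) (b + t) h = F (b + t) - F (a + t).
  have := key (a + t) h F; rewrite (_ : a + t + (b - a) = b + t); last by ring.
  apply => //; first by lra.
  by move=> x xx; apply: FD; apply: AB; right.
have := key a (fun x => h (x + t)) (fun x => F (x + t)).
rewrite (_ : a + (b - a) = b); last by ring.
apply => //.
- move=> x /andP[ax xb]; have Hx : is_derive (x + t) 1 F (h (x + t)).
    by apply/FD/AB; right; rewrite !lerD2r ax.
  have Ht : is_derive x 1 (fun y : R => y + t) 1.
    by rewrite -[1 in X in is_derive _ _ _ X]addr0; apply: is_deriveD.
  have := @is_derive1_comp R F (fun y => y + t) x _ _ Hx Ht.
  by rewrite mulr1.
- move=> x e e0; have [d d0 H] := hc (x + t) e e0; exists d => // y yx; apply: H.
  by rewrite opprD addrACA subrr addr0.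
Qed.

End integral.

Section complex_integral.
Variable R : realType.
Implicit Types (f g : R -> R[i]) (a b c t x y : R).

Definition ccont f x := forall e, 0 < e -> exists2 d : R, 0 < d &
  forall y, `|y - x| < d -> cabs (f y - f x) <= e.

Definition ccontin a b f := forall x, a <= x <= b -> ccont f x.

Lemma ccont_Re f x : ccont f x -> rcont (fun y => complex.Re (f y)) x.
Proof.
move=> fx e /fx[d d0 fd]; exists d => // y /fd; rewrite -cReB.
exact: le_trans (normRe_le _).
Qed.

Lemma ccont_Im f x : ccont f x -> rcont (fun y => complex.Im (f y)) x.
Proof.
move=> fx e /fx[d d0 fd]; exists d => // y /fd; rewrite -cImB.
exact: le_trans (normIm_le _).
Qed.

Lemma ccontD f g x : ccont f x -> ccont g x -> ccont (fun y => f y + g y) x.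
Proof.
move=> hx kx e e0; have e20 : 0 < e / 2 by rewrite divr_gt0.
have [d d0 H] := hx _ e20; have [d' d'0 K] := kx _ e20.
exists (Order.min d d') => [|y]; first by rewrite lt_min d0.
rewrite lt_min => /andP[/H yh /K yk].
have -> : f y + g y - (f x + g x) = (f y - f x) + (g y - g x) by ring.
by apply: le_trans (cabsD _ _) _; lra.
Qed.

Lemma ccont_cst (z : R[i]) x : ccont (fun=> z) x.
Proof. by move=> e e0; exists 1 => // y _; rewrite subrr cabs0 ltW. Qed.

Lemma ccontM f g x : ccont f x -> ccont g x -> ccont (fun y => f y * g y) x.
Proof.
move=> hx kx e e0; pose A := cabs (f x) + cabs (g x) + 1.
have A1 : 1 <= A by rewrite lerDr addr_ge0 ?cabs_ge0.
have A0 : 0 < A by apply: lt_le_trans A1.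
pose e1 := Order.min 1 (e / (2 * A)).
have e10 : 0 < e1 by rewrite lt_min ltr01 divr_gt0 // mulr_gt0.
have e11 : e1 <= 1 by rewrite ge_min lexx.
have e12 : 2 * A * e1 <= e by rewrite mulrC -ler_pdivlMr ?mulr_gt0 // ge_min lexx orbT.
have [d d0 H] := hx _ e10; have [d' d'0 K] := kx _ e10.
exists (Order.min d d') => [|y]; first by rewrite lt_min d0.
rewrite lt_min => /andP[/H yh /K yk].
have -> : f y * g y - f x * g x =
  (f y - f x) * (g y - g x) + (f x * (g y - g x) + (f y - f x) * g x) by ring.
apply: le_trans e12; apply: le_trans (cabsD _ _) _.
have := cabsD (f x * (g y - g x)) ((f y - f x) * g x); rewrite !cabsM.
move: (cabs_ge0 (f x)) (cabs_ge0 (g x)) (cabs_ge0 (f y - f x)) (cabs_ge0 (g y - g x)).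
rewrite /A in A0 *; move: (cabs (f x)) (cabs (g x)) yh yk => P Q.
move: (cabs _) (cabs _) (cabs _) => X Y Z X1 Y1 P0 Q0 X0 Y0 ZZ.
have h1 : Z * Y <= e1 by rewrite -[leRHS]mulr1 ler_pM // (le_trans Y1).
have h2 : P * Y <= P * e1 by rewrite ler_wpM2l.
have h3 : Z * Q <= e1 * Q by rewrite ler_wpM2r.
have h4 : 0 <= P * e1 by rewrite mulr_ge0 // ltW.
have h5 : 0 <= Q * e1 by rewrite mulr_ge0 // ltW.
lra.
Qed.

Lemma ccontZ f (z : R[i]) x : ccont f x -> ccont (fun y => z * f y) x.
Proof. by move=> fx; apply: ccontM => //; exact: ccont_cst. Qed.

Lemma ccontB f g x : ccont f x -> ccont g x -> ccont (fun y => f y - g y) x.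
Proof.
move=> fx gx; apply: ccontD => // e /gx[d d0 H]; exists d => // y /H.
by rewrite -opprD cabsN.
Qed.

Lemma ccont_conj f x : ccont f x -> ccont (fun y => (f y)^*%C) x.
Proof. by move=> fx e /fx[d d0 H]; exists d => // y /H; rewrite -raddfB cabs_conj. Qed.

Lemma ccontin_Re a b f : ccontin a b f -> contin a b (fun y => complex.Re (f y)).
Proof. by move=> fc x /fc; exact: ccont_Re. Qed.

Lemma ccontin_Im a b f : ccontin a b f -> contin a b (fun y => complex.Im (f y)).
Proof. by move=> fc x /fc; exact: ccont_Im. Qed.

Definition cint a b f : R[i] :=
  Complex (rint a b (fun x => complex.Re (f x))) (rint a b (fun x => complex.Im (f x))).

Lemma eq_cint a b f g : (forall x, a <= x <= b -> f x = g x) -> cint a b f = cint a b g.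
Proof. by move=> fg; congr Complex; apply: eq_rint => x /fg ->. Qed.

Lemma cintD a b f g : ccontin a b f -> ccontin a b g ->
  cint a b (fun x => f x + g x) = cint a b f + cint a b g.
Proof.
move=> fc gc; apply: cP; rewrite ?cReD ?cImD /= -rintD.
- by apply: eq_rint => x _; rewrite cReD.
- exact: ccontin_Re.
- exact: ccontin_Re.
- by apply: eq_rint => x _; rewrite cImD.
- exact: ccontin_Im.
- exact: ccontin_Im.
Qed.

Lemma cintZ a b f (z : R[i]) : ccontin a b f ->
  cint a b (fun x => z * f x) = z * cint a b f.
Proof.
move=> fc; have rf := ccontin_Re fc; have mf := ccontin_Im fc.
have cz k c : contin a b k -> contin a b (fun x => c * k x).
  by move=> kc x /kc; exact: rcontZ.
apply: cP.
  rewrite cReM /=.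
  rewrite -mulNr -!rintZ // -rintD; [|exact: cz|exact: cz].
  by apply: eq_rint => x _; rewrite cReM mulNr.
rewrite cImM /= -!rintZ // -rintD; [|exact: cz|exact: cz].
by apply: eq_rint => x _; rewrite cImM.
Qed.

Lemma cintB a b f g : ccontin a b f -> ccontin a b g ->
  cint a b (fun x => f x - g x) = cint a b f - cint a b g.
Proof.
move=> fc gc; rewrite -[- cint a b g]mulN1r -cintZ // -cintD //.
  by apply: eq_cint => x _; rewrite mulN1r.
by move=> x /gc; exact: ccontZ.
Qed.

Lemma cint_cst a b (z : R[i]) : a <= b -> cint a b (fun=> z) = z * (b - a)%:C%C.
Proof.
move=> ab; rewrite /cint !rint_cst //; apply: cP; rewrite ?cReM ?cImM /=; ring.
Qed.

Lemma cint_split a m b f : a <= m -> m <= b -> ccontin a b f ->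
  cint a b f = cint a m f + cint m b f.
Proof.
move=> am mb fc; apply: cP; rewrite ?cReD ?cImD /=; apply: rint_split => //.
  exact: ccontin_Re.
exact: ccontin_Im.
Qed.

(** Bounding real and imaginary parts separately costs a factor 2, which only enlarges later
    constants. *)
Lemma cabs_cint a b f (k : R -> R) : ccontin a b f -> contin a b k ->
  (forall x, a <= x <= b -> cabs (f x) <= k x) ->
  cabs (cint a b f) <= 2 * rint a b k.
Proof.
move=> fc kc fk; apply: le_trans (cabs_le_ReIm _) _.
rewrite mulr_natl mulr2n; apply: lerD; apply: norm_rint => //.
- exact: ccontin_Re.
- by move=> x /fk; apply: le_trans; exact: normRe_le.
- exact: ccontin_Im.
- by move=> x /fk; apply: le_trans; exact: normIm_le.
Qed.

Lemma cabs_cint_le a b f K : a <= b -> ccontin a b f ->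
  (forall x, a <= x <= b -> cabs (f x) <= K) ->
  cabs (cint a b f) <= 2 * K * (b - a).
Proof.
move=> ab fc fk; rewrite -mulrA -rint_cst //; apply: cabs_cint => //.
by move=> x _; apply: rcont_cst.
Qed.

Lemma cint_conj a b f : ccontin a b f ->
  cint a b (fun x => (f x)^*%C) = (cint a b f)^*%C.
Proof.
move=> fc; apply: cP.
  by apply: eq_rint => x _ /=; case: (f x).
rewrite /= -mulN1r -rintZ; last exact: ccontin_Im.
by apply: eq_rint => x _; rewrite mulN1r; case: (f x).
Qed.

End complex_integral.

(** * Cauchy's theorem for rectangles and Harnack estimates *)

Section goursat.
Variable R : realType.
Implicit Types (f : R[i] -> R[i]) (a b c d x y w h : R).

Definition cdiff f (z al : R[i]) := forall e, 0 < e -> exists2 r : R, 0 < r &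
  forall u, cabs u < r -> cabs (f (z + u) - f z - al * u) <= e * cabs u.

Lemma cdiff_cont f z al : cdiff f z al -> forall e, 0 < e -> exists2 r : R, 0 < r &
  forall v, cabs (v - z) < r -> cabs (f v - f z) <= e.
Proof.
move=> fz e e0; have [r r0 H] := fz 1 ltr01.
have A0 : 0 < 1 + cabs al by rewrite ltr_pwDl // cabs_ge0.
exists (Order.min r (e / (1 + cabs al))); first by rewrite lt_min r0 divr_gt0.
move=> v; rewrite lt_min ltr_pdivlMr // => /andP[vr ve].
have := H _ vr; rewrite [z + _]addrC subrK mul1r => H1.
have -> : f v - f z = (f v - f z - al * (v - z)) + al * (v - z) by ring.
apply: le_trans (cabsD _ _) _; rewrite cabsM; apply: le_trans (ltW ve); lra.
Qed.

Definition holoR f a b c d := forall x y, a <= x <= b -> c <= y <= d ->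
  exists al, cdiff f (Complex x y) al.

Lemma holoR_hor f a b c d y : holoR f a b c d -> c <= y <= d ->
  ccontin a b (fun x => f (Complex x y)).
Proof.
move=> H yy x xx e e0; have [al /cdiff_cont/(_ e e0)[r r0 K]] := H x y xx yy.
exists r => // s sx; apply: K; rewrite (_ : _ - _ = (s - x)%:C%C) ?cabsR //.
by apply: cP => /=; ring.
Qed.

Lemma holoR_ver f a b c d x : holoR f a b c d -> a <= x <= b ->
  ccontin c d (fun y => f (Complex x y)).
Proof.
move=> H xx y yy e e0; have [al /cdiff_cont/(_ e e0)[r r0 K]] := H x y xx yy.
exists r => // s sy; apply: K.
have -> : Complex x s - Complex x y = 'i%C * (s - y)%:C%C by apply: cP => /=; ring.
by rewrite cabsM cabs_i mul1r cabsR.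
Qed.

Lemma holoR_sub f a b c d a' b' c' d' : holoR f a b c d ->
  a <= a' -> b' <= b -> c <= c' -> d' <= d -> holoR f a' b' c' d'.
Proof.
move=> H aa bb cc dd x y /andP[x1 x2] /andP[y1 y2]; apply: H.
  by rewrite (le_trans aa) // (le_trans x2).
by rewrite (le_trans cc) // (le_trans y2).
Qed.

(** The integral of [f(z) dz] along the boundary of the rectangle, counterclockwise, with opposite
    sides paired. *)
Definition rectI f a b c d : R[i] :=
  cint a b (fun x => f (Complex x c) - f (Complex x d)) +
  'i%C * cint c d (fun y => f (Complex b y) - f (Complex a y)).

Lemma rectI_splitx f a m b c d : holoR f a b c d -> a <= m -> m <= b -> c <= d ->
  rectI f a b c d = rectI f a m c d + rectI f m b c d.
Proof.
move=> H am mb cd; have ab := le_trans am mb; rewrite /rectI (@cint_split _ a m b) //.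
  have -> : cint c d (fun y => f (Complex b y) - f (Complex a y)) =
    cint c d (fun y => f (Complex m y) - f (Complex a y)) +
    cint c d (fun y => f (Complex b y) - f (Complex m y)).
    rewrite -cintD; first by apply: eq_cint => x _; ring.
      by move=> y yy; apply: ccontB; apply: (holoR_ver H); rewrite ?lexx ?ab ?am.
    by move=> y yy; apply: ccontB; apply: (holoR_ver H); rewrite ?lexx ?ab ?am.
  ring.
by move=> x xx; apply: ccontB; apply: (holoR_hor H); rewrite ?lexx ?cd.
Qed.

Lemma rectI_splity f a b c m d : holoR f a b c d -> c <= m -> m <= d -> a <= b ->
  rectI f a b c d = rectI f a b c m + rectI f a b m d.
Proof.
move=> H cm md ab; have cd := le_trans cm md.
rewrite /rectI (@cint_split _ c m d) //.
  have -> : cint a b (fun x => f (Complex x c) - f (Complex x d)) =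
    cint a b (fun x => f (Complex x c) - f (Complex x m)) +
    cint a b (fun x => f (Complex x m) - f (Complex x d)).
    rewrite -cintD; first by apply: eq_cint => x _; ring.
      by move=> y yy; apply: ccontB; apply: (holoR_hor H); rewrite ?lexx ?cd ?cm.
    by move=> y yy; apply: ccontB; apply: (holoR_hor H); rewrite ?lexx ?cd ?cm.
  ring.
by move=> x xx; apply: ccontB; apply: (holoR_ver H); rewrite ?lexx ?ab.
Qed.

Lemma rectI_quarter f a c w h : 0 <= w -> 0 <= h ->
  holoR f a (a + w) c (c + h) ->
  exists a' c', [/\ a <= a', a' + w / 2 <= a + w, c <= c', c' + h / 2 <= c + h &
    cabs (rectI f a (a + w) c (c + h)) <=
    4 * cabs (rectI f a' (a' + w / 2) c' (c' + h / 2))].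
Proof.
move=> w0 h0 H; apply: contrapT => N.
have [w20 h20] : 0 <= w / 2 /\ 0 <= h / 2 by split; lra.
pose K := cabs (rectI f a (a + w) c (c + h)).
have [q1 q2 q3] : [/\ a + w / 2 <= a + w, c + h / 2 <= c + h & c <= c + h / 2].
  by split; lra.
have [q4 q5 q6] : [/\ c + h / 2 + h / 2 <= c + h, a <= a + w / 2 &
    a + w / 2 + w / 2 <= a + w] by split; lra.
have small a' c' : a <= a' -> a' + w / 2 <= a + w -> c <= c' -> c' + h / 2 <= c + h ->
    cabs (rectI f a' (a' + w / 2) c' (c' + h / 2)) < K / 4.
  move=> h1 h2 h3 h4; rewrite ltNge; apply/negP => h5; apply: N; exists a', c'.
  by split => //; rewrite -/K; lra.
have : K <= cabs (rectI f a (a + w / 2) c (c + h / 2)) +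
   cabs (rectI f a (a + w / 2) (c + h / 2) (c + h / 2 + h / 2)) +
   (cabs (rectI f (a + w / 2) (a + w / 2 + w / 2) c (c + h / 2)) +
   cabs (rectI f (a + w / 2) (a + w / 2 + w / 2) (c + h / 2) (c + h / 2 + h / 2))).
  have ew : a + w = a + w / 2 + w / 2 by lra.
  have eh : c + h = c + h / 2 + h / 2 by lra.
  rewrite /K (@rectI_splitx _ _ (a + w / 2)) //; try lra.
  rewrite (@rectI_splity _ _ _ _ (c + h / 2)); try lra; last first.
    by apply: holoR_sub H _ _ _ _; lra.
  rewrite (@rectI_splity _ (a + w / 2) _ _ (c + h / 2)); try lra; last first.
    by apply: holoR_sub H _ _ _ _; lra.
  rewrite -ew -eh.
  apply: le_trans (cabsD _ _) _.
  by apply: lerD; exact: cabsD.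
have s1 := small a c (lexx _) q1 (lexx _) q2.
have s2 := small a (c + h / 2) (lexx _) q1 q3 q4.
have s3 := small (a + w / 2) c q5 q6 (lexx _) q2.
have s4 := small (a + w / 2) (c + h / 2) q5 q6 q3 q4.
clear -s1 s2 s3 s4; move=> s; have : K < K by lra.
by rewrite ltxx.
Qed.

(** An affine function has zero boundary integral. Subtracting it from [f] changes the two paired
    integrands by the constants [K1] and [K2], whose contributions cancel, and leaves integrands of
    modulus at most [2 * e]. *)
Lemma rectI_local f a b c d x0 y0 al e : a <= b -> c <= d -> 0 <= e ->
  holoR f a b c d ->
  (forall x y, a <= x <= b -> c <= y <= d ->
    let u := Complex x y - Complex x0 y0 in
    cabs (f (Complex x y) - f (Complex x0 y0) - al * u) <= e) ->
  cabs (rectI f a b c d) <= 4 * e * ((b - a) + (d - c)).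
Proof.
move=> ab cd e0 H fe.
have aab : a <= a <= b by rewrite lexx.
have bab : a <= b <= b by rewrite lexx andbT.
have ccd : c <= c <= d by rewrite lexx.
have dcd : c <= d <= d by rewrite lexx andbT.
pose K1 := al * 'i%C * (c - d)%:C%C; pose K2 := al * (b - a)%:C%C.
have c1 : ccontin a b (fun x => f (Complex x c) - f (Complex x d)).
  by move=> x xx; apply: ccontB; apply: (holoR_hor H).
have c2 : ccontin c d (fun y => f (Complex b y) - f (Complex a y)).
  by move=> y yy; apply: ccontB; apply: (holoR_ver H).
have e1 : cint a b (fun x => f (Complex x c) - f (Complex x d)) =
   cint a b (fun x => f (Complex x c) - f (Complex x d) - K1) + K1 * (b - a)%:C%C.
  rewrite -cint_cst // -cintD; first by apply: eq_cint => x _; ring.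
    by move=> x xx; apply: ccontB; [exact: c1|exact: ccont_cst].
  by move=> x xx; exact: ccont_cst.
have e2 : cint c d (fun y => f (Complex b y) - f (Complex a y)) =
   cint c d (fun y => f (Complex b y) - f (Complex a y) - K2) + K2 * (d - c)%:C%C.
  rewrite -cint_cst // -cintD; first by apply: eq_cint => x _; ring.
    by move=> x xx; apply: ccontB; [exact: c2|exact: ccont_cst].
  by move=> x xx; exact: ccont_cst.
have -> : rectI f a b c d = cint a b (fun x => f (Complex x c) - f (Complex x d) - K1) +
  'i%C * cint c d (fun y => f (Complex b y) - f (Complex a y) - K2).
  rewrite /rectI e1 e2 /K1 /K2 !rmorphB /=; ring.
apply: le_trans (cabsD _ _) _; rewrite cabsM cabs_i mul1r.
have two (z1 z2 z0 : R[i]) : cabs (z1 - z0) <= e -> cabs (z2 - z0) <= e -> cabs (z1 - z2) <= 2 * e.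
  by move=> h1 h2; have := cabs_dist z1 z2 z0; rewrite (cabsC z0 z2); lra.
have b1 : cabs (cint a b (fun x => f (Complex x c) - f (Complex x d) - K1)) <=
   2 * (2 * e) * (b - a).
  apply: cabs_cint_le => //.
    by move=> x xx; apply: ccontB; [exact: c1|exact: ccont_cst].
  move=> x xx; have := fe x c xx ccd; have := fe x d xx dcd => /= h1 h2.
  have -> : f (Complex x c) - f (Complex x d) - K1 =
     (f (Complex x c) - f (Complex x0 y0) - al * (Complex x c - Complex x0 y0)) -
     (f (Complex x d) - f (Complex x0 y0) - al * (Complex x d - Complex x0 y0)).
    have -> : K1 = al * ((Complex x c - Complex x0 y0) - (Complex x d - Complex x0 y0)).
      by rewrite /K1 -mulrA; congr (_ * _); apply: cP => /=; ring.
    ring.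
  by apply: le_trans (cabsB _ _) _; lra.
have b2 : cabs (cint c d (fun y => f (Complex b y) - f (Complex a y) - K2)) <=
   2 * (2 * e) * (d - c).
  apply: cabs_cint_le => //.
    by move=> x xx; apply: ccontB; [exact: c2|exact: ccont_cst].
  move=> y yy; have := fe a y aab yy; have := fe b y bab yy => /= h1 h2.
  have -> : f (Complex b y) - f (Complex a y) - K2 =
     (f (Complex b y) - f (Complex x0 y0) - al * (Complex b y - Complex x0 y0)) -
     (f (Complex a y) - f (Complex x0 y0) - al * (Complex a y - Complex x0 y0)).
    have -> : K2 = al * ((Complex b y - Complex x0 y0) - (Complex a y - Complex x0 y0)).
      by rewrite /K2; congr (_ * _); apply: cP => /=; ring.
    ring.
  by apply: le_trans (cabsB _ _) _; lra.
lra.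
Qed.

Lemma nested_common_point (a l : nat -> R) : (forall n, a n <= a n.+1) ->
  (forall n, a n.+1 + l n.+1 <= a n + l n) -> (forall n, 0 <= l n) ->
  exists x, forall n, a n <= x <= a n + l n.
Proof.
move=> aS lS l0.
have mon n k : a n <= a (n + k)%N.
  by elim: k => [|k IH]; rewrite ?addn0 // addnS (le_trans IH).
have dec n k : a (n + k)%N + l (n + k)%N <= a n + l n.
  by elim: k => [|k IH]; rewrite ?addn0 // addnS (le_trans (lS _)).
have am n m : a n <= a m + l m.
  have [nm|/ltnW mn] := leqP n m.
    by rewrite -(subnKC nm) (le_trans (mon n (m - n)%N)) // lerDl.
  by apply: le_trans (dec m (n - m)%N); rewrite subnKC // lerDl.
have hs : has_sup (range a).
  by split; [exists (a 0%N); exists 0%N|exists (a 0%N + l 0%N) => _ [n _ <-]].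
exists (sup (range a)) => n; rewrite sup_upper_bound ?ge_sup //.
- by case: hs.
- by move=> _ [m _ <-].
Qed.

(** Quadrisection: the factor [4 ^+ n] lost after [n] steps is recovered because the first-order
    remainder and the perimeter both shrink like [2 ^- n]. Rectangles of zero width or height are
    allowed. *)
Theorem goursat f a b c d : a <= b -> c <= d -> holoR f a b c d -> rectI f a b c d = 0.
Proof.
move=> ab cd H; pose w := b - a; pose h := d - c.
have w0 : 0 <= w by rewrite subr_ge0.
have h0 : 0 <= h by rewrite subr_ge0.
have p2 n : 0 < (2 ^+ n)^-1 :> R by rewrite invr_gt0 exprn_gt0.
pose Q n (s : R * R) := rectI f s.1 (s.1 + w / 2 ^+ n) s.2 (s.2 + h / 2 ^+ n).
pose ok n (s : R * R) := [/\ a <= s.1, s.1 + w / 2 ^+ n <= b, c <= s.2 & s.2 + h / 2 ^+ n <= d].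
have half (v : R) n : v / 2 ^+ n.+1 = v / 2 ^+ n / 2.
  by rewrite exprS [2 * _]mulrC invfM mulrA.
have step n s : exists s', ok n s ->
   [/\ ok n.+1 s', s.1 <= s'.1 /\ s'.1 + w / 2 ^+ n.+1 <= s.1 + w / 2 ^+ n,
     s.2 <= s'.2 /\ s'.2 + h / 2 ^+ n.+1 <= s.2 + h / 2 ^+ n &
     cabs (Q n s) <= 4 * cabs (Q n.+1 s')].
  have [oks|] := pselect (ok n s); last by exists s.
  have [ok1 ok2 ok3 ok4] := oks.
  have wn : 0 <= w / 2 ^+ n by rewrite mulr_ge0 // ltW.
  have hn : 0 <= h / 2 ^+ n by rewrite mulr_ge0 // ltW.
  have [a' [c' [h1 h2 h3 h4 h5]]] := @rectI_quarter f s.1 s.2 _ _ wn hn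
     (holoR_sub H ok1 ok2 ok3 ok4).
  exists (a', c') => _; rewrite /ok /Q !half /=; split => //.
  by split => //; lra.
have [g gP] := choice (fun ns : nat * (R * R) => step ns.1 ns.2).
pose S := fix S n := if n is m.+1 then g (m, S m) else (a, c).
have S0 : S 0%N = (a, c) by [].
have okS n : ok n (S n).
  elim: n => [|n IH]; last by case: (gP (n, S n) IH).
  by rewrite /ok S0 /= !expr0 !divr1 /w /h !addrA ![_ + _ - _]addrAC !subrr !add0r.
have SP n := gP (n, S n) (okS n).
have [x0 x0P] : exists x, forall n, (S n).1 <= x <= (S n).1 + w / 2 ^+ n.
  by apply: nested_common_point => n; [case: (SP n) => _ [] //|case: (SP n) => _ [] //|rewrite mulr_ge0 // ltW].
have [y0 y0P] : exists y, forall n, (S n).2 <= y <= (S n).2 + h / 2 ^+ n.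
  by apply: nested_common_point => n; [case: (SP n) => _ _ [] //|case: (SP n) => _ _ [] //|rewrite mulr_ge0 // ltW].
have QS n : cabs (rectI f a b c d) <= 4 ^+ n * cabs (Q n (S n)).
  elim: n => [|n IH].
    by rewrite expr0 mul1r /Q S0 /= !divr1 /w /h !addrA ![_ + _ - _]addrAC !subrr !add0r.
  apply: le_trans IH _; rewrite exprSr -mulrA ler_wpM2l ?exprn_ge0 //.
  by case: (SP n).
have [al fal] : exists al, cdiff f (Complex x0 y0) al.
  apply: H; first by have := x0P 0%N; rewrite S0 /= divr1 /w addrC subrK.
  by have := y0P 0%N; rewrite S0 /= divr1 /h addrC subrK.
pose B := w + h; have B0 : 0 <= B by rewrite addr_ge0.
suff key e : 0 < e -> cabs (rectI f a b c d) <= 4 * e * B ^+ 2.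
  apply: csmall_eq0 => e e0; have B1 : 0 < 4 * B ^+ 2 + 1 by rewrite ltr_wpDl // mulr_ge0 ?sqr_ge0.
  apply: le_trans (key _ (divr_gt0 e0 B1)) _.
  rewrite -mulrA mulrCA -[leRHS](divfK (lt0r_neq0 B1)) ler_wpM2l //; first by rewrite divr_ge0 // ltW.
  by rewrite lerDl.
move=> e0; have [r r0 fr] := fal e e0.
have [n Bn] : exists n, B / 2 ^+ n < r.
  have [N Nr] := archi_inv (divr_gt0 r0 (ltr_pwDl ltr01 B0)); exists N.+1.
  apply: le_lt_trans (_ : (1 + B) / N.+1%:R < _); last first.
    by rewrite -ltr_pdivlMl ?ltr_pwDl // mulrC.
  apply: ler_pM; rewrite ?invr_ge0 ?exprn_ge0 //; first by rewrite lerDr.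
  rewrite lef_pV2 ?posrE ?exprn_gt0 ?ltr0n // -natrX ler_nat ltnW //.
  exact: ltn_expl.
have [ok1 ok2 ok3 ok4] := okS n.
have wn : 0 <= w / 2 ^+ n by rewrite mulr_ge0 // ltW.
have hn : 0 <= h / 2 ^+ n by rewrite mulr_ge0 // ltW.
have BE : B / 2 ^+ n = w / 2 ^+ n + h / 2 ^+ n by rewrite mulrDl.
have loc : cabs (Q n (S n)) <= 4 * (e * (B / 2 ^+ n)) * (B / 2 ^+ n).
  rewrite /Q [X in _ <= _ * X](_ : _ = (S n).1 + w / 2 ^+ n - (S n).1 +
     ((S n).2 + h / 2 ^+ n - (S n).2)); last by rewrite BE; ring.
  apply: (@rectI_local _ _ _ _ _ x0 y0 al); rewrite ?lerDl //.
  - by rewrite mulr_ge0 ?(ltW e0) // mulr_ge0 // ltW.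
  - exact: holoR_sub H ok1 ok2 ok3 ok4.
  - move=> x y /andP[x1 x2] /andP[y1 y2]; cbv zeta; set u := Complex x y - _.
    have uB : cabs u <= B / 2 ^+ n.
      apply: le_trans (cabs_le_ReIm _) _; rewrite /u /= BE.
      have /andP[? ?] := x0P n; have /andP[? ?] := y0P n.
      by apply: lerD; rewrite ler_norml; apply/andP; split; lra.
    have uE : Complex x0 y0 + u = Complex x y by rewrite /u [_ + (_ - _)]addrC subrK.
    have := fr u (le_lt_trans uB Bn); rewrite uE => /le_trans; apply.
    by rewrite ler_pM2l.
apply: le_trans (QS n) _; apply: le_trans (ler_wpM2l _ loc) _; first exact: exprn_ge0.
rewrite le_eqVlt; apply/orP; left; apply/eqP.
have -> : (4 : R) ^+ n = 2 ^+ n * 2 ^+ n by rewrite -exprMn; congr (_ ^+ _); ring.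
by field; rewrite expf_neq0 // pnatr_eq0.
Qed.

End goursat.

(** * Calculus of one-variable complex derivatives *)

Section cdiff_theory.
Variable R : realType.
Implicit Types (f g : R[i] -> R[i]) (z u v al be : R[i]).

Lemma cdiff_cst (c : R[i]) z : cdiff (fun=> c) z 0.
Proof.
move=> e e0; exists 1 => // u _.
by rewrite subrr mul0r subrr cabs0 mulr_ge0 ?cabs_ge0 // ltW.
Qed.

Lemma cdiff_id z : cdiff id z 1.
Proof.
move=> e e0; exists 1 => // u _.
have -> : z + u - z - 1 * u = 0 by ring.
by rewrite cabs0 mulr_ge0 ?cabs_ge0 // ltW.
Qed.

Lemma cdiffD f g z al be : cdiff f z al -> cdiff g z be ->
  cdiff (fun w => f w + g w) z (al + be).
Proof.
move=> fz gz e e0; have e20 : 0 < e / 2 by rewrite divr_gt0.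
have [r r0 H] := fz _ e20; have [r' r'0 K] := gz _ e20.
exists (Order.min r r') => [|u]; first by rewrite lt_min r0.
rewrite lt_min => /andP[/H h /K k].
have -> : f (z + u) + g (z + u) - (f z + g z) - (al + be) * u =
  (f (z + u) - f z - al * u) + (g (z + u) - g z - be * u) by ring.
apply: le_trans (cabsD _ _) _; lra.
Qed.

Lemma cdiff_comp f g z al be : cdiff f z al -> cdiff g (f z) be ->
  cdiff (fun w => g (f w)) z (be * al).
Proof.
move=> fz gz e e0.
have A0 : 0 < 1 + cabs al by rewrite ltr_pwDl // cabs_ge0.
have B0 : 0 < 1 + cabs be by rewrite ltr_pwDl // cabs_ge0.
have [r r0 H] := gz (e / 2 / (1 + cabs al)) ltac:(by rewrite !divr_gt0).
have [r1 r10 K1] := fz 1 ltr01.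
have [r2 r20 K2] := fz (e / 2 / (1 + cabs be)) ltac:(by rewrite !divr_gt0).
exists (Order.min r1 (Order.min r2 (r / (1 + cabs al)))).
  by rewrite !lt_min r10 r20 divr_gt0.
move=> u; rewrite !lt_min ltr_pdivlMr // => /and3P[ur1 ur2 ur].
set v := f (z + u) - f z.
have vu : cabs v <= (1 + cabs al) * cabs u.
  have -> : v = (f (z + u) - f z - al * u) + al * u by rewrite /v; ring.
  by apply: le_trans (cabsD _ _) _; rewrite cabsM; have := K1 _ ur1; lra.
have vr : cabs v < r by apply: le_lt_trans vu _; rewrite mulrC.
have fE : f (z + u) = f z + v by rewrite /v; ring.
have := H v vr; rewrite fE => Hv.
have -> : g (f z + v) - g (f z) - be * al * u =
  (g (f z + v) - g (f z) - be * v) + be * (f (z + u) - f z - al * u).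
  by rewrite -/v; ring.
apply: le_trans (cabsD _ _) _; rewrite cabsM.
have k1 : e / 2 / (1 + cabs al) * cabs v <= e / 2 * cabs u.
  have -> : e / 2 * cabs u = e / 2 / (1 + cabs al) * ((1 + cabs al) * cabs u).
    by rewrite [RHS]mulrA divfK // gt_eqF.
  by rewrite ler_wpM2l // !divr_ge0 // ltW.
have k2 : cabs be * cabs (f (z + u) - f z - al * u) <= e / 2 * cabs u.
  apply: (@le_trans _ _ ((1 + cabs be) * (e / 2 / (1 + cabs be) * cabs u))).
    by apply: ler_pM; rewrite ?cabs_ge0 ?lerDr ?K2.
  by rewrite mulrA mulrC [_ * (e / 2 / _)]mulrC divfK ?gt_eqF // mulrC.
lra.
Qed.

Lemma cdiffZ f z al (c : R[i]) : cdiff f z al -> cdiff (fun w => c * f w) z (c * al).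
Proof.
move=> fz; apply: (cdiff_comp (g := fun w => c * w)) => // e e0.
exists 1 => // u _; have -> : c * (f z + u) - c * f z - c * u = 0 by ring.
by rewrite cabs0 mulr_ge0 ?cabs_ge0 // ltW.
Qed.

Lemma cdiff_sqr z : cdiff (fun w => w * w) z (2 * z).
Proof.
move=> e e0; exists e => // u ue.
have -> : (z + u) * (z + u) - z * z - 2 * z * u = u * u by ring.
by rewrite cabsM ler_wpM2r ?cabs_ge0 // ltW.
Qed.

(** By polarisation from [cdiff_sqr]: a product is a quarter of the difference between the square of
    the sum and the square of the difference. *)
Lemma cdiffM f g z al be : cdiff f z al -> cdiff g z be ->
  cdiff (fun w => f w * g w) z (al * g z + f z * be).
Proof.
move=> fz gz.
have s1 := cdiffZ (1 / 4) (cdiff_comp (cdiffD fz gz) (cdiff_sqr (f z + g z))).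
have s2 := cdiffZ (- (1 / 4)) (cdiff_comp (cdiffD fz (cdiffZ (- 1) gz)) (cdiff_sqr (f z + - 1 * g z))).
have := cdiffD s1 s2.
have -> : (fun w => 1 / 4 * ((f w + g w) * (f w + g w)) +
   - (1 / 4) * ((f w + -1 * g w) * (f w + -1 * g w))) = (fun w => f w * g w).
  by apply: funext => w; field.
by have -> : 1 / 4 * (2 * (f z + g z) * (al + be)) +
   - (1 / 4) * (2 * (f z + -1 * g z) * (al + -1 * be)) = al * g z + f z * be by field.
Qed.

Lemma cdiff_cexp z : cdiff (@cexp R) z (cexp z).
Proof.
move=> e e0; have E0 := expR_gt0 (complex.Re z).
exists (Order.min (1 / 2) (e / (6 * expR (complex.Re z)))).
  by rewrite lt_min !divr_gt0 // mulr_gt0.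
move=> u; rewrite lt_min => /andP[/ltW u2]; rewrite ltr_pdivlMr ?mulr_gt0 // => ue.
have -> : cexp (z + u) - cexp z - cexp z * u = cexp z * (cexp u - 1 - u).
  by rewrite cexpD; ring.
rewrite cabsM cabs_cexp.
apply: le_trans (ler_wpM2l (ltW E0) (cexp_order2 u2)) _.
rewrite -mulr_natr; have := cabs_ge0 u; nra.
Qed.

Lemma cdiff_ext f g z al (r : R) : 0 < r ->
  (forall w, cabs (w - z) < r -> f w = g w) -> cdiff f z al -> cdiff g z al.
Proof.
move=> r0 fg fz e e0; have [r' r'0 H] := fz e e0.
exists (Order.min r r') => [|u]; first by rewrite lt_min r0.
rewrite lt_min => /andP[ur /H]; rewrite !fg //; first by rewrite subrr cabs0.
by rewrite addrAC subrr add0r.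
Qed.

End cdiff_theory.

(** * Circle means and the gradient bound for functions with nonnegative real part *)

Section harnack.
Variable R : realType.
Implicit Types (F V : R[i] -> R[i]).

Definition holoD V (z0 : R[i]) (r : R) :=
  forall z, cabs (z - z0) <= r -> exists al, cdiff V z al.

(** Written as the exponential of a point on a vertical line, so that annuli become rectangles to
    which [goursat] applies. *)
Definition rot (r th : R) : R[i] := cexp (Complex (ln r) th).

Lemma cabs_rot r th : 0 < r -> cabs (rot r th) = r.
Proof. by move=> r0; rewrite cabs_cexp /= lnK. Qed.

Lemma rot_cont r th : ccont (rot r) th.
Proof.
move=> e e0; have [d d0 H] := cdiff_cont (cdiff_cexp (Complex (ln r) th)) e0.
exists d => // y yd; apply: H.
have -> : Complex (ln r) y - Complex (ln r) th = 'i%C * (y - th)%:C%C.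
  by apply: cP => /=; ring.
by rewrite cabsM cabs_i mul1r cabsR.
Qed.

(** The exponential maps a rectangle onto the annulus between the radii [s] and [r], and the
    horizontal sides cancel by periodicity; so [goursat] makes the circle mean independent of the
    radius, and [s] tends to 0. Only a limit [L] at 0 is asked for, so that difference quotients are
    covered. *)
Lemma circle_mean F (r : R) (L : R[i]) : 0 < r ->
  (forall z, z != 0 -> cabs z <= r -> exists al, cdiff F z al) ->
  (forall e, 0 < e -> exists2 d : R, 0 < d &
     forall z, z != 0 -> cabs z < d -> cabs (F z - L) <= e) ->
  cint 0 (pi *+ 2) (fun th => F (rot r th)) = L * (pi *+ 2)%:C%C.
Proof.
move=> r0 FH FL; set p2 : R := pi *+ 2.
have p20 : 0 <= p2 by rewrite mulrn_wge0 // pi_ge0.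
have key s : 0 < s -> s <= r ->
   cint 0 p2 (fun th => F (rot r th)) = cint 0 p2 (fun th => F (rot s th)).
  move=> s0 sr.
  have H : holoR (fun w => F (cexp w)) (ln s) (ln r) 0 p2.
    move=> x y /andP[x1 x2] _.
    have [|be Hb] := FH (cexp (Complex x y)) (cexp_neq0 _).
      by rewrite cabs_cexp /= -(lnK (r0 : r \is Num.pos)) ler_expR.
    by exists (be * cexp (Complex x y)); apply: cdiff_comp => //; exact: cdiff_cexp.
  have sr' : ln s <= ln r by rewrite ler_ln.
  have c1 := holoR_ver H (introT andP (conj sr' (lexx _))).
  have c2 := holoR_ver H (introT andP (conj (lexx _) sr')).
  have := goursat sr' p20 H; rewrite /rectI.
  have -> : cint (ln s) (ln r) (fun x => F (cexp (Complex x 0)) - F (cexp (Complex x p2))) = 0.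
    rewrite (_ : (fun _ => _) = (fun=> 0)); first by rewrite cint_cst // mul0r.
    apply: funext => x; apply/eqP; rewrite subr_eq0; apply/eqP; congr F.
    by rewrite /cexp /= cos2pi sin2pi cos0 sin0.
  rewrite add0r; set D := cint _ _ _ => h.
  have : D = 0 by apply/eqP; rewrite -cabs_eq0 -[cabs D]mul1r -(cabs_i R) -cabsM h cabs0.
  by rewrite /D cintB => [/eqP||]; [rewrite subr_eq0 => /eqP|exact: c1|exact: c2].
apply/eqP; rewrite -subr_eq0; apply/eqP/csmall_eq0 => e e0.
have P0 : 0 < 2 * p2 + 1 by rewrite ltr_wpDl // mulr_ge0.
have [d d0 Fd] := FL _ (divr_gt0 e0 P0).
pose s := Order.min r (d / 2).
have s0 : 0 < s by rewrite lt_min r0 divr_gt0.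
have sr : s <= r by rewrite ge_min lexx.
have sd : s < d by rewrite /s gt_min; apply/orP; right; lra.
have cs : ccontin 0 p2 (fun th => F (rot s th)).
  move=> th _ e' e'0; have [al Ha] := FH (rot s th) (cexp_neq0 _) ltac:(by rewrite cabs_rot).
  have [d1 d10 H1] := cdiff_cont Ha e'0.
  have [d2 d20 H2] := @rot_cont s th (d1 / 2) ltac:(by rewrite divr_gt0).
  by exists d2 => // y /H2 h; apply: H1; apply: le_lt_trans h _; lra.
have := cint_cst L p20; rewrite subr0 (key s s0 sr) => <-.
rewrite -cintB; [|exact: cs|by move=> *; exact: ccont_cst].
rewrite -[leRHS](divfK (lt0r_neq0 P0)).
apply: (@le_trans _ _ (2 * (e / (2 * p2 + 1)) * (p2 - 0))).
  apply: cabs_cint_le => //.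
    by move=> x xx; apply: ccontB; [exact: cs|exact: ccont_cst].
  by move=> x _; apply: Fd; rewrite ?cabs_rot // cexp_neq0.
rewrite subr0 -mulrA mulrCA ler_wpM2l ?lerDl //.
by rewrite divr_ge0 // ltW.
Qed.

(** Against the weight [1 / rot], the circle mean of [V - V z0] is [al], while constants and the
    conjugate of [V] have mean zero. So [al] is the mean of [2 Re V / rot], of modulus at most
    [2 / r] times the mean of [Re V] because [Re V] is nonnegative; the factor 2 of [cabs_cint]
    makes it 4. *)
Lemma gradient_bound V z0 (r : R) al : 0 < r -> holoD V z0 r ->
  (forall z, cabs (z - z0) <= r -> 0 <= complex.Re (V z)) ->
  cdiff V z0 al -> cabs al <= 4 * complex.Re (V z0) / r.
Proof.
move=> r0 VH Vpos Val; set p2 : R := pi *+ 2.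
have p20 : 0 < p2 by rewrite mulrn_wgt0 // pi_gt0.
have sh z : cdiff (fun w => z0 + w) z 1.
  by rewrite -[1]add0r; apply: cdiffD; [exact: cdiff_cst|exact: cdiff_id].
have VH' z : cabs z <= r -> exists al, cdiff (fun w => V (z0 + w)) z al.
  move=> zr; have [be Hb] := VH (z0 + z) ltac:(by rewrite addrAC subrr add0r).
  by exists (be * 1); apply: cdiff_comp.
have V0 : cdiff (fun w => V (z0 + w)) 0 al.
  by rewrite -[al]mulr1; apply: cdiff_comp => //; rewrite addr0.
have rotN th : rot r th != 0 := cexp_neq0 _.
have cV : ccontin 0 p2 (fun th => V (z0 + rot r th)).
  move=> th _ e e0; have [be Hb] := VH' (rot r th) ltac:(by rewrite cabs_rot).
  have [d1 d10 H1] := cdiff_cont Hb e0.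
  have [d2 d20 H2] := @rot_cont r th (d1 / 2) ltac:(by rewrite divr_gt0).
  by exists d2 => // y /H2 h; apply: H1; apply: le_lt_trans h _; lra.
have cr : ccontin 0 p2 (rot r) by move=> x _; exact: rot_cont.
pose ir th : R[i] := (rot r th)^-1.
have irE th : ir th = (r ^- 2)%:C%C * (rot r th)^*%C.
  apply: (mulfI (rotN th)); rewrite /ir divff // mulrCA mulcJ cabs_rot //.
  by rewrite -rmorphM /= mulVf // expf_neq0 // gt_eqF.
have cir : ccontin 0 p2 ir.
  move=> x xx; rewrite (_ : ir = fun th => (r ^- 2)%:C%C * (rot r th)^*%C).
    by apply/ccontZ/ccont_conj/cr.
  by apply: funext.
have m0 : cint 0 p2 (fun th => V (z0 + rot r th)) = V z0 * p2%:C%C.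
  apply: (circle_mean (F := fun w => V (z0 + w)) r0) => [z _|e e0]; first exact: VH'.
  have [d d0 H] := cdiff_cont V0 e0; exists d => // z _ zd.
  by rewrite -{2}[z0]addr0; apply: H; rewrite subr0.
have mE : cint 0 p2 (rot r) = 0.
  rewrite (@circle_mean id r 0) ?mul0r // => [z _ _|e e0]; first by exists 1; exact: cdiff_id.
  by exists e => // z _ /ltW; rewrite subr0.
have m1 : cint 0 p2 (fun th => V (z0 + rot r th) * rot r th) = 0.
  rewrite (@circle_mean (fun w => V (z0 + w) * w) r 0) ?mul0r // => [z _ zr|e e0].
    have [be Hb] := VH' z zr.
    by exists (be * z + V (z0 + z) * 1); apply: cdiffM => //; exact: cdiff_id.
  have [d d0 H] := cdiff_cont (cdiffM V0 (@cdiff_id R 0)) e0; exists d => // z _ zd.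
  by have := H z; rewrite mulr0 !subr0; apply.
have mi : cint 0 p2 ir = 0.
  rewrite (eq_cint (g := fun th => (r ^- 2)%:C%C * (rot r th)^*%C)); last by move=> x _; exact: irE.
  rewrite cintZ; last by move=> x xx; apply/ccont_conj/cr.
  by rewrite cint_conj // mE conjc0 mulr0.
(* On the circle [ir] is [r ^- 2] times the conjugate of [rot r], so this integral is a multiple of
   the conjugate of the one in [m1]. Hence the conjugate of [V] can be added freely, and only the
   real part of [V] remains. *)
have mJ : cint 0 p2 (fun th => (V (z0 + rot r th))^*%C * ir th) = 0.
  rewrite (eq_cint (g := fun th => (r ^- 2)%:C%C * (V (z0 + rot r th) * rot r th)^*%C)).
    rewrite cintZ; last by move=> x xx; apply/ccont_conj/ccontM; [exact: cV|exact: cr].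
    rewrite cint_conj; last by move=> x xx; apply/ccontM; [exact: cV|exact: cr].
    by rewrite m1 conjc0 mulr0.
  by move=> x _; rewrite irE rmorphM /=; ring.
have mD : cint 0 p2 (fun th => (V (z0 + rot r th) - V z0) * ir th) = al * p2%:C%C.
  apply: (circle_mean (F := fun w => (V (z0 + w) - V z0) / w) r0) => [z z_neq0 zr|e e0].
    have [be Hb] := VH' z zr.
    have inv : cdiff (fun w : R[i] => w^-1) z (- z ^- 2).
      have z0' : 0 < cabs z by rewrite cabs_gt0.
      move=> e e0; exists (Order.min (cabs z / 2) (e * cabs z ^+ 3 / 2)).
        by rewrite lt_min !divr_gt0 // mulr_gt0 // exprn_gt0.
      move=> u; rewrite lt_min => /andP[u1 u2].
      have zu : cabs z / 2 <= cabs (z + u).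
        by have := cabs_lB z (- u); rewrite opprK cabsN; lra.
      have zu0 : z + u != 0 by rewrite -cabs_gt0; apply: lt_le_trans zu; rewrite divr_gt0.
      have -> : (z + u)^-1 - z^-1 - - z ^- 2 * u = u * u / (z ^+ 2 * (z + u)).
        by field; rewrite zu0 z_neq0.
      rewrite !cabsM cabsV cabsM cabsX -mulrA mulrC ler_wpM2r ?cabs_ge0 //.
      rewrite ler_pdivrMr; last by rewrite mulr_gt0 ?exprn_gt0 // (lt_le_trans _ zu) // divr_gt0.
      apply: le_trans (ltW u2) _.
      rewrite -[leLHS]mulrA ler_pM2l // exprSr -mulrA ler_pM2l ?exprn_gt0 //.
    exists ((be + 0) * z^-1 + (V (z0 + z) - V z0) * (- z ^- 2)).
    by apply: cdiffM => //; apply: cdiffD => //; exact: cdiff_cst.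
  have [d d0 H] := V0 e e0; exists d => // z z_neq0 zd.
  have := H z zd; rewrite add0r addr0 => Hz.
  have -> : (V (z0 + z) - V z0) / z - al = (V (z0 + z) - V z0 - al * z) / z.
    by field.
  by rewrite cabsM cabsV ler_pdivrMr // cabs_gt0.
pose G th := (V (z0 + rot r th) + (V (z0 + rot r th))^*%C) * ir th.
have cG : ccontin 0 p2 G.
  move=> x xx; apply: ccontM; last exact: cir.
  by apply: ccontD; [exact: cV|apply/ccont_conj/cV].
have mG : cint 0 p2 G = al * p2%:C%C.
  have c1 : ccontin 0 p2 (fun th => (V (z0 + rot r th) - V z0) * ir th).
    move=> x xx; apply: ccontM; last exact: cir.
    by apply: ccontB; [exact: cV|exact: ccont_cst].
  have c2 : ccontin 0 p2 (fun th => (V (z0 + rot r th))^*%C * ir th).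
    by move=> x xx; apply: ccontM; [apply/ccont_conj/cV|exact: cir].
  have c3 : ccontin 0 p2 (fun th => V z0 * ir th).
    by move=> x xx; apply/ccontZ/cir.
  rewrite -[RHS]addr0 -[X in _ = _ + X]addr0 -{1}mJ -(mulr0 (V z0)) -mi -mD.
  rewrite -cintZ // -!cintD //; first by apply: eq_cint => x _; rewrite /G; ring.
  by move=> x xx; apply: ccontD; [exact: c2|exact: c3].
have Gb : cabs (cint 0 p2 G) <= 2 * rint 0 p2 (fun th => 2 / r * complex.Re (V (z0 + rot r th))).
  apply: cabs_cint => //.
    by move=> x xx; apply/rcontZ/ccont_Re/cV.
  move=> x _; rewrite /G cabsM /ir cabsV cabs_rot // addcJ cabsM cabs_nat cabsR.
  rewrite ger0_norm; last by rewrite Vpos // addrAC subrr add0r cabs_rot.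
  by rewrite mulrAC.
have RI : rint 0 p2 (fun th => complex.Re (V (z0 + rot r th))) = complex.Re (V z0) * p2.
  by have /(congr1 (@complex.Re R)) := m0; rewrite cReM /= mulr0 subr0.
move: Gb; rewrite mG cabsM cabsR (ger0_norm (ltW p20)) rintZ; last exact: ccontin_Re.
rewrite RI => h; rewrite -(ler_pM2r p20); apply: le_trans h _.
by rewrite le_eqVlt; apply/orP; left; apply/eqP; field; rewrite gt_eqF.
Qed.

End harnack.

Section strip.
Variable R : realType.

(** Cauchy's theorem leaves only the two vertical sides, so the bound does not grow with [S]. After
    division by the length of the segment, this forces means along parallel lines to agree. *)
Lemma strip_bound (g : R[i] -> R[i]) (h K S : R) : 0 <= h -> 0 <= S ->
  (forall s t, 0 <= t <= h -> exists al, cdiff g (Complex s t) al) ->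
  (forall s t, 0 <= t <= h -> cabs (g (Complex s t)) <= K) ->
  cabs (cint (- S) S (fun s => g (Complex s 0) - g (Complex s h))) <= 4 * K * h.
Proof.
move=> h0 S0 gH gK.
have SS : - S <= S by lra.
have H : holoR g (- S) S 0 h by move=> x y _; exact: gH.
have := goursat SS h0 H; rewrite /rectI => /eqP; rewrite addr_eq0 => /eqP ->.
rewrite cabsN cabsM cabs_i mul1r.
apply: (@le_trans _ _ (2 * (2 * K) * (h - 0))).
  apply: cabs_cint_le => // [y yh|y yh].
    by apply: ccontB; apply: (holoR_ver H); rewrite ?lexx ?SS.
  apply: le_trans (cabsB _ _) _; rewrite mulr_natl mulr2n; apply: lerD; exact: gK.
by rewrite subr0; lra.
Qed.

End strip.

(** * From local to uniform constants on compact sets *)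

Section compactness.
Variables (R : realType) (X : pseudoMetricType R).
Implicit Types (K : set X) (h : X -> R[i]).

(** The common principle behind several uniform bounds: [d] stands for a radius, a lower bound or
    the reciprocal of an upper bound, and all of these survive shrinking. *)
Lemma compact_uniform K (P : R -> X -> Prop) : compact K ->
  (forall d d' x, d' <= d -> P d x -> P d' x) ->
  (forall x, K x -> exists2 d : R, 0 < d & forall y, ball x d y -> P d y) ->
  exists2 d : R, 0 < d & forall x, K x -> P d x.
Proof.
move=> /compact_near_coveringP cK Pmon Ploc.
have : \forall d \near (0 : R)^'+, K `<=` P d.
  apply: cK => x Kx; have [d d0 H] := Ploc x Kx.
  exists (ball x d, [set d' : R | 0 < d' <= d]).
    split => /=; first exact: nbhsx_ballx.
    by apply: filterS2 (nbhs_right_gt (0 : R)) (nbhs_right_le d0) => e /= e0 ed; rewrite e0 ed.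
  by move=> [y d'] /= [/H Py /andP[_ d'd]]; apply: Pmon Py.
move=> H; have [d [d0 KP]] := filter_ex (filterI (nbhs_right_gt (0 : R)) H).
by exists d.
Qed.

Definition xcont h x := forall e, 0 < e -> exists2 d : R, 0 < d &
  forall y, ball x d y -> cabs (h y - h x) <= e.

Let ge_minl_ (a b : R) : Order.min a b <= a.
Proof. by rewrite ge_min lexx. Qed.

Lemma heine K h : compact K -> (forall x, K x -> xcont h x) ->
  forall e, 0 < e -> exists2 d : R, 0 < d &
  forall x y, K x -> ball x d y -> cabs (h y - h x) <= e.
Proof.
move=> cK hc e e0.
have [|x Kx|d d0 H] := @compact_uniform K
  (fun d x => forall y, ball x d y -> cabs (h y - h x) <= e) cK.
- by move=> d d' x dd H y xy; apply: H; exact: le_ball dd _ xy.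
- have [d d0 H] := hc x Kx (e / 2) ltac:(by rewrite divr_gt0).
  exists (d / 2) => [|y xy z yz]; first by rewrite divr_gt0.
  have xz : ball x d z by apply: ball_split xy yz.
  have xy' : ball x d y by apply: le_ball xy; lra.
  by have := cabs_dist (h z) (h y) (h x); have := H z xz; have := H y xy';
    rewrite (cabsC (h y)); lra.
- by exists d => // x y Kx; apply: H.
Qed.

Lemma compact_lower K h : compact K -> (forall x, K x -> xcont h x) ->
  (forall x, K x -> h x != 0) ->
  exists2 m : R, 0 < m & forall x, K x -> m <= cabs (h x).
Proof.
move=> cK hc h0; apply: (@compact_uniform K (fun m x => m <= cabs (h x))) => //.
  by move=> d d' x dd; exact: le_trans.
move=> x Kx; have hx : 0 < cabs (h x) by rewrite cabs_gt0 h0.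
have [d d0 H] := hc x Kx (cabs (h x) / 2) ltac:(by rewrite divr_gt0).
exists (Order.min d (cabs (h x) / 2)); first by rewrite lt_min d0 divr_gt0.
move=> y xy; have := H y (le_ball (ge_minl_ d _) xy).
have := cabs_lB (h x) (h y); rewrite cabsC => h1 h2.
by rewrite ge_min; apply/orP; right; lra.
Qed.

(** The upper bound is sought through its reciprocal [m], since [compact_uniform] asks for a
    property inherited by smaller values. *)
Lemma compact_upper K h : compact K -> (forall x, K x -> xcont h x) ->
  exists M : R, forall x, K x -> cabs (h x) <= M.
Proof.
move=> cK hc.
have [|x Kx|d d0 H] := @compact_uniform K (fun m x => cabs (h x) * m <= 1) cK.
- by move=> d d' x dd; apply: le_trans; rewrite ler_wpM2l ?cabs_ge0.
- have [d d0 H] := hc x Kx 1 ltr01.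
  have A0 : 0 < cabs (h x) + 1 by rewrite ltr_wpDl ?cabs_ge0.
  exists (Order.min d (cabs (h x) + 1)^-1); first by rewrite lt_min d0 invr_gt0.
  move=> y xy; have := H y (le_ball (ge_minl_ d _) xy).
  have := cabs_lB (h y) (h x) => h1 h2; rewrite -[leRHS](divff (lt0r_neq0 A0)).
  apply: ler_pM; rewrite ?cabs_ge0 ?ge_min ?lexx ?orbT //.
    by rewrite le_min (ltW d0) invr_ge0 ltW.
  lra.
- by exists d^-1 => x /H; rewrite -ler_pdivlMr // div1r.
Qed.

End compactness.

(** * Logarithms on rectangles and Harnack's inequality along a segment *)

Section rectangle_log.
Variable R : realType.
Implicit Types (phi : R[i] -> R[i]).

(** [clog] covers the right half-plane; the other points are brought there by rotations through [pi]
    or [pi / 2]. *)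
Lemma cexp_surj (w : R[i]) : w != 0 -> exists l, cexp l = w.
Proof.
case: w => a b w0.
have ci x : cexp (Complex 0 x) = Complex (cos x) (sin x).
  by rewrite /cexp /= expR0 !mul1r.
have pos (z : R[i]) : 0 < complex.Re z -> exists l, cexp l = z.
  by move=> /cexp_clog zz; exists (clog z).
have [a0|a0|a0] := ltrgtP a 0.
- have [l lE] := pos (Complex (- a) (- b)) ltac:(by rewrite /= oppr_gt0).
  exists (l + Complex 0 pi); rewrite cexpD lE ci cospi sinpi.
  by apply: cP; rewrite ?cReM ?cImM /=; ring.
- exact: (pos (Complex a b)).
- have [b0|b0|b0] := ltrgtP b 0.
  + have [l lE] := pos (Complex (- b) 0) ltac:(by rewrite /= oppr_gt0).
    exists (l - Complex 0 (pi / 2)); rewrite cexpB lE ci cos_pihalf sin_pihalf.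
    apply: (canLR (mulfK _)); first by rewrite eq_complex /= oner_eq0 andbF.
    by apply: cP; rewrite ?cReM ?cImM a0 /=; ring.
  + have [l lE] := pos (Complex b 0) b0.
    exists (l + Complex 0 (pi / 2)); rewrite cexpD lE ci cos_pihalf sin_pihalf.
    by apply: cP; rewrite ?cReM ?cImM a0 /=; ring.
  + by rewrite a0 b0 eqxx in w0.
Qed.

Lemma cdiff_clog1 : cdiff (@clog R) 1 1.
Proof.
move=> e e0; exists (Order.min (1 / 8) (e / 96)); first by rewrite lt_min !divr_gt0.
move=> u; rewrite lt_min => /andP[/ltW u8 ue].
have uE : 1 + u - 1 = u by ring.
have := @clog_order2 R (1 + u); rewrite uE => /(_ u8) H.
rewrite clog1 subr0 mul1r; apply: le_trans H _.
by have := cabs_ge0 u; rewrite exprSr; nra.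
Qed.

Lemma cdiff_local_log phi (L : R[i] -> R[i]) z al (d : R) : 0 < d -> phi z != 0 ->
  cdiff phi z al -> (forall w, cabs (w - z) < d -> L w = L z + clog (phi w / phi z)) ->
  cdiff L z (al / phi z).
Proof.
move=> d0 pz pd LE.
have H : cdiff (fun w => L z + clog ((phi z)^-1 * phi w)) z (0 + 1 * ((phi z)^-1 * al)).
  apply: cdiffD; first exact: cdiff_cst.
  apply: cdiff_comp; first exact: cdiffZ.
  by rewrite mulVf //; exact: cdiff_clog1.
rewrite (_ : al / _ = 0 + 1 * ((phi z)^-1 * al)); last by ring.
apply: cdiff_ext d0 _ H => w wd; rewrite (LE w wd).
by rewrite [(phi z)^-1 * _]mulrC.
Qed.

Definition inrect (a b c d : R) (z : R[i]) :=
  a <= complex.Re z <= b /\ c <= complex.Im z <= d.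

Lemma ball_cabs (z w : R[i]) (d : R) :
  `|complex.Re w - complex.Re z| < d / 2 -> `|complex.Im w - complex.Im z| < d / 2 ->
  cabs (w - z) < d.
Proof.
move=> h1 h2; apply: le_lt_trans (cabs_le_ReIm _) _; rewrite cReB cImB; lra.
Qed.

Lemma rect_uc phi a b c d : (forall z, inrect a b c d z -> exists al, cdiff phi z al) ->
  (forall e, 0 < e -> exists2 r : R, 0 < r & forall z w, inrect a b c d z ->
    cabs (w - z) < r -> cabs (phi w - phi z) <= e) /\
  ((forall z, inrect a b c d z -> phi z != 0) ->
   exists2 m : R, 0 < m & forall z, inrect a b c d z -> m <= cabs (phi z)).
Proof.
move=> H; pose h (u : R * R) := phi (Complex u.1 u.2).
pose K := `[a, b] `*` `[c, d] : set (R * R).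
have cK : compact K by apply: compact_setX; exact: segment_compact.
have Kin u : K u <-> inrect a b c d (Complex u.1 u.2).
  by rewrite /K /inrect /= !in_itv.
have hc u : K u -> xcont h u.
  move=> /Kin /H[al /cdiff_cont pc] e /pc[r r0 Hr]; exists (r / 2); first by rewrite divr_gt0.
  by move=> [y1 y2] [/= b1 b2]; apply: Hr; apply: ball_cabs; rewrite /= distrC.
split.
  move=> e /(heine cK hc)[r r0 Hr]; exists r => // -[z1 z2] [w1 w2] zin wz.
  apply: (Hr (z1, z2) (w1, w2)); first by apply/Kin.
  have := normRe_le (Complex w1 w2 - Complex z1 z2).
  have := normIm_le (Complex w1 w2 - Complex z1 z2).
  by move=> /= h1 h2; split => /=; rewrite /ball /= distrC (le_lt_trans _ wz).
move=> h0; have [m m0 Hm] := compact_lower cK hc (fun u Ku => h0 _ ((Kin u).1 Ku)).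
by exists m => // -[z1 z2] zin; apply: (Hm (z1, z2)); apply/Kin.
Qed.

(** A rectangle containing 0 is star-shaped about 0, so the logarithm is the lift along the rays
    [s * z]. The last clause, with one radius for the whole rectangle, carries the continuity of [L]
    and later its differentiability. *)
Lemma rect_log phi a b c d : a <= 0 <= b -> c <= 0 <= d ->
  (forall z, inrect a b c d z -> exists al, cdiff phi z al) ->
  (forall z, inrect a b c d z -> phi z != 0) ->
  exists L : R[i] -> R[i], (forall z, inrect a b c d z -> cexp (L z) = phi z) /\
   exists2 r : R, 0 < r & forall z w, inrect a b c d z -> inrect a b c d w ->
      cabs (w - z) < r -> L w = L z + clog (phi w / phi z).
Proof.
move=> ab cd pd p0; have [uc low] := rect_uc pd; have [m m0 pm] := low p0.
have star s z : 0 <= s <= 1 -> inrect a b c d z -> inrect a b c d (s%:C%C * z).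
  move=> /andP[s0 s1] [z1 z2]; rewrite /inrect cReM cImM /= !mul0r subr0 addr0.
  move: (complex.Re z) (complex.Im z) z1 z2 ab cd => x y.
  move=> /andP[? ?] /andP[? ?] /andP[? ?] /andP[? ?].
  by split; apply/andP; split; nra.
have in0 : inrect a b c d 0 by split.
have [l0 l0E] := cexp_surj (p0 0 in0).
have [|z zin|z zin|L [LE LC]] := @lift_family R R[i] (inrect a b c d)
    (fun z s => phi (s%:C%C * z)) (fun=> l0).
- move=> z zin e e0; have [r r0 H] := uc e e0.
  have A0 : 0 < cabs z + 1 by rewrite ltr_wpDl ?cabs_ge0.
  exists (r / (cabs z + 1)); first by rewrite divr_gt0.
  move=> s s' s01 s'01 ss; apply: H; first exact: star.
  rewrite -mulrBl -rmorphB cabsM cabsR; rewrite ltr_pdivlMr // in ss.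
  by apply: le_lt_trans ss; rewrite ler_wpM2l // lerDl.
- by exists m => // s s01; apply: pm; exact: star.
- by rewrite mul0r.
exists L; split => [z /LE ->|]; first by rewrite mul1r.
have [r r0 H] := uc (1 / 2 * m) ltac:(by rewrite !mulr_gt0).
exists r => // z w zin win wz.
have key s : 0 <= s <= 1 -> cabs (phi (s%:C%C * w) / phi (s%:C%C * z) - 1) <= 1 / 2.
  move=> s01; apply: (ratio_close m0); first by apply: pm; exact: star.
  apply: H; first exact: star.
  rewrite -mulrBr cabsM cabsR; apply: le_lt_trans wz.
  move/andP: s01 => [s0 s1]; rewrite ger0_norm //.
  by rewrite ler_piMl ?cabs_ge0.
have := LC z w zin win key; rewrite !mul1r; apply.
by rewrite !mul0r divff ?clog1 ?addr0 // p0.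
Qed.

Lemma is_derive_eps (v : R -> R) (s a : R) :
  (forall e, 0 < e -> exists2 d : R, 0 < d & forall h, `|h| < d ->
     `|v (s + h) - v s - a * h| <= e * `|h|) -> is_derive s 1 v a.
Proof.
move=> H; have cv : (fun h : R => h^-1 *: ((v \o shift s) (h *: 1) - v s)) @ 0^' --> a.
  apply/cvgrPdist_le => e e0; have [d d0 Hd] := H e e0.
  exists d => //= h; rewrite /= add0r normrN => hd h0.
  have := Hd h hd; rewrite [h *: 1]mulr1 -ler_pdivrMr ?normr_gt0 // => h1.
  rewrite distrC; apply: le_trans h1; rewrite -normfV -normrM /=.
  rewrite ?mulr1 [h + s]addrC.
  have -> : h^-1 *: (v (s + h) - v s) = (v (s + h) - v s) / h by exact: mulrC.
  by rewrite (_ : _ - a = (v (s + h) - v s - a * h) / h) //; field.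
by split; [apply/cvg_ex; exists a|apply: cvg_lim].
Qed.

(** The function [V = ln M - L] has nonnegative real part [v] on the segment, and [gradient_bound]
    gives [v' <= (4 / rho) v], so [exp(- 4 s / rho) v(s)] decreases from [s = 0] to [s = 1]. One
    half of the margin [2 * rho] holds the discs of the gradient bound, the other half keeps
    neighbourhoods of their points in the rectangle. *)
Lemma harnack_segment phi (rho M : R) : 0 < rho ->
  (forall z, inrect (- (2 * rho)) (1 + 2 * rho) (- (2 * rho)) (2 * rho) z ->
     [/\ exists al, cdiff phi z al, phi z != 0 & cabs (phi z) <= M]) ->
  ln M - ln (cabs (phi 1)) <= expR (4 / rho) * (ln M - ln (cabs (phi 0))).
Proof.
move=> rho0 H; set K := inrect _ _ _ _ in H.
have [||||L [LE [r r0 LC]]] := @rect_log phi (- (2 * rho)) (1 + 2 * rho) (- (2 * rho)) (2 * rho).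
- by apply/andP; split; lra.
- by apply/andP; split; lra.
- by move=> z /H[].
- by move=> z /H[].
pose V z := Complex (ln M) 0 - L z.
have lnE z : K z -> complex.Re (L z) = ln (cabs (phi z)).
  by move=> Kz; rewrite -LE // cabs_cexp expRK.
have VR z : K z -> complex.Re (V z) = ln M - ln (cabs (phi z)).
  by move=> Kz; rewrite cReB lnE.
have Vpos z : K z -> 0 <= complex.Re (V z).
  move=> Kz; have [_ p0 pM] := H z Kz; rewrite VR // subr_ge0 ler_ln ?posrE ?cabs_gt0 //.
  by apply: lt_le_trans pM; rewrite cabs_gt0.
have near1 (s : R) (w : R[i]) : 0 <= s <= 1 -> cabs (w - s%:C%C) < 2 * rho -> K w.
  move=> /andP[s0 s1] ws; have := le_lt_trans (normRe_le _) ws; have := le_lt_trans (normIm_le _) ws.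
  rewrite cReB cImB /= subr0 !ltr_norml => /andP[? ?] /andP[? ?].
  by split; apply/andP; split; lra.
have Vd (s : R) (z : R[i]) : 0 <= s <= 1 -> cabs (z - s%:C%C) <= rho -> exists al, cdiff V z al.
  move=> s01 zs; have Kz : K z by apply: near1 s01 _; lra.
  have [[al pal] p0 _] := H z Kz.
  exists (0 + -1 * (al / phi z)).
  rewrite /V (_ : (fun _ => _) = fun z => Complex (ln M) 0 + -1 * L z); last first.
    by apply: funext => w; ring.
  apply: cdiffD; first exact: cdiff_cst.
  apply: cdiffZ; apply: (@cdiff_local_log phi L z al (Order.min r rho)) => //.
    by rewrite lt_min r0.
  move=> w; rewrite lt_min => /andP[wr wrho]; apply: LC => //.
  by apply: near1 s01 _; apply: le_lt_trans (cabs_dist _ _ z) _; lra.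
pose v (s : R) := complex.Re (V s%:C%C).
have vd (s : R) : 0 <= s <= 1 -> exists2 a, is_derive s 1 v a & a <= 4 / rho * v s.
  move=> s01; have [al Val] := Vd s s%:C%C s01 ltac:(by rewrite subrr cabs0 ltW).
  exists (complex.Re al).
    apply: is_derive_eps => e e0; have [d d0 Hd] := Val e e0; exists d => // h hd.
    have := Hd h%:C%C; rewrite cabsR => /(_ hd); apply: le_trans.
    apply: le_trans (normRe_le _).
    rewrite [complex.Re (_ - al * _)]cReB [complex.Re (V _ - V _)]cReB cReM.
    by rewrite [complex.Im h%:C%C]/= mulr0 subr0 /v rmorphD.
  apply: le_trans (Re_le _) _; rewrite mulrAC.
  apply: (gradient_bound rho0 _ _ Val); first by move=> z; exact: Vd.
  by move=> z zs; apply/Vpos/(near1 s) => //; lra.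
pose k := 4 / rho; pose u (s : R) := expR (- k * s) * v s.
have k0 : 0 < k by rewrite divr_gt0.
have ud (s : R) : 0 <= s <= 1 -> exists2 a, is_derive s 1 u a & a <= 0.
  move=> /vd[a va ak]; exists (expR (- k * s) * a + v s * (- k * expR (- k * s))).
    have h1 : is_derive s 1 (fun s => - k * s) (- k).
      apply: is_derive_eps => e e0; exists 1 => // h _.
      rewrite (_ : _ - _ - _ = 0); last by ring.
      by rewrite normr0 mulr_ge0 // ltW.
    have h2 : is_derive s 1 (fun s => expR (- k * s)) (- k * expR (- k * s)).
      rewrite mulrC; exact: (@is_derive1_comp R expR (fun s => - k * s) s _ _
        (is_derive_expR _) h1).
    exact: is_deriveM.
  have := expR_gt0 (- k * s); rewrite -/k in ak; nra.
have u01 : u 1 <= u 0.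
  have duP (s : R) : exists a, 0 <= s <= 1 -> is_derive s 1 u a /\ a <= 0.
    have [s01|] := pselect (is_true (0 <= s <= 1)); last by exists 0.
    by have [a h1 h2] := ud s s01; exists a.
  have [du Hdu] := choice duP.
  have uc : {within `[0, 1], continuous u}.
    apply: continuous_in_subspaceT => s /set_mem /=; rewrite in_itv /= => /Hdu[[? _] _].
    by apply/differentiable_continuous/derivable1_diffP.
  have [s|s] := @MVT R u du 0 1 ltr01 _ uc.
    by rewrite in_itv /= => /andP[/ltW s0 /ltW s1]; apply: (Hdu s _).1; rewrite s0.
  rewrite in_itv /= => /andP[/ltW s0 /ltW s1] E.
  have := (Hdu s ltac:(by rewrite s0)).2; move: E; rewrite subr0 mulr1 => <-; lra.
have K0 : K 0 by apply: (near1 0); rewrite ?lexx ?ler01 // subrr cabs0; lra.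
have K1 : K 1 by apply: (near1 1); rewrite ?lexx ?ler01 // subrr cabs0; lra.
rewrite -!VR //; move: u01; rewrite /u mulr0 expR0 mul1r mulr1 /v -/k.
have e0 := expR_gt0 k; rewrite expRN mulrC ler_pdivrMr // mulrC.
by rewrite rmorph0 rmorph1.
Qed.

End rectangle_log.

Section row_vector_norm.
Variables (R : realType) (p : nat).
Implicit Types x : 'rV[R]_p.

Lemma ler_coord_norm x j : `|x 0 j| <= `|x|.
Proof.
have -> : `|x| = mx_norm x by [].
rewrite mx_normrE.
exact: (le_bigmax _ (fun ij : 'I_1 * 'I_p => `|x ij.1 ij.2|) (0, j)).
Qed.

Lemma ler_norm_coord x e : 0 <= e -> (forall j, `|x 0 j| <= e) -> `|x| <= e.
Proof.
move=> e0 xe; have [->|n0] := eqVneq `|x| 0 => //.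
have [[i j] /= E] := mx_norm_neq0 n0; have -> : `|x| = mx_norm x by [].
rewrite E.
by rewrite (ord1 i) xe.
Qed.

End row_vector_norm.

(** * Averages and almost periodic functions *)

Section average.
Variables (R : realType) (J : finType).
Implicit Types (u v : J -> R[i]) (a b : J -> R).

Definition avgc u : R[i] := (#|J|%:R)^-1 * \sum_j u j.
Definition avgr a : R := (#|J|%:R)^-1 * \sum_j a j.

Lemma le_avgr a b : (forall j, a j <= b j) -> avgr a <= avgr b.
Proof. by move=> ab; rewrite ler_wpM2l ?invr_ge0 ?ler0n // ler_sum. Qed.

Lemma avgr_ge0 a : (forall j, 0 <= a j) -> 0 <= avgr a.
Proof. by move=> a0; rewrite mulr_ge0 ?invr_ge0 ?ler0n // sumr_ge0. Qed.

Lemma avgrD a b : avgr (fun j => a j + b j) = avgr a + avgr b.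
Proof. by rewrite /avgr big_split mulrDr. Qed.

Lemma avgrZ c a : avgr (fun j => c * a j) = c * avgr a.
Proof. by rewrite /avgr -big_distrr /= mulrCA. Qed.

Lemma avgr_cst c : (0 < #|J|)%N -> avgr (fun=> c) = c.
Proof.
by move=> J0; rewrite /avgr sumr_const -[c *+ _]mulr_natl mulKf // pnatr_eq0 -lt0n.
Qed.

Lemma avgr_le_cst a c : (0 < #|J|)%N -> (forall j, a j <= c) -> avgr a <= c.
Proof. by move=> J0 ac; rewrite -[leRHS](avgr_cst c J0) le_avgr. Qed.

Lemma avgcD u v : avgc (fun j => u j + v j) = avgc u + avgc v.
Proof. by rewrite /avgc big_split mulrDr. Qed.

Lemma avgcZ c u : avgc (fun j => c * u j) = c * avgc u.
Proof. by rewrite /avgc -big_distrr /= mulrCA. Qed.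

Lemma avgcB u v : avgc (fun j => u j - v j) = avgc u - avgc v.
Proof. by rewrite /avgc sumrB mulrBr. Qed.

Lemma avgc_cst c : (0 < #|J|)%N -> avgc (fun=> c) = c.
Proof.
by move=> J0; rewrite /avgc sumr_const -[c *+ _]mulr_natl mulKf // pnatr_eq0 -lt0n.
Qed.

Lemma cabs_avgc u : cabs (avgc u) <= avgr (fun j => cabs (u j)).
Proof.
rewrite /avgc /avgr cabsM cabsV cabs_nat ler_wpM2l ?invr_ge0 ?ler0n //.
exact: cabs_sum.
Qed.

Lemma cabs_avgc_le u c : (0 < #|J|)%N -> (forall j, cabs (u j) <= c) -> cabs (avgc u) <= c.
Proof. by move=> J0 uc; apply: le_trans (cabs_avgc u) _; exact: avgr_le_cst. Qed.

Lemma Re_avgc u : complex.Re (avgc u) = avgr (fun j => complex.Re (u j)).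
Proof.
rewrite /avgc /avgr -(rmorph_nat (real_complex R)) -fmorphV cReM /= mul0r subr0.
by rewrite cRe_sum.
Qed.

Lemma Im_avgc u : complex.Im (avgc u) = avgr (fun j => complex.Im (u j)).
Proof.
rewrite /avgc /avgr -(rmorph_nat (real_complex R)) -fmorphV cImM /= mul0r addr0.
by rewrite cIm_sum.
Qed.

End average.

Lemma avgc_exchange (R : realType) (I J : finType) (F : I -> J -> R[i]) :
  avgc (fun i => avgc (F i)) = avgc (fun j => avgc (F^~ j)).
Proof.
by rewrite /avgc -!big_distrr /= exchange_big /= mulrCA.
Qed.

Lemma avgr_exchange (R : realType) (I J : finType) (F : I -> J -> R) :
  avgr (fun i => avgr (F i)) = avgr (fun j => avgr (F^~ j)).
Proof.
by rewrite /avgr -!big_distrr /= exchange_big /= mulrCA.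
Qed.

Lemma ultra_limit (R : realType) (T : Type) (F : set_system T) (a : T -> R) (B : R) : UltraFilter F ->
  F [set t | `|a t| <= B] -> exists l, forall e : R, 0 < e -> F [set t | `|a t - l| <= e].
Proof.
move=> FU FB; have [|l [_ al]] := @segment_compact R (- B) B (a @ F) _.
  change (F (a @^-1` `[- B, B])); apply: filterS FB => t /=.
  by rewrite in_itv /= -ler_norml.
exists l => e e0; have [//|N] := in_ultra_setVsetC [set t | `|a t - l| <= e] FU.
have N' : (a @ F) [set x | ~ `|x - l| <= e] by exact: N.
have [x [/= h1]] := al _ _ N' (nbhsx_ballx l e e0).
by rewrite /ball /= distrC => /ltW /h1.
Qed.

Lemma ultra_climit (R : realType) (T : Type) (F : set_system T) (a : T -> R[i]) (B : R) : UltraFilter F ->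
  F [set t | cabs (a t) <= B] -> exists l, forall e : R, 0 < e -> F [set t | cabs (a t - l) <= e].
Proof.
move=> FU FB.
have [l1 h1] : exists l, forall e : R, 0 < e -> F [set t | `|complex.Re (a t) - l| <= e].
  by apply: (@ultra_limit _ _ _ _ B); apply: filterS FB => t; apply: le_trans (normRe_le _).
have [l2 h2] : exists l, forall e : R, 0 < e -> F [set t | `|complex.Im (a t) - l| <= e].
  by apply: (@ultra_limit _ _ _ _ B); apply: filterS FB => t; apply: le_trans (normIm_le _).
exists (Complex l1 l2) => e e0; have e20 : 0 < e / 2 by rewrite divr_gt0.
apply: filterS2 (h1 _ e20) (h2 _ e20) => t /= k1 k2.
by apply: le_trans (cabs_le_ReIm _) _; rewrite cReB cImB [leRHS]splitr lerD.
Qed.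

(** * Limits along an ultrafilter on the integers *)

Section ultralimit.
Variable R : realType.

Lemma ultra_ex : exists U : set_system nat, UltraFilter U /\ \oo `<=` U.
Proof. exact: ultraFilterLemma. Qed.

(** One ultrafilter refining convergence to infinity is fixed for good: bounded sequences then have
    limits for all translations [t] at once, where a choice of subsequences could handle only
    countably many. *)
Definition ultra : set_system nat := sval (cid ultra_ex).

Global Instance ultra_ultra : UltraFilter ultra.
Proof. by rewrite /ultra; case: cid => U []. Qed.

Lemma ultra_oo (P : set nat) : (\forall n \near \oo, P n) -> \forall n \near ultra, P n.
Proof. by rewrite /ultra; case: cid => U [_ UP] /= h; exact: UP. Qed.

Definition ulim (a : nat -> R) : R := lim (a @ ultra).

Lemma ulimP (a : nat -> R) (B : R) : (forall n, `|a n| <= B) ->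
  forall e : R, 0 < e -> \forall n \near ultra, `|a n - ulim a| <= e.
Proof.
move=> aB; have [|l cv] := @ultra_limit R nat ultra a B _; first exact: filterE.
have al' : a @ ultra --> l by apply/cvgrPdist_le => e /cv; apply: filterS => n; rewrite distrC.
by have -> : ulim a = l by apply: cvg_lim.
Qed.

Definition culim (a : nat -> R[i]) : R[i] :=
  Complex (ulim (fun n => complex.Re (a n))) (ulim (fun n => complex.Im (a n))).

Lemma culimP (a : nat -> R[i]) (B : R) : (forall n, cabs (a n) <= B) ->
  forall e : R, 0 < e -> \forall n \near ultra, cabs (a n - culim a) <= e.
Proof.
move=> aB e e0; have e20 : 0 < e / 2 by rewrite divr_gt0.
have h1 := @ulimP (fun n => complex.Re (a n)) B (fun n => le_trans (normRe_le _) (aB n)) _ e20.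
have h2 := @ulimP (fun n => complex.Im (a n)) B (fun n => le_trans (normIm_le _) (aB n)) _ e20.
apply: filterS2 h1 h2 => n h1 h2; apply: le_trans (cabs_le_ReIm _) _.
by rewrite cReB cImB /=; lra.
Qed.

Lemma culim_unique (a : nat -> R[i]) (B : R) z : (forall n, cabs (a n) <= B) ->
  (forall e : R, 0 < e -> \forall n \near ultra, cabs (a n - z) <= e) -> culim a = z.
Proof.
move=> aB H; apply/eqP; rewrite -subr_eq0; apply/eqP/csmall_eq0 => e e0.
have e20 : 0 < e / 2 by rewrite divr_gt0.
have [n [h1 h2]] := filter_ex (filterI (culimP aB e20) (H _ e20)).
apply: le_trans (cabs_dist _ _ (a n)) _; rewrite (cabsC (culim a)); lra.
Qed.

Lemma near_inv (c e : R) : 0 < e -> \forall N \near \oo, c / N.+1%:R <= e.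
Proof.
move=> e0; have c1 : 0 < `|c| + 1 by rewrite ltr_wpDl.
have [N0 h] := archi_inv (divr_gt0 e0 c1).
exists N0 => // N /= N0N; have N1 : 0 < N.+1%:R :> R by rewrite ltr0n.
rewrite ler_pdivrMr //; apply: (@le_trans _ _ (`|c| + 1)).
  by apply: le_trans (ler_norm _) _; rewrite lerDl.
have : N0.+1%:R^-1 >= N.+1%:R^-1 :> R by rewrite lef_pV2 ?posrE ?ltr0n // ler_nat.
move=> /le_lt_trans/(_ h)/ltW; rewrite -[X in X <= _]div1r ler_pdivrMr // mulrAC.
by rewrite ler_pdivlMr // mul1r.
Qed.

End ultralimit.

Section almost_periodic.
Variables (R : realType) (p : nat).
Implicit Types (h u v : 'rV[R]_p -> R[i]) (x t : 'rV[R]_p).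

Definition ucont h := forall e : R, 0 < e -> exists2 d : R, 0 < d &
  forall x t, `|t| < d -> cabs (h (x + t) - h x) <= e.

(* Total boundedness of the translates: finitely many colours for t such that
   equally coloured translates are uniformly e-close. *)
Definition tbdd h := forall e : R, 0 < e -> exists (I : finType) (col : 'rV[R]_p -> I),
  forall t t', col t = col t' -> forall x, cabs (h (x + t) - h (x + t')) <= e.

Definition bounded h := exists B : R, forall x, cabs (h x) <= B.

(** The mean in von Neumann's sense: finite averages of translates that are uniformly close to a
    constant. It involves no averaging sets, which makes uniqueness short and allows comparison both
    with grid means and with means over cubes. *)
Definition cmean h (m : R[i]) := forall e : R, 0 < e ->
  exists (J : finType) (s : J -> 'rV[R]_p), (0 < #|J|)%N /\
  forall x, cabs (avgc (fun j => h (x + s j)) - m) <= e.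

Lemma tbdd_reps h : tbdd h -> forall e : R, 0 < e -> exists (I : finType) (s : I -> 'rV[R]_p),
  forall t, exists i, forall x, cabs (h (x + t) - h (x + s i)) <= e.
Proof.
move=> hb e /hb[I [col H]].
have C i : exists t0, forall t, col t = i -> col t = col t0.
  have [[t ti]|N] := pselect (exists t, col t = i); first by exists t => t' ->; rewrite ti.
  by exists 0 => t ti; case: N; exists t.
have [s sP] := choice C; exists I, s => t; exists (col t) => x.
by apply: H; apply: sP.
Qed.

Lemma tbdd_bounded h : tbdd h -> bounded h.
Proof.
move=> /tbdd_reps /(_ 1 ltr01)[I [s H]].
exists (1 + \sum_i cabs (h (s i))) => x; have [i /(_ 0)] := H x; rewrite !add0r => hi.
have := cabs_lB (h x) (h (s i)); rewrite (bigD1 i) //=.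
have : 0 <= \sum_(j | j != i) cabs (h (s j)) by apply: sumr_ge0 => *; exact: cabs_ge0.
lra.
Qed.

Lemma tbddM h u : tbdd h -> tbdd u -> tbdd (fun x => h x * u x).
Proof.
move=> hb ub e e0; have [B hB] := tbdd_bounded hb; have [B' uB] := tbdd_bounded ub.
have B0 : 0 <= B := le_trans (cabs_ge0 _) (hB 0).
have B'0 : 0 <= B' := le_trans (cabs_ge0 _) (uB 0).
have A0 : 0 < B + B' + 1 by lra.
have [I [col H]] := hb (e / (B + B' + 1)) (divr_gt0 e0 A0).
have [I' [col' H']] := ub (e / (B + B' + 1)) (divr_gt0 e0 A0).
exists (I * I')%type, (fun t => (col t, col' t)) => t t' [/H c1 /H' c2] x.
have -> : h (x + t) * u (x + t) - h (x + t') * u (x + t') =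
  (h (x + t) - h (x + t')) * u (x + t) + h (x + t') * (u (x + t) - u (x + t')) by ring.
apply: le_trans (cabsD _ _) _; rewrite !cabsM.
have := c1 x; have := c2 x; set q := e / _ => l1 l2.
have q0 : 0 <= q by rewrite divr_ge0 // ltW.
have eE : e = q * (B + B' + 1) by rewrite divfK // gt_eqF.
have k1 : cabs (h (x + t) - h (x + t')) * cabs (u (x + t)) <= q * B' by rewrite ler_pM ?cabs_ge0.
have k2 : cabs (h (x + t')) * cabs (u (x + t) - u (x + t')) <= B * q by rewrite ler_pM ?cabs_ge0.
by rewrite eE; lra.
Qed.

Lemma ucontM h u : bounded h -> bounded u -> ucont h -> ucont u ->
  ucont (fun x => h x * u x).
Proof.
move=> [B hB] [B' uB] hc uc e e0.
have B0 : 0 <= B := le_trans (cabs_ge0 _) (hB 0).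
have B'0 : 0 <= B' := le_trans (cabs_ge0 _) (uB 0).
have A0 : 0 < B + B' + 1 by lra.
have [d d0 H] := hc (e / (B + B' + 1)) (divr_gt0 e0 A0).
have [d' d'0 H'] := uc (e / (B + B' + 1)) (divr_gt0 e0 A0).
exists (Order.min d d'); first by rewrite lt_min d0.
move=> x t; rewrite lt_min => /andP[/H c1 /H' c2].
have -> : h (x + t) * u (x + t) - h x * u x =
  (h (x + t) - h x) * u (x + t) + h x * (u (x + t) - u x) by ring.
apply: le_trans (cabsD _ _) _; rewrite !cabsM.
have := c1 x; have := c2 x; set q := e / _ => l1 l2.
have q0 : 0 <= q by rewrite divr_ge0 // ltW.
have eE : e = q * (B + B' + 1) by rewrite divfK // gt_eqF.
have k1 : cabs (h (x + t) - h x) * cabs (u (x + t)) <= q * B' by rewrite ler_pM ?cabs_ge0.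
have k2 : cabs (h x) * cabs (u (x + t) - u x) <= B * q by rewrite ler_pM ?cabs_ge0.
by rewrite eE; lra.
Qed.

(** Averaging over both families of shifts at once gives a number close to both candidates. *)
Lemma cmean_unique h m m' : cmean h m -> cmean h m' -> m = m'.
Proof.
move=> hm hm'; apply/eqP; rewrite -subr_eq0; apply/eqP/csmall_eq0 => e e0.
have e20 : 0 < e / 2 by rewrite divr_gt0.
have [J [s [J0 H]]] := hm _ e20; have [J' [s' [J'0 H']]] := hm' _ e20.
pose W := avgc (fun j => avgc (fun j' => h (s j + s' j'))).
have W1 : cabs (W - m') <= e / 2.
  by rewrite -(avgc_cst m' J0) -avgcB; apply: cabs_avgc_le.
have W2 : cabs (W - m) <= e / 2.
  rewrite /W avgc_exchange -(avgc_cst m J'0) -avgcB; apply: cabs_avgc_le => // j'.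
  by rewrite (_ : (fun i => _) = (fun i => h (s' j' + s i))) //; apply: funext => i; rewrite addrC.
apply: le_trans (cabs_dist _ _ W) _; rewrite (cabsC m); lra.
Qed.

(** The product family of shifts is good for both functions, since each of its averages is an
    average of good averages. *)
Lemma cmeanB h u m n : cmean h m -> cmean u n -> cmean (fun x => h x - u x) (m - n).
Proof.
move=> hm un e e0; have e20 : 0 < e / 2 by rewrite divr_gt0.
have [J [s [J0 H]]] := hm _ e20; have [J' [s' [J'0 H']]] := un _ e20.
exists (J * J')%type, (fun jj => s jj.1 + s' jj.2); split; first by rewrite card_prod muln_gt0 J0.
move=> x; rewrite avgcB.
have pairE (w : 'rV[R]_p -> R[i]) : avgc (fun jj : J * J' => w (x + (s jj.1 + s' jj.2))) =
    avgc (fun j => avgc (fun j' => w (x + (s j + s' j')))).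
  rewrite /avgc card_prod natrM invfM -big_distrr /= mulrCA mulrA; congr (_ * _).
    exact: mulrC.
  by rewrite pair_bigA.
rewrite !pairE (avgc_exchange (fun j j' => h (x + (s j + s' j')))).
have -> : forall a b : R[i], a - b - (m - n) = (a - m) - (b - n) by move=> a b; ring.
apply: le_trans (cabsB _ _) _; rewrite [leRHS](splitr e); apply: lerD.
  rewrite -(avgc_cst m J'0) -avgcB; apply: cabs_avgc_le => // j'.
  rewrite (_ : (fun i => _) = (fun i => h (x + s' j' + s i))) //.
  by apply: funext => i; rewrite -addrA [s' _ + _]addrC.
rewrite -(avgc_cst n J0) -avgcB; apply: cabs_avgc_le => // j.
rewrite (_ : (fun i => _) = (fun i => u (x + s j + s' i))) //.
by apply: funext => i; rewrite addrA.
Qed.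

Lemma cmean_cst c : cmean (fun=> c) c.
Proof.
move=> e e0; exists unit, (fun=> 0); rewrite card_unit; split => // x.
by rewrite avgc_cst ?card_unit // subrr cabs0 ltW.
Qed.

End almost_periodic.

(** * Fourier analysis on finite tori *)

Section average_complex.
Variables (R : realType) (J : finType).

Lemma avgc_conj (u : J -> R[i]) : (avgc u)^*%C = avgc (fun j => (u j)^*%C).
Proof.
apply: cP; rewrite ?Re_avgc ?Im_avgc.
  have -> : complex.Re (avgc u)^*%C = complex.Re (avgc u) by case: (avgc u).
  by rewrite Re_avgc; congr avgr; apply: funext => j; case: (u j).
have -> : complex.Im (avgc u)^*%C = - complex.Im (avgc u) by case: (avgc u).
rewrite Im_avgc -mulN1r -avgrZ; congr avgr; apply: funext => j.
by rewrite mulN1r; case: (u j).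
Qed.

Lemma avgr_toC (f : J -> R) : (avgr f)%:C%C = avgc (fun j => (f j)%:C%C).
Proof.
apply: cP; first by rewrite Re_avgc.
by rewrite Im_avgc /= /avgr big1 // mulr0.
Qed.

Lemma avgc_sum (K : finType) (F : K -> J -> R[i]) :
  avgc (fun j => \sum_k F k j) = \sum_k avgc (F k).
Proof. by rewrite /avgc exchange_big /= mulr_sumr. Qed.

Lemma avgr_sum (K : finType) (F : K -> J -> R) :
  avgr (fun j => \sum_k F k j) = \sum_k avgr (F k).
Proof. by rewrite /avgr exchange_big /= mulr_sumr. Qed.

End average_complex.

Section finite_fourier.
Variables (R : realType) (A : finZmodType) (K : finType) (chi : K -> A -> R[i]).
Hypothesis chiD : forall k a b, chi k (a + b) = chi k a * chi k b.
Hypothesis chi1 : forall k a, cabs (chi k a) = 1.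
Hypothesis chi_sum : forall a, \sum_k chi k a = (if a == 0 then #|A|%:R else 0).
Implicit Types (u v : A -> R[i]).

Let A0 : (0 < #|A|)%N. Proof. by apply/card_gt0P; exists 0. Qed.
Let Anz : (#|A|%:R : R[i]) != 0. Proof. by rewrite pnatr_eq0 -lt0n. Qed.

Lemma chi_conj k a : chi k (- a) = (chi k a)^*%C.
Proof.
have c0 : chi k a != 0 by rewrite -cabs_gt0 chi1.
apply: (mulfI c0); rewrite -chiD subrr mulcJ chi1 expr1n /=.
have : chi k 0 * chi k 0 = chi k 0 by rewrite -chiD addr0.
move=> /(canRL (mulfK _)) -> //; last by rewrite -cabs_gt0 chi1.
by rewrite divff // -cabs_gt0 chi1.
Qed.

Definition hat u k := avgc (fun n => u n * (chi k n)^*%C).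

Lemma hat_inversion u m : u m = \sum_k hat u k * chi k m.
Proof.
rewrite /hat /avgc.
under eq_bigr do rewrite -mulrA mulr_suml.
rewrite -big_distrr /= exchange_big /=.
rewrite (bigD1 m) //= [X in _ + X]big1 ?addr0; last first.
  move=> n nm; under eq_bigr do rewrite -mulrA -chi_conj -chiD.
  by rewrite -big_distrr /= chi_sum addrC subr_eq0 eq_sym (negbTE nm) mulr0.
under eq_bigr do rewrite -mulrA -chi_conj -chiD.
by rewrite -big_distrr /= chi_sum addrC subrr eqxx [u m * _]mulrC mulKf.
Qed.

Lemma parseval u : avgr (fun n => cabs (u n) ^+ 2) = \sum_k cabs (hat u k) ^+ 2.
Proof.
apply: (@complexI R); rewrite avgr_toC rmorph_sum /=.
have E n : (cabs (u n) ^+ 2)%:C%C = \sum_k hat u k * (u n * (chi k n)^*%C)^*%C.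
  rewrite -mulcJ {1}hat_inversion mulr_suml; apply: eq_bigr => k _.
  by rewrite rmorphM /= conjcK -mulrA [chi k n * _]mulrC.
under eq_fun do rewrite E.
by rewrite avgc_sum; apply: eq_bigr => k _; rewrite avgcZ -avgc_conj mulcJ.
Qed.

Lemma avgc_shift u a : avgc (fun n => u (n + a)) = avgc u.
Proof. by rewrite /avgc [in RHS](reindex_inj (addIr a)). Qed.

Lemma avgr_shift (f : A -> R) a : avgr (fun n => f (n + a)) = avgr f.
Proof. by rewrite /avgr [in RHS](reindex_inj (addIr a)). Qed.

Lemma hat_shift u a k : hat (fun n => u (n + a)) k = chi k a * hat u k.
Proof.
rewrite /hat -avgcZ -[in RHS](avgc_shift _ a); congr avgc; apply: funext => n.
have := mulcJ (chi k a); rewrite chi1 expr1n => cc.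
rewrite chiD rmorphM /=.
have -> : chi k a * (u (n + a) * ((chi k n)^*%C * (chi k a)^*%C)) =
  (chi k a * (chi k a)^*%C) * (u (n + a) * (chi k n)^*%C) by ring.
by rewrite cc mul1r.
Qed.

(** A frequency whose coefficient is not small has a character that separates two shifts no better
    than [u] does in mean. This is the source of the continuity of the limit characters. *)
Lemma cabs_hat_shiftB u a b k :
  cabs (chi k a - chi k b) * cabs (hat u k) <= avgr (fun n => cabs (u (n + a) - u (n + b))).
Proof.
rewrite -cabsM mulrBl -!hat_shift /hat -avgcB; apply: le_trans (cabs_avgc _) _.
by apply: le_avgr => n; rewrite -mulrBl cabsM cabs_conj chi1 mulr1.
Qed.

Lemma l2_shift u a b : avgr (fun n => cabs (u (n + a) - u (n + b)) ^+ 2) =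
  \sum_k cabs (hat u k) ^+ 2 * cabs (chi k a - chi k b) ^+ 2.
Proof.
rewrite (parseval (fun n => u (n + a) - u (n + b))); apply: eq_bigr => k _.
rewrite -exprMn -cabsM mulrC; congr (cabs _ ^+ 2).
rewrite mulrBl -!hat_shift /hat -avgcB; congr avgc.
by apply: funext => n; rewrite mulrBl.
Qed.

(* Averaging [l2_shift] over pairs of almost periods from a set of positive
   density shows that a bounded number of frequencies carries almost all the mass. *)
Lemma spectral_concentration (J : finType) (s : J -> A) u (e : R) :
  (0 < #|J|)%N -> injective s ->
  (forall i j, avgr (fun n => cabs (u (n + s i) - u (n + s j)) ^+ 2) <= e) ->
  exists B : pred K, #|B|%:R * #|J|%:R <= 2 * #|A|%:R :> R /\
    \sum_(k | ~~ B k) cabs (hat u k) ^+ 2 <= e.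
Proof.
move=> J0 sinj H; pose c k := avgc (fun j => chi k (s j)).
have Jn0 : (#|J|%:R : R[i]) != 0 by rewrite pnatr_eq0 -lt0n.
have Jp : 0 < #|J|%:R :> R by rewrite ltr0n.
have pairE k : avgr (fun i => avgr (fun j => cabs (chi k (s i) - chi k (s j)) ^+ 2)) =
    2 - 2 * cabs (c k) ^+ 2.
  apply: (@complexI R).
  have -> : (2 - 2 * cabs (c k) ^+ 2)%:C%C = 2 - 2 * (c k * (c k)^*%C) :> R[i].
    by rewrite mulcJ rmorphB rmorphM /= !rmorph_nat.
  have conjE : (c k)^*%C = avgc (fun j => (chi k (s j))^*%C) := avgc_conj _.
  rewrite avgr_toC; under [in LHS]eq_fun do rewrite avgr_toC.
  have E i j : (cabs (chi k (s i) - chi k (s j)) ^+ 2)%:C%C =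
     2 - (chi k (s i) * (chi k (s j))^*%C + (chi k (s i))^*%C * chi k (s j)).
    rewrite -mulcJ rmorphB /= mulrBl !mulrBr !mulcJ !chi1 expr1n.
    by rewrite [chi k (s j) * (_)^*%C]mulrC; ring.
  have inner i : avgc (fun j => (cabs (chi k (s i) - chi k (s j)) ^+ 2)%:C%C) =
     2 - (chi k (s i) * (c k)^*%C + (chi k (s i))^*%C * c k).
    under eq_fun do rewrite E.
    by rewrite avgcB avgc_cst // avgcD !avgcZ conjE.
  under eq_fun do rewrite inner.
  rewrite avgcB avgc_cst // avgcD.
  have -> : avgc (fun j => chi k (s j) * (c k)^*%C) = c k * (c k)^*%C.
    by under eq_fun do rewrite mulrC; rewrite avgcZ mulrC.
  have -> : avgc (fun j => (chi k (s j))^*%C * c k) = c k * (c k)^*%C.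
    by under eq_fun do rewrite mulrC; rewrite avgcZ conjE.
  by ring.
have main : \sum_k cabs (hat u k) ^+ 2 * (2 - 2 * cabs (c k) ^+ 2) <= e.
  have -> : \sum_k cabs (hat u k) ^+ 2 * (2 - 2 * cabs (c k) ^+ 2) =
    avgr (fun i => avgr (fun j => avgr (fun n => cabs (u (n + s i) - u (n + s j)) ^+ 2))).
    under eq_bigr do rewrite -pairE.
    under [in RHS]eq_fun do under eq_fun do rewrite l2_shift.
    under [in RHS]eq_fun do rewrite avgr_sum.
    rewrite avgr_sum; apply: eq_bigr => k _.
    by rewrite -avgrZ; congr avgr; apply: funext => i; rewrite -avgrZ.
  by apply: avgr_le_cst => // i; apply: avgr_le_cst.
have c1 k : cabs (c k) ^+ 2 <= 1.
  rewrite -[leRHS](expr1n _ 2) ler_pXn2r ?nnegrE ?cabs_ge0 //.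
  by apply: cabs_avgc_le => // j; rewrite chi1.
(* Orthogonality keeps only the diagonal terms of the double sum, because [s] is injective. So at
   most [2 * #|A| / #|J|] frequencies have [|c k|^2 >= 1 / 2], and for all others the weight in
   [main] is at least 1. *)
have sumc : \sum_k cabs (c k) ^+ 2 = #|A|%:R / #|J|%:R.
  apply: (@complexI R); rewrite rmorph_sum rmorphM fmorphV !rmorph_nat /=.
  have cE k : (cabs (c k) ^+ 2)%:C%C =
      (#|J|%:R)^-1 * ((#|J|%:R)^-1 * \sum_i \sum_j chi k (s i - s j)).
    rewrite -mulcJ avgc_conj /c /avgc mulrACA -mulrA; congr (_ * (_ * _)).
    rewrite mulr_suml; apply: eq_bigr => i _.
    by rewrite mulr_sumr; apply: eq_bigr => j _; rewrite chiD chi_conj.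
  under eq_bigr do rewrite cE.
  rewrite -!big_distrr /= exchange_big /=.
  have E i : \sum_k \sum_j chi k (s i - s j) = #|A|%:R.
    rewrite exchange_big /= (bigD1 i) //= chi_sum subrr eqxx big1 ?addr0 // => j ji.
    by rewrite chi_sum subr_eq0 (inj_eq sinj) eq_sym (negbTE ji).
  under eq_bigr do rewrite E.
  by rewrite sumr_const -[#|A|%:R *+ _]mulr_natl mulKf // mulrC.
exists (fun k => 1 / 2 <= cabs (c k) ^+ 2); split.
  rewrite -ler_pdivlMr // -mulrA -sumc mulr_sumr.
  rewrite (bigID (fun k => 1 / 2 <= cabs (c k) ^+ 2)) /=.
  rewrite -[leLHS]addr0; apply: lerD; last first.
    by apply: sumr_ge0 => k _; rewrite mulr_ge0 ?sqr_ge0.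
  rewrite -sum1_card natr_sum big_mkcond [leRHS]big_mkcond /=.
  by apply: ler_sum => k _; rewrite unfold_in; case: ifP => // h; lra.
apply: le_trans main; rewrite [leRHS](bigID (fun k => 1 / 2 <= cabs (c k) ^+ 2)) /=.
rewrite -[leLHS]add0r; apply: lerD.
  by apply: sumr_ge0 => k _; rewrite mulr_ge0 ?sqr_ge0 // subr_ge0; have := c1 k; lra.
rewrite big_mkcond [leRHS]big_mkcond /=; apply: ler_sum => k _.
case: ifP => //; rewrite -ltNge => h.
by rewrite -[leLHS]mulr1 ler_wpM2l ?sqr_ge0 //; lra.
Qed.

End finite_fourier.

Section torus_characters.
Variables (R : realType) (p L : nat).
Local Notation A := 'rV['I_L.+1]_p.

Definition dotn (k n : A) : nat := (\sum_j (k 0%R j : nat) * (n 0%R j : nat))%N.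

Definition tchar (k n : A) : R[i] :=
  cexp (Complex 0 (pi *+ 2 * ((dotn k n)%:R / L.+1%:R))).

Lemma cexp_2pin (n : nat) : cexp (Complex 0 (pi *+ 2 * n%:R) : R[i]) = 1.
Proof.
have -> : Complex 0 (pi *+ 2 * n%:R) = (Complex 0 (pi *+ 2)) *+ n :> R[i].
  by rewrite -[RHS]mulr_natr -(rmorph_nat (real_complex R)); apply: cP => /=; ring.
by rewrite cexpMn /cexp /= expR0 !mul1r cos2pi sin2pi expr1n.
Qed.

Lemma tchar_mod (m m' : nat) : m = m' %[mod L.+1] ->
  cexp (Complex 0 (pi *+ 2 * (m%:R / L.+1%:R)) : R[i]) =
  cexp (Complex 0 (pi *+ 2 * (m'%:R / L.+1%:R))).
Proof.
have L0 : L.+1%:R != 0 :> R by rewrite pnatr_eq0.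
have red (n : nat) : cexp (Complex 0 (pi *+ 2 * (n%:R / L.+1%:R)) : R[i]) =
    cexp (Complex 0 (pi *+ 2 * ((n %% L.+1)%N%:R / L.+1%:R))).
  have -> : n%:R / L.+1%:R = (n %/ L.+1)%N%:R + (n %% L.+1)%N%:R / L.+1%:R :> R.
    by rewrite {1}(divn_eq n L.+1) natrD natrM [LHS]mulrDl [_ * _ / _]mulfK.
  have -> : Complex 0 (pi *+ 2 * ((n %/ L.+1)%N%:R + (n %% L.+1)%N%:R / L.+1%:R)) =
     Complex 0 (pi *+ 2 * (n %/ L.+1)%N%:R) +
     Complex 0 (pi *+ 2 * ((n %% L.+1)%N%:R / L.+1%:R)) :> R[i] by apply: cP => /=; ring.
  by rewrite cexpD cexp_2pin mul1r.
by move=> mm; rewrite red mm -red.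
Qed.

Lemma tcharC k n : tchar k n = tchar n k.
Proof. by rewrite /tchar /dotn; under eq_bigr do rewrite mulnC. Qed.

Lemma tcharD k a b : tchar k (a + b) = tchar k a * tchar k b.
Proof.
rewrite /tchar -cexpD.
have -> : Complex 0 (pi *+ 2 * ((dotn k a)%:R / L.+1%:R)) +
  Complex 0 (pi *+ 2 * ((dotn k b)%:R / L.+1%:R)) =
  Complex 0 (pi *+ 2 * ((dotn k a + dotn k b)%N%:R / L.+1%:R)) :> R[i].
  by apply: cP => /=; rewrite ?natrD; ring.
apply: tchar_mod; rewrite /dotn -big_split /= -modn_summ -[in RHS]modn_summ.
congr (_ %% _)%N; apply: eq_bigr => j _.
by rewrite mxE /= modnMmr mulnDr.
Qed.

Lemma cabs_tchar k a : cabs (tchar k a) = 1.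
Proof. by rewrite cabs_cexp /= expR0. Qed.

Lemma tchar_sum a : \sum_k tchar k a = (if a == 0 then #|{: A}|%:R else 0).
Proof.
case: eqVneq => [->|a0].
  rewrite -sum1_card natr_sum; apply: eq_bigr => k _.
  rewrite /tchar /dotn big1 ?mul0r ?mulr0 ?cexp0 // => j _.
  by rewrite mxE muln0.
have [j aj] : exists j, a 0 j != 0.
  apply: contrapT => N; move/eqP: a0; apply; apply/rowP => j; rewrite mxE.
  by apply/eqP; apply: contrapT => /negP h; apply: N; exists j.
have L0 : (0 < L)%N.
  by case: (L) (a 0 j) aj => // -[[|m] Hm] //.
(* Adding the unit vector [e] to [k] permutes the characters and multiplies the sum by [tchar e a],
   which is not 1; hence the sum is zero. [L0] ensures that [inord 1] is really 1. *)
pose e : A := \row_i (if i == j then inord 1 else 0).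
have wE : tchar e a != 1.
  rewrite /tchar (_ : dotn e a = (a 0%R j : nat)); last first.
    rewrite /dotn (bigD1 j) //= big1 ?addn0 => [|i ij]; last by rewrite mxE (negbTE ij) mul0n.
    by rewrite mxE eqxx inordK ?mul1n // ltnS.
  apply/eqP => /cexp_eq1 /=.
  have ajp : (0 < (a 0%R j : nat))%N by rewrite lt0n.
  have L1 : 0 < L.+1%:R :> R by rewrite ltr0n.
  have h0 : 0 < (a 0 j : nat)%:R / L.+1%:R :> R by rewrite divr_gt0 ?ltr0n.
  have h1 : (a 0 j : nat)%:R / L.+1%:R < 1 :> R by rewrite ltr_pdivrMr // mul1r ltr_nat ltn_ord.
  have p2 : 0 < pi *+ 2 :> R by rewrite mulrn_wgt0 // pi_gt0.
  have -> : `|pi *+ 2 * ((a 0 j : nat)%:R / L.+1%:R)| < pi *+ 2 :> R.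
    by rewrite ger0_norm ?mulr_ge0 ?(ltW p2) ?(ltW h0) // gtr_pMr.
  move=> /(_ isT) [] /eqP; rewrite mulf_eq0 (gt_eqF p2) /= => /eqP h.
  by rewrite h ltxx in h0.
have inv : tchar e a * \sum_k tchar k a = \sum_k tchar k a.
  rewrite mulr_sumr [RHS](reindex_inj (addrI e)) /=; apply: eq_bigr => k _.
  by rewrite ![tchar _ a]tcharC tcharD.
have : (tchar e a - 1) * \sum_k tchar k a = 0 by rewrite mulrBl inv mul1r subrr.
by move=> /eqP; rewrite mulf_eq0 subr_eq0 (negbTE wE) /= => /eqP.
Qed.

End torus_characters.

(** * Grids in the real space read on a finite torus *)

Section grid.
Variables (R : realType) (p r N : nat).

(** With mesh [1 / N.+1] the torus has side [r.+1 * N.+1], which grows with [N], while shifts of up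
    to [N.+1 ^ 2] steps wrap around only on a fraction of order [1 / r.+1]. The predecessor is taken
    because coordinates live in ['I_L.+1], which is a group. *)
Definition bsize : nat := (r.+1 * N.+1 ^ 2).-1.
Lemma bsizeE : bsize.+1 = (r.+1 * N.+1 ^ 2)%N.
Proof. by rewrite prednK // muln_gt0 expn_gt0. Qed.

Local Notation L := bsize.
Definition box := 'rV['I_L.+1]_p.

Definition grid (n : box) : 'rV[R]_p := \row_j ((n 0 j : nat)%:R / N.+1%:R).

Definition zshift (z : 'I_p -> int) : box := \row_j inZp `|(z j %% (L.+1)%:Z)%Z|%N.

(** The points that the shift by [z] does not wrap around the torus; at these, addition in the box
    agrees with translation in space. *)
Definition inside (z : 'I_p -> int) (n : box) : bool :=
  [forall j, (0 <= (n 0 j : nat)%:Z + z j) && ((n 0 j : nat)%:Z + z j < L.+1%:Z)].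

Lemma grid_shift z n : inside z n ->
  grid (n + zshift z) = grid n + \row_j ((z j)%:~R / N.+1%:R).
Proof.
move=> /forallP H; apply/rowP => j; rewrite !mxE -mulrDl; congr (_ / _).
have /andP[h1 h2] := H j; rewrite /= modnDmr.
have zE : (`|(z j %% L.+1)%Z|%N : int) = (z j %% L.+1)%Z by rewrite gez0_abs // modz_ge0.
have xE : (((n 0%R j + `|(z j %% L.+1)%Z|%N) %% L.+1)%N : int) = (n 0 j : nat)%:Z + z j.
  by rewrite -modz_nat PoszD zE modzDmr modz_small // h1.
by have := congr1 (fun i : int => i%:~R : R) xE; rewrite intrD.
Qed.

Lemma zshift_box (m : box) : zshift (fun j => (m 0 j : nat)) = m.
Proof.
apply/rowP => j; rewrite mxE; apply: val_inj => /=.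
by rewrite modz_nat /= modn_mod modn_small.
Qed.

(** A further average over shifts [c] of the coordinate is harmless by translation invariance, and
    performed first it already gives the one-dimensional average at every point of the box. *)
Lemma avgr_coord (f : 'I_L.+1 -> R) j : avgr (fun n : box => f (n 0 j)) = avgr f.
Proof.
have shift c : avgr (fun n : box => f (n 0 j)) = avgr (fun n : box => f (n 0 j + c)).
  rewrite -(avgr_shift (fun n : box => f (n 0 j)) (const_mx c)).
  by congr avgr; apply: funext => n; rewrite !mxE.
have I0 : (0 < #|'I_L.+1|)%N by rewrite card_ord.
rewrite -[LHS](avgr_cst _ I0).
under eq_fun => c do rewrite (shift c).
rewrite avgr_exchange.
have E (n : box) : avgr (fun c => f (n 0 j + c)) = avgr f.
  by under eq_fun do rewrite addrC; rewrite avgr_shift.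
under eq_fun do rewrite E.
by rewrite avgr_cst //; apply/card_gt0P; exists 0.
Qed.

Lemma sum_ltn_ord (l m : nat) : (\sum_(a < l) (a < m)%N <= m)%N.
Proof.
suff : (\sum_(a < l) (a < m)%N <= minn l m)%N by move/leq_trans; apply; exact: geq_minr.
elim: l => [|l IH]; first by rewrite big_ord0.
rewrite big_ord_recr /=; move: IH; set S := (\sum_(_ < l) _)%N; case: (ltnP l m); lia.
Qed.

Lemma sum_geq_ord (l q : nat) : (\sum_(a < l) (q <= a)%N <= l - q)%N.
Proof.
elim: l => [|l IH]; rewrite ?big_ord0 // big_ord_recr /=.
move: IH; set S := (\sum_(_ < l) _)%N; case: (leqP q l); lia.
Qed.

Lemma outside_avg z :
  avgr (fun n => (~~ inside z n)%:R : R) <= \sum_j (`|z j|%N%:R / L.+1%:R).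
Proof.
pose b j (a : 'I_L.+1) := ~~ ((0 <= (a : nat)%:Z + z j) && ((a : nat)%:Z + z j < L.+1%:Z)).
apply: (@le_trans _ _ (avgr (fun n : box => \sum_j (b j (n 0 j))%:R))).
  apply: le_avgr => n; rewrite -natr_sum ler_nat.
  case: (boolP (inside z n)) => //= /forallPn[j bj].
  by rewrite (bigD1 j) //= /b bj leq_addr.
rewrite avgr_sum; apply: ler_sum => j _.
rewrite (avgr_coord (fun a => (b j a)%:R)) /avgr card_ord mulrC ler_wpM2r ?invr_ge0 //.
rewrite -natr_sum ler_nat.
case: (lerP 0 (z j)) => z0.
  apply: (@leq_trans (\sum_(a < L.+1) (L.+1 - `|z j|%N <= a)%N)).
    by apply: leq_sum => a _; rewrite /b; have := ltn_ord a; lia.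
  by apply: leq_trans (sum_geq_ord _ _) _; lia.
apply: (@leq_trans (\sum_(a < L.+1) (a < `|z j|)%N)); last exact: sum_ltn_ord.
by apply: leq_sum => a _; rewrite /b; have := ltn_ord a; lia.
Qed.

Definition ashift (t : 'rV[R]_p) : box := zshift (fun j => Num.floor (t 0 j * N.+1%:R)).

Lemma card_box_gt0 : (0 < #|{: box}|)%N.
Proof. by apply/card_gt0P; exists 0. Qed.

End grid.

(** * Means as ultralimits of grid averages *)

Section mean.
Variables (R : realType) (p r : nat).
Implicit Types (h u v : 'rV[R]_p -> R[i]) (x t : 'rV[R]_p).

(** There are two errors. Rounding [t] to the grid moves points by at most [1 / N.+1], where [ucont]
    applies. Wrapping around affects a fraction of at most [p * (|t| + 1) / N.+1], since the shift
    takes about [|t| * N.+1] steps out of [r.+1 * N.+1 ^ 2] in each direction. *)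
Lemma ashift_close h t : ucont h -> bounded h -> forall e : R, 0 < e ->
  \forall N \near \oo,
  avgr (fun n : box p r N => cabs (h (grid R (n + ashift r N t)) - h (grid R n + t))) <= e.
Proof.
move=> hc [B hB] e e0; have e20 : 0 < e / 2 by rewrite divr_gt0.
have [d d0 hd] := hc _ e20.
have B0 : 0 <= B := le_trans (cabs_ge0 _) (hB 0).
pose C := 2 * B * (p%:R * (`|t| + 1)).
have d20 : 0 < d / 2 by rewrite divr_gt0.
apply: filterS2 (near_inv 1 d20) (near_inv C e20) => N Nd NC.
pose z j := Num.floor (t 0 j * N.+1%:R).
have N0 : 0 < N.+1%:R :> R by rewrite ltr0n.
apply: (@le_trans _ _ (avgr (fun n : box p r N => e / 2 + 2 * B * (~~ inside z n)%:R))).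
  apply: le_avgr => n; case: (boolP (inside z n)) => /= zn; last first.
    rewrite mulr1; apply: le_trans (cabsB _ _) _.
    by have := hB (grid R (n + ashift r N t)); have := hB (grid R n + t); lra.
  rewrite mulr0 addr0; have := grid_shift R zn; rewrite -[zshift r N z]/(ashift r N t) => ->.
  have -> : grid R n + \row_j ((z j)%:~R / N.+1%:R) =
    grid R n + t + (\row_j ((z j)%:~R / N.+1%:R) - t) by rewrite -addrA [t + _]addrC subrK.
  apply: hd; apply: le_lt_trans (_ : d / 2 < d); last by lra.
  apply: ler_norm_coord => [|j]; first by rewrite ltW.
  rewrite !mxE; apply: le_trans Nd.
  have -> : (z j)%:~R / N.+1%:R - t 0 j = ((z j)%:~R - t 0 j * N.+1%:R) / N.+1%:R.
    by rewrite mulrBl mulfK ?gt_eqF.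
  rewrite normrM normfV [`|N.+1%:R|]ger0_norm ?ler0n // ler_pM2r ?invr_gt0 //.
  have /andP[f1 f2] := floor_itv (t 0 j * N.+1%:R).
  rewrite intrD -/(z j) in f1 f2.
  by rewrite ler_norml; apply/andP; split; lra.
rewrite avgrD avgr_cst ?card_box_gt0 // avgrZ [leRHS]splitr lerD2l.
apply: le_trans NC; rewrite /C -!mulrA ler_pM2l // ler_wpM2l //.
apply: (le_trans (@outside_avg R p r N z)).
have -> : p%:R * ((`|t| + 1) / N.+1%:R) = \sum_(j < p) ((`|t| + 1) / N.+1%:R).
  by rewrite sumr_const card_ord mulr_natl.
apply: ler_sum => j _; rewrite bsizeE.
rewrite ler_pdivrMr; last by rewrite ltr0n muln_gt0 expn_gt0.
apply: (@le_trans _ _ ((`|t| + 1) * N.+1%:R)); last first.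
  rewrite -mulrA ler_wpM2l ?addr_ge0 // natrM natrX.
  rewrite ler_pdivlMl // -expr2 ler_peMl ?sqr_ge0 //.
  by rewrite ler1n.
have -> : `|z j|%N%:R = `|(z j)%:~R| :> R by rewrite -intr_norm -abszE.
have /andP[f1 f2] := floor_itv (t 0 j * N.+1%:R).
rewrite intrD -/(z j) in f1 f2.
have tj : `|t 0 j * N.+1%:R| <= `|t| * N.+1%:R.
  by rewrite normrM [`|N.+1%:R|]ger0_norm ?ler0n // ler_wpM2r ?ler0n ?ler_coord_norm.
have N1 : 1 <= N.+1%:R :> R by rewrite ler1n.
apply: (@le_trans _ _ (`|t 0 j * N.+1%:R| + 1)); last by lra.
have -> : (z j)%:~R = t 0 j * N.+1%:R + ((z j)%:~R - t 0 j * N.+1%:R) by ring.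
apply: le_trans (ler_normD _ _) _; rewrite lerD2l ler_norml; apply/andP; split; lra.
Qed.

Definition gavg N u : R[i] := avgc (fun n : box p r N => u (grid R n)).

(** A value for every function, possibly depending on [r] and on the ultrafilter; [cmean_exists] and
    [cmean_unique] remove this dependence for almost periodic functions. *)
Definition Mean u : R[i] := culim (fun N => gavg N u).

Lemma cabs_gavg N u (B : R) : (forall x, cabs (u x) <= B) -> cabs (gavg N u) <= B.
Proof. by move=> uB; apply: cabs_avgc_le => //; exact: card_box_gt0. Qed.

Lemma Mean_near u : bounded u -> forall e : R, 0 < e ->
  \forall N \near ultra, cabs (gavg N u - Mean u) <= e.
Proof. by move=> [B uB] e e0; apply: (@culimP _ _ B) => // N; exact: cabs_gavg. Qed.

Lemma Mean_unique u z : bounded u ->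
  (forall e : R, 0 < e -> \forall N \near ultra, cabs (gavg N u - z) <= e) -> Mean u = z.
Proof. by move=> [B uB]; apply: (@culim_unique _ _ B) => N; exact: cabs_gavg. Qed.

Lemma boundedD u v : bounded u -> bounded v -> bounded (fun x => u x + v x).
Proof.
move=> [B uB] [B' vB]; exists (B + B') => x.
by apply: le_trans (cabsD _ _) _; apply: lerD.
Qed.

Lemma boundedZ c u : bounded u -> bounded (fun x => c * u x).
Proof.
by move=> [B uB]; exists (cabs c * B) => x; rewrite cabsM ler_wpM2l ?cabs_ge0.
Qed.

Lemma MeanD u v : bounded u -> bounded v -> Mean (fun x => u x + v x) = Mean u + Mean v.
Proof.
move=> ub vb; apply: Mean_unique => [|e e0]; first exact: boundedD.
have e20 : 0 < e / 2 by rewrite divr_gt0.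
apply: filterS2 (Mean_near ub e20) (Mean_near vb e20) => N h1 h2.
rewrite /gavg avgcD opprD addrACA.
by apply: le_trans (cabsD _ _) _; rewrite [leRHS]splitr lerD.
Qed.

Lemma MeanZ c u : bounded u -> Mean (fun x => c * u x) = c * Mean u.
Proof.
move=> ub; apply: Mean_unique => [|e e0]; first exact: boundedZ.
have c1 : 0 < cabs c + 1 by rewrite ltr_wpDl ?cabs_ge0.
apply: filterS (Mean_near ub (divr_gt0 e0 c1)) => N.
rewrite ler_pdivlMr // => h; rewrite /gavg avgcZ -mulrBr cabsM mulrC.
by apply: le_trans h; rewrite ler_wpM2l ?cabs_ge0 // lerDl.
Qed.

Lemma Mean_cst c : Mean (fun=> c) = c.
Proof.
apply: Mean_unique => [|e e0]; first by exists (cabs c).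
apply: filterE => N; rewrite /gavg avgc_cst ?card_box_gt0 // subrr cabs0.
exact: ltW.
Qed.

Lemma Mean_shift u t : ucont u -> bounded u -> Mean (fun x => u (x + t)) = Mean u.
Proof.
move=> uc ub; apply: Mean_unique => [|e e0].
  by have [B uB] := ub; exists B.
have e20 : 0 < e / 2 by rewrite divr_gt0.
apply: filterS2 (Mean_near ub e20) (ultra_oo (ashift_close t uc ub e20)) => N h1 h2.
apply: le_trans (cabs_dist _ _ (gavg N u)) _; rewrite [leRHS]splitr; apply: lerD => //.
rewrite /gavg -(avgc_shift (fun n : box p r N => u (grid R n)) (ashift r N t)).
rewrite -avgcB; apply: le_trans (cabs_avgc _) _; apply: le_trans h2.
by apply: le_avgr => n; rewrite cabsC.
Qed.

Lemma Mean_le u v : bounded u -> bounded v ->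
  (forall x, complex.Re (u x) <= complex.Re (v x)) ->
  complex.Re (Mean u) <= complex.Re (Mean v).
Proof.
move=> ub vb uv; rewrite leNgt; apply/negP => lt.
pose e := (complex.Re (Mean u) - complex.Re (Mean v)) / 4.
have e0 : 0 < e by rewrite divr_gt0 // subr_gt0.
have [N [h1 h2]] := filter_ex (filterI (Mean_near ub e0) (Mean_near vb e0)).
have k1 := le_trans (normRe_le _) h1; have k2 := le_trans (normRe_le _) h2.
rewrite !cReB /gavg !Re_avgc in k1 k2.
have := le_avgr (fun n : box p r N => uv (grid R n)).
have eE : e * 4 = complex.Re (Mean u) - complex.Re (Mean v) by rewrite divfK.
move: k1 k2; rewrite !ler_norml => /andP[? ?] /andP[? ?] ?; lra.
Qed.

(** The shifts witnessing the mean are the points of one grid. Up to [e / 4] there are only finitely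
    many translates of [u], so one [N] serves them all, and they share their limit by
    [Mean_shift]. *)
Lemma cmean_exists u : ucont u -> tbdd u -> cmean u (Mean u).
Proof.
move=> uc ub e e0; have ubd := tbdd_bounded ub.
have e20 : 0 < e / 2 by rewrite divr_gt0.
have e40 : 0 < e / 2 / 2 by rewrite divr_gt0.
have [I [s sP]] := tbdd_reps ub e40.
have Hi i : \forall N \near ultra, cabs (gavg N (fun x => u (x + s i)) - Mean u) <= e / 2.
  rewrite -(Mean_shift (s i) uc ubd); apply: Mean_near => //.
  by have [B uB] := ubd; exists B.
have [N HN] := filter_ex (filter_forall _ Hi).
exists (box p r N), (@grid R p r N); split; first exact: card_box_gt0.
move=> x; have [i xi] := sP x.
apply: le_trans (cabs_dist _ _ (gavg N (fun x => u (x + s i)))) _.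
have := HN i; set a := cabs (gavg N _ - _) => ha.
have : cabs (avgc (fun n : box p r N => u (x + grid R n)) - gavg N (fun x => u (x + s i))) <= e / 2 / 2.
  rewrite /gavg -avgcB; apply: cabs_avgc_le => [|n]; first exact: card_box_gt0.
  by rewrite [x + _]addrC; exact: xi.
lra.
Qed.

End mean.

(** * Logarithms and mean motion *)

Section logarithms.
Variables (R : realType) (p : nat).
Implicit Types (h L g : 'rV[R]_p -> R[i]) (x t : 'rV[R]_p).

Lemma rv_log h (m : R) : ucont h -> 0 < m -> (forall x, m <= cabs (h x)) ->
  exists L, (forall x, cexp (L x) = h x) /\ exists2 d : R, 0 < d &
    forall x t, `|t| < d -> L (x + t) = L x + clog (h (x + t) / h x).
Proof.
move=> hc m0 hm.
have h0 x : h x != 0 by rewrite -cabs_gt0 (lt_le_trans m0).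
have [l0 l0E] := cexp_surj (h0 0).
have [|x _|x _|L [LE LC]] := @lift_family R 'rV[R]_p setT (fun (x : 'rV[R]_p) (s : R) => h (s *: x)) (fun=> l0).
- move=> x _ e /hc[d d0 hd].
  have A0 : 0 < `|x| + 1 by rewrite ltr_wpDl.
  exists (d / (`|x| + 1)); first by rewrite divr_gt0.
  move=> s s' _ _ ss; have -> : s *: x = s' *: x + (s - s') *: x by rewrite -scalerDl addrC subrK.
  apply: hd; rewrite normrZ; rewrite ltr_pdivlMr // in ss.
  by apply: le_lt_trans ss; rewrite ler_wpM2l // lerDl.
- by exists m.
- by rewrite scale0r.
exists L; split => [x|]; first by rewrite LE // scale1r.
have [d d0 hd] := hc (1 / 2 * m) ltac:(by rewrite !mulr_gt0).
exists d => // x t td; have := LC x (x + t) I I; rewrite !scale1r; apply.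
  move=> s /andP[s0 s1]; apply: (ratio_close m0) => //.
  rewrite scalerDr; apply: hd; rewrite normrZ ger0_norm //.
  by apply: le_lt_trans td; rewrite ler_piMl.
by rewrite !scale0r divff ?clog1 ?addr0.
Qed.

Lemma ucont_log h L (m d : R) : ucont h -> 0 < m -> (forall x, m <= cabs (h x)) -> 0 < d ->
  (forall x t, `|t| < d -> L (x + t) = L x + clog (h (x + t) / h x)) -> ucont L.
Proof.
move=> hc m0 hm d0 LC e e0; pose e1 := Order.min (1 / 2) (e / 4).
have e10 : 0 < e1 by rewrite lt_min !divr_gt0.
have e12 : e1 <= 1 / 2 by rewrite ge_min lexx.
have e14 : e1 <= e / 4 by rewrite ge_min lexx orbT.
have [d' d'0 hd] := hc (e1 * m) ltac:(by rewrite mulr_gt0).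
exists (Order.min d d') => [|x t]; first by rewrite lt_min d0.
rewrite lt_min => /andP[td td']; rewrite LC // addrAC subrr add0r.
have q : cabs (h (x + t) / h x - 1) <= e1 by apply: (ratio_close m0) => //; exact: hd.
apply: le_trans (cabs_clog _) _; [exact: le_trans q e12|lra].
Qed.

(** The values of [D] are multiples of the period, steps shorter than [d] cannot change them, and
    such steps lead from 0 to any point. *)
Lemma const_of_cexp1 (D : 'rV[R]_p -> R[i]) (d : R) : 0 < d ->
  (forall x, cexp (D x) = 1) ->
  (forall x t, `|t| < d -> `|complex.Im (D (x + t) - D x)| < pi *+ 2) ->
  forall x, D x = D 0.
Proof.
move=> d0 D1 Dd x; have A0 : 0 < `|x| + 1 by rewrite ltr_wpDl.
rewrite -[in LHS](scale1r x).
apply: (@chain01 R (fun s : R => D (s *: x) = D 0) (d / (`|x| + 1))).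
- by rewrite divr_gt0.
- by rewrite scale0r.
move=> s s' _ _ ss <-; apply/eqP; rewrite -subr_eq0; apply/eqP/cexp_eq1.
  by rewrite cexpB !D1 divff // oner_eq0.
have -> : s' *: x = s *: x + (s' - s) *: x by rewrite -scalerDl addrC subrK.
apply: Dd; rewrite normrZ distrC; rewrite ltr_pdivlMr // in ss.
by apply: le_lt_trans ss; rewrite ler_wpM2l // lerDl.
Qed.

Lemma ucont_steps L (T : R) : ucont L -> exists2 C : R, 0 <= C &
  forall x t, `|t| <= T -> cabs (L (x + t) - L x) <= C.
Proof.
move=> Lc; have [d d0 Ld] := Lc 1 ltr01.
have A0 : 0 < `|T| + 1 by rewrite ltr_wpDl.
have [N Nd] := archi_inv (divr_gt0 d0 A0).
exists N.+1%:R => // x t tT.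
pose u := (N.+1%:R)^-1 *: t.
have ud : `|u| < d.
  rewrite normrZ normfV ger0_norm //; rewrite ltr_pdivlMr // in Nd.
  apply: le_lt_trans Nd; rewrite ler_wpM2l ?invr_ge0 //.
  by apply: le_trans tT _; apply: le_trans (ler_norm _) _; rewrite lerDl.
have H k : cabs (L (x + u *+ k) - L x) <= k%:R.
  elim: k => [|k IH]; first by rewrite addr0 subrr cabs0.
  apply: le_trans (cabs_dist _ _ (L (x + u *+ k))) _.
  by rewrite mulrSr addrA -natr1 [k%:R + 1]addrC; apply: lerD => //; exact: Ld.
by have := H N.+1; rewrite /u -scaler_nat scalerA divff ?pnatr_eq0 // scale1r.
Qed.

(** Subtracting [s * a 1] leaves an additive function that vanishes on the integers, hence is
    bounded everywhere by its bound on the unit interval; a bounded additive function is zero. *)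
Lemma additive_linear (a : R -> R[i]) (C : R) : (forall s s' : R, a (s + s') = a s + a s') ->
  (forall s : R, `|s| <= 1 -> cabs (a s) <= C) -> forall s : R, a s = s%:C%C * a 1.
Proof.
move=> aD aC; pose b s := a s - s%:C%C * a 1.
have bD s s' : b (s + s') = b s + b s' by rewrite /b aD rmorphD /=; ring.
have b0 : b 0 = 0 by have := bD 0 0; rewrite addr0 => /eqP; rewrite -subr_eq subrr => /eqP <-.
have b1 : b 1 = 0 by rewrite /b rmorph1 mul1r subrr.
have bn s n : b (s *+ n) = b s *+ n.
  by elim: n => [|n IH]; rewrite ?mulr0n // !mulrS bD IH.
have bN s : b (- s) = - b s by apply/eqP; rewrite -addr_eq0 -bD addNr b0.
have bz (z : int) : b z%:~R = 0.
  by case: z => n; rewrite ?NegzE ?rmorphN ?bN /= bn b1 mul0rn ?oppr0.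
have bB s : cabs (b s) <= C + C.
  have /andP[f1 f2] := floor_itv s; rewrite rmorphD /= in f2.
  have -> : b s = b (s - (Num.floor s)%:~R) by rewrite bD bN bz oppr0 addr0.
  have u01 : `|s - (Num.floor s)%:~R| <= 1 by rewrite ler_norml; apply/andP; split; lra.
  apply: le_trans (cabsB _ _) _; apply: lerD; first exact: aC.
  rewrite cabsM cabsR -[leRHS]mul1r ler_pM ?cabs_ge0 // aC // normr1 //.
suff b00 s : b s = 0 by move=> s; apply/eqP; rewrite -subr_eq0; apply/eqP; exact: b00.
have C0 : 0 <= C + C := le_trans (cabs_ge0 _) (bB 0).
apply: csmall_eq0 => e e0; have [N Nd] := archi_inv (divr_gt0 e0 (ltr_wpDl C0 ltr01)).
have := bB (s *+ N.+1); rewrite bn -mulr_natl cabsM cabs_nat => h.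
have N0 : 0 < N.+1%:R :> R by rewrite ltr0n.
rewrite ltr_pdivlMr ?ltr_wpDl // mulrC ltr_pdivrMr // in Nd.
rewrite -(ler_pM2l N0); apply: le_trans h _; rewrite mulrC; lra.
Qed.

Definition ip (x c : 'rV[R]_p) : R := \sum_j x 0 j * c 0 j.

Lemma ipDl (x y c : 'rV[R]_p) : ip (x + y) c = ip x c + ip y c.
Proof. by rewrite /ip -big_split; apply: eq_bigr => j _; rewrite mxE mulrDl. Qed.

Lemma ipNl (x c : 'rV[R]_p) : ip (- x) c = - ip x c.
Proof. by rewrite /ip -sumrN; apply: eq_bigr => j _; rewrite mxE mulNr. Qed.

Lemma ipBl (x y c : 'rV[R]_p) : ip (x - y) c = ip x c - ip y c.
Proof. by rewrite ipDl ipNl. Qed.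

Lemma ipDr (x c d : 'rV[R]_p) : ip x (c + d) = ip x c + ip x d.
Proof. by rewrite /ip -big_split; apply: eq_bigr => j _; rewrite mxE mulrDr. Qed.

Lemma ipNr (x c : 'rV[R]_p) : ip x (- c) = - ip x c.
Proof. by rewrite /ip -sumrN; apply: eq_bigr => j _; rewrite mxE mulrN. Qed.

Lemma ipBr (x c d : 'rV[R]_p) : ip x (c - d) = ip x c - ip x d.
Proof. by rewrite ipDr ipNr. Qed.

Lemma ip0l (c : 'rV[R]_p) : ip 0 c = 0.
Proof. by rewrite /ip big1 // => j _; rewrite mxE mul0r. Qed.

Lemma ip_norm (x c : 'rV[R]_p) : `|ip x c| <= `|x| * \sum_j `|c 0 j|.
Proof.
apply: le_trans (ler_norm_sum _ _ _) _; rewrite mulr_sumr; apply: ler_sum => j _.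
by rewrite normrM ler_wpM2r // ler_coord_norm.
Qed.

(** Hyers' argument: [psi (n t) / n] stays within [C0] of [psi t], and its ultralimit [bar] is
    additive because the defect is divided by [n]. The bound on the unit ball then makes [bar]
    linear. *)
Lemma quasimorphism_linear (psi : 'rV[R]_p -> R[i]) (C0 C1 : R) :
  (forall x t, cabs (psi (x + t) - psi x - psi t) <= C0) ->
  (forall t, `|t| <= 1 -> cabs (psi t) <= C1) ->
  exists b : 'I_p -> R[i], forall t, cabs (psi t - \sum_j (t 0 j)%:C%C * b j) <= C0.
Proof.
move=> psiD psi1; have C00 : 0 <= C0 := le_trans (cabs_ge0 _) (psiD 0 0).
have psin t n : cabs (psi (t *+ n.+1) - n.+1%:R * psi t) <= n%:R * C0.
  elim: n => [|n IH]; first by rewrite !mul1r subrr cabs0 mul0r.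
  have -> : psi (t *+ n.+2) - n.+2%:R * psi t =
    (psi (t + t *+ n.+1) - psi t - psi (t *+ n.+1)) + (psi (t *+ n.+1) - n.+1%:R * psi t).
    by rewrite mulrS -[n.+2%:R]natr1; ring.
  apply: le_trans (cabsD _ _) _; rewrite addrC -[in leRHS]natr1 mulrDl mul1r.
  exact: lerD.
pose q t n : R[i] := (n.+1%:R)^-1 * psi (t *+ n.+1).
have qd t n : cabs (q t n - psi t) <= C0.
  have n0 : n.+1%:R != 0 :> R[i] by rewrite pnatr_eq0.
  have -> : q t n - psi t = (n.+1%:R)^-1 * (psi (t *+ n.+1) - n.+1%:R * psi t).
    by rewrite mulrBr mulKf.
  rewrite cabsM cabsV cabs_nat ler_pdivrMl ?ltr0n //.
  by apply: le_trans (psin t n) _; rewrite ler_wpM2r // ler_nat.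
have qB t n : cabs (q t n) <= cabs (psi t) + C0.
  have := cabs_lB (q t n) (psi t); have := qd t n; lra.
pose bar t := culim (q t).
have barE t := culimP (qB t).
have bard t : cabs (psi t - bar t) <= C0.
  rewrite leNgt; apply/negP => lt.
  have e0 : 0 < (cabs (psi t - bar t) - C0) / 2 by rewrite divr_gt0 // subr_gt0.
  have [n hn] := filter_ex (barE t _ e0).
  have := cabs_dist (psi t) (bar t) (q t n); rewrite (cabsC (psi t) (q t n)).
  by have := qd t n; rewrite -/(bar t) in hn; lra.
have barD (t s : 'rV[R]_p) : bar (t + s) = bar t + bar s.
  apply: (culim_unique (qB _)) => e e0; have e30 : 0 < e / 3 by rewrite divr_gt0.
  apply: filterS3 (barE t _ e30) (barE s _ e30) (ultra_oo (near_inv C0 e30)) => n h1 h2 h3.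
  have -> : q (t + s) n - (bar t + bar s) =
    (q (t + s) n - q t n - q s n) + ((q t n - bar t) + (q s n - bar s)) by ring.
  apply: le_trans (cabsD _ _) _.
  have h4 := cabsD (q t n - bar t) (q s n - bar s).
  have h5 : cabs (q (t + s) n - q t n - q s n) <= C0 / n.+1%:R.
    rewrite /q -!mulrBr cabsM cabsV cabs_nat mulrC ler_wpM2r ?invr_ge0 //.
    by rewrite mulrnDl.
  have {}h1 : cabs (q t n - bar t) <= e / 3 := h1.
  have {}h2 : cabs (q s n - bar s) <= e / 3 := h2.
  apply: le_trans (lerD (le_trans h5 h3) (le_trans h4 (lerD h1 h2))) _.
  by move: e {e0 e30 h1 h2 h3} => e; lra.
have bar0 : bar 0 = 0.
  by have := barD 0 0; rewrite addr0 => /eqP; rewrite -subr_eq subrr => /eqP <-.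
exists (fun j => bar (delta_mx 0 j)) => t; have := bard t.
have -> // : bar t = \sum_j (t 0 j)%:C%C * bar (delta_mx 0 j).
rewrite {1}(row_sum_delta t) (big_morph bar barD bar0); apply: eq_bigr => j _.
rewrite -(scale1r (delta_mx 0 j)) scalerA mulr1.
apply: (@additive_linear (fun s : R => bar (s *: delta_mx 0 j)) (C1 + C0)).
  by move=> s s'; rewrite scalerDl barD.
move=> s s1; have st : `|s *: delta_mx 0 j : 'rV[R]_p| <= 1.
  apply: ler_norm_coord => // k; rewrite !mxE eqxx /=.
  by case: eqP => _; rewrite ?mulr1 ?mulr0 ?normr0.
have := cabs_lB (bar (s *: delta_mx 0 j)) (psi (s *: delta_mx 0 j)).
by have := bard (s *: delta_mx 0 j); rewrite cabsC; have := psi1 _ st; lra.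
Qed.

Lemma Im_clog_diff (w w' : R[i]) : `|complex.Im (clog w) - complex.Im (clog w')| < pi.
Proof.
have := normIm_clog w; have := normIm_clog w'.
by rewrite !ltr_norml => /andP[? ?] /andP[? ?]; apply/andP; split; lra.
Qed.

(* The argument of a non-vanishing almost periodic function is a quasimorphism
   up to bounded error, hence linear up to bounded error. *)
Lemma mean_motion h L (m : R) : tbdd h -> 0 < m -> (forall x, m <= cabs (h x)) ->
  ucont L -> (forall x, cexp (L x) = h x) ->
  exists c : 'rV[R]_p, bounded (fun x => L x - Complex 0 (ip x c)).
Proof.
move=> hb m0 hm Lc LE; have [B hB] := tbdd_bounded hb.
have h0 x : h x != 0 by rewrite -cabs_gt0 (lt_le_trans m0).
have m20 : 0 < 1 / 2 * m by rewrite mulr_gt0.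
have [I [s sP]] := tbdd_reps hb m20.
have Cs i : exists C : R, 0 <= C /\ forall x, cabs (L (x + s i) - L x) <= C.
  by have [C C0 HC] := ucont_steps (`|s i|) Lc; exists C; split => // x; exact: HC.
have [C HC] := choice Cs; pose Cm := \sum_i C i.
have CCm i : C i <= Cm.
  by rewrite /Cm (bigD1 i) //= lerDl; apply: sumr_ge0 => j _; case: (HC j).
(* [t] is compared with a representative [s i] whose translate is close: the difference of [L] at
   the two shifts agrees with [clog] of the ratio up to a constant. [clog] contributes at most 2 at
   each of the points [x] and 0, and the shift by [s i] at most [Cm] at each. *)
have quasi x t : cabs (L (x + t) - L x - (L t - L 0)) <= 4 + 2 * Cm.
  have [i ti] := sP t.
  have q1 y : cabs (h (y + t) / h (y + s i) - 1) <= 1 / 2 by apply: (ratio_close m0).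
  pose D y := L (y + t) - L (y + s i) - clog (h (y + t) / h (y + s i)).
  have [d d0 Ld] := Lc (1 / 4) ltac:(by rewrite divr_gt0).
  have DE : D x = D 0.
    apply: (const_of_cexp1 d0) => [y|y u ud].
      rewrite !cexpB !LE cexp_clog ?Re_near1_gt0 // divff //.
      by rewrite mulf_neq0 // invr_eq0.
    have := Im_clog_diff (h (y + t) / h (y + s i)) (h (y + u + t) / h (y + u + s i)).
    have := le_trans (normIm_le _) (Ld (y + t) u ud).
    have := le_trans (normIm_le _) (Ld (y + s i) u ud).
    rewrite /D !cImB [y + u + t]addrAC [y + u + s i]addrAC; have := pi_ge2 R.
    move: (complex.Im (L (y + t + u))) (complex.Im (L (y + t))) (complex.Im (L (y + s i + u)))
      (complex.Im (L (y + s i))) (complex.Im (clog _)) (complex.Im (clog _)) => a1 a2 a3 a4 a5 a6.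
    rewrite !ltr_norml !ler_norml [pi *+ 2]mulr2n.
    by move=> ? /andP[? ?] /andP[? ?] /andP[? ?]; apply/andP; split; lra.
  have k1 := cabs_clog (q1 x); have k2 := cabs_clog (q1 0).
  have l1 := q1 x; have l2 := q1 0.
  have -> : L (x + t) - L x - (L t - L 0) =
    (D x + clog (h (x + t) / h (x + s i)) + (L (x + s i) - L x)) -
    (D 0 + clog (h (0 + t) / h (0 + s i)) + (L (0 + s i) - L 0)).
    by rewrite /D !add0r; ring.
  rewrite DE.
  have -> : forall a b c e f : R[i], a + b + c - (a + e + f) = (b - e) + (c - f) by move=> *; ring.
  apply: le_trans (cabsD _ _) _.
  have := cabsB (clog (h (x + t) / h (x + s i))) (clog (h (0 + t) / h (0 + s i))).
  have := cabsB (L (x + s i) - L x) (L (0 + s i) - L 0).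
  have := (HC i).2 x; have := (HC i).2 0; have := CCm i; lra.
have [C1 C10 HC1] := ucont_steps 1 Lc.
have [|t t1|b bP] := @quasimorphism_linear (fun x => L x - L 0) (4 + 2 * Cm) C1.
- move=> x t; have := quasi x t.
  by have -> : L (x + t) - L x - (L t - L 0) = L (x + t) - L 0 - (L x - L 0) - (L t - L 0) by ring.
- by have := HC1 0 t t1; rewrite add0r.
have ReL x : complex.Re (L x) = ln (cabs (h x)) by rewrite -LE cabs_cexp expRK.
have hx0 x : 0 < cabs (h x) by rewrite cabs_gt0.
have B0 : 0 < B by apply: lt_le_trans (hB 0).
have ReB x : `|complex.Re (L x)| <= `|ln m| + `|ln B|.
  have l1 : ln m <= complex.Re (L x) by rewrite ReL ler_ln ?posrE.
  have l2 : complex.Re (L x) <= ln B by rewrite ReL ler_ln ?posrE.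
  have := ler_norm (ln B); have := ler_norm (- ln m); rewrite normrN => *.
  have := normr_ge0 (ln m); have := normr_ge0 (ln B) => *.
  by rewrite ler_norml; apply/andP; split; lra.
(* [Re L = ln |h|] is bounded, so the linear part has no real component; its imaginary parts form
   the vector [c]. *)
have Reb j : complex.Re (b j) = 0.
  apply: small_eq0 => e e0.
  pose K := (4 + 2 * Cm) + 2 * (`|ln m| + `|ln B|).
  have [N [hN _]] := filter_ex (filterI (near_inv K e0) (near_inv K e0)).
  have := bP (N.+1%:R *: delta_mx 0 j).
  rewrite (bigD1 j) //= big1 ?addr0; last first.
    by move=> k kj; rewrite !mxE (negbTE kj) andbF mulr0 rmorph0 mul0r.
  rewrite !mxE !eqxx mulr1 => /(le_trans (normRe_le _)).
  rewrite !cReB cReM /= mul0r subr0 => H.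
  have N0 : 0 < N.+1%:R :> R by rewrite ltr0n.
  apply: le_trans hN; rewrite ler_pdivlMr // mulrC -[X in X * _]ger0_norm // -normrM.
  have r1 := ReB (N.+1%:R *: delta_mx 0 j); have r2 := ReB 0.
  move: H r1 r2; rewrite /K.
  move: (complex.Re (L (N.+1%:R *: delta_mx 0 j))) (complex.Re (L 0)) (N.+1%:R * complex.Re (b j)) => a1 a2 a3.
  by rewrite !ler_norml => /andP[? ?] /andP[? ?] /andP[? ?]; apply/andP; split; lra.
exists (\row_j complex.Im (b j)); exists (4 + 2 * Cm + cabs (L 0)) => x.
have -> : Complex 0 (ip x (\row_j complex.Im (b j))) = \sum_j (x 0 j)%:C%C * b j.
  apply: cP; rewrite ?cRe_sum ?cIm_sum /=.
    by rewrite big1 // => j _; rewrite cReM Reb /= mulr0 mul0r subrr.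
  by rewrite /ip; apply: eq_bigr => j _; rewrite mxE cImM /= mul0r addr0.
have -> : L x - \sum_j (x 0 j)%:C%C * b j = (L x - L 0 - \sum_j (x 0 j)%:C%C * b j) + L 0 by ring.
by apply: le_trans (cabsD _ _) _; rewrite lerD2r.
Qed.

(** The difference between [g (x + t) - g (x + s)] and the principal logarithm of the ratio is a
    constant [w]. Iterating the shift by [t - s] adds up copies of [w], and boundedness of [g]
    forces [|w| <= 4 * de]. So almost periods of [h] are almost periods of [g], and the linear part
    contributes a number close to 1. *)
Lemma slice_log h g (c t s : 'rV[R]_p) (de : R) : ucont g -> bounded g ->
  (forall x, h x = cexp (g x + Complex 0 (ip x c))) -> de <= 1 / 2 ->
  (forall x, cabs (h (x + t) - h (x + s)) <= de * cabs (h (x + s))) ->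
  (forall x, cabs (g (x + t) - g (x + s)) <= 8 * de) /\
  exists w, cabs w <= 4 * de /\ cexp (Complex 0 (ip (t - s) c)) = cexp w.
Proof.
move=> gc [G gG] hE de2 hts.
have h0 x : h x != 0 by rewrite hE cexp_neq0.
have q1 x : cabs (h (x + t) / h (x + s) - 1) <= de.
  have hs : 0 < cabs (h (x + s)) by rewrite cabs_gt0.
  by apply: (ratio_close hs).
have q2 x := le_trans (q1 x) de2.
pose D x := g (x + t) - g (x + s) + Complex 0 (ip (t - s) c) - clog (h (x + t) / h (x + s)).
have D1 x : cexp (D x) = 1.
  rewrite cexpB cexp_clog ?Re_near1_gt0 // !hE -cexpB.
  have -> : g (x + t) - g (x + s) + Complex 0 (ip (t - s) c) =
     g (x + t) + Complex 0 (ip (x + t) c) - (g (x + s) + Complex 0 (ip (x + s) c)).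
    have -> : Complex 0 (ip (t - s) c) = Complex 0 (ip (x + t) c) - Complex 0 (ip (x + s) c) :> R[i].
      by apply: cP => /=; rewrite ?ipBl ?ipDl; ring.
    by ring.
  by rewrite divff // cexp_neq0.
have [d d0 gd] := gc (1 / 4) ltac:(by rewrite divr_gt0).
have DE x : D x = D 0.
  apply: (const_of_cexp1 d0) => // y u ud.
  have := Im_clog_diff (h (y + t) / h (y + s)) (h (y + u + t) / h (y + u + s)).
  have := le_trans (normIm_le _) (gd (y + t) u ud).
  have := le_trans (normIm_le _) (gd (y + s) u ud).
  rewrite /D !(cImB, cImD) [y + u + t]addrAC [y + u + s]addrAC; have := pi_ge2 R.
  move: (complex.Im (g (y + t + u))) (complex.Im (g (y + t))) (complex.Im (g (y + s + u)))
      (complex.Im (g (y + s))) (complex.Im (clog _)) (complex.Im (clog _)) => a1 a2 a3 a4 a5 a6.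
  rewrite !ltr_norml !ler_norml [pi *+ 2]mulr2n.
  by move=> ? /andP[? ?] /andP[? ?] /andP[? ?]; apply/andP; split; lra.
pose w := D 0 - Complex 0 (ip (t - s) c).
have gw x : g (x + t) - g (x + s) = w + clog (h (x + t) / h (x + s)).
  by rewrite /w -(DE x) /D; ring.
have cl x : cabs (clog (h (x + t) / h (x + s))) <= 4 * de.
  by apply: le_trans (cabs_clog (q2 x)) _; have := q1 x; lra.
have iter n : cabs (g (s + (t - s) *+ n) - g s - n%:R * w) <= n%:R * (4 * de).
  elim: n => [|n IH]; first by rewrite addr0 subrr !mul0r subrr cabs0.
  have := gw ((t - s) *+ n); rewrite -natr1 => E.
  have -> : g (s + (t - s) *+ n.+1) - g s - (n%:R + 1) * w =
    (g (s + (t - s) *+ n) - g s - n%:R * w) + clog (h ((t - s) *+ n + t) / h ((t - s) *+ n + s)).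
    have -> : s + (t - s) *+ n.+1 = (t - s) *+ n + t by rewrite mulrSr addrC -addrA subrK.
    have -> : g ((t - s) *+ n + t) = w + clog (h ((t - s) *+ n + t) / h ((t - s) *+ n + s)) + g (s + (t - s) *+ n).
      by rewrite -E [s + _]addrC; ring.
    by ring.
  apply: le_trans (cabsD _ _) _; rewrite -[in leRHS]natr1 [in leRHS]mulrDl mul1r.
  exact: lerD.
have wde : cabs w <= 4 * de.
  rewrite leNgt; apply/negP => lt.
  have e0 : 0 < (cabs w - 4 * de) / 2 by rewrite divr_gt0 // subr_gt0.
  have [N hN] := filter_ex (near_inv (2 * G) e0).
  have N0 : 0 < N.+1%:R :> R by rewrite ltr0n.
  have := iter N.+1; have := cabsB (g (s + (t - s) *+ N.+1)) (g s).
  have := gG (s + (t - s) *+ N.+1); have := gG s.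
  have := cabs_lB (N.+1%:R * w) (g (s + (t - s) *+ N.+1) - g s).
  rewrite (cabsC (N.+1%:R * w)) cabsM cabs_nat.
  rewrite ler_pdivrMr // in hN; move=> ? ? ? ? ?.
  have : N.+1%:R * (cabs w - 4 * de) <= 2 * G by lra.
  have : 0 < N.+1%:R * (cabs w - 4 * de) by rewrite mulr_gt0 // subr_gt0.
  lra.
split => [x|].
  by rewrite gw; apply: le_trans (cabsD _ _) _; have := cl x; lra.
exists (- w); rewrite cabsN; split => //.
have -> : - w = Complex 0 (ip (t - s) c) - D 0 by rewrite /w; ring.
by rewrite cexpB D1 divr1.
Qed.

End logarithms.

Lemma tchar0 (R : realType) (p L : nat) (k : 'rV['I_L.+1]_p) : tchar R k 0 = 1.
Proof.
rewrite /tchar /dotn big1 ?mul0r ?mulr0 ?cexp0 // => j _.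
by rewrite mxE muln0.
Qed.

Lemma pigeonhole (T I : finType) (c : T -> I) (t0 : T) :
  exists i, (#|T| <= #|[pred t | c t == i]| * #|I|)%N.
Proof.
have [i _ iM] := @arg_maxnP I (c t0) predT (fun i => #|[pred t | c t == i]|) isT.
exists i; rewrite -sum1_card (partition_big c predT) //= mulnC -sum_nat_const.
apply: leq_sum => j _; apply: leq_trans (iM j isT).
by rewrite sum1_card; apply: subset_leq_card; apply/fintype.subsetP => t; rewrite !inE.
Qed.

(** * Frequencies of an almost periodic function *)

Section frequencies.
Variables (R : realType) (p : nat) (h : 'rV[R]_p -> R[i]).
Hypotheses (hb : tbdd h).

Definition samp r N (n : box p r N) : R[i] := h (grid R n).
Definition fhat r N (k : box p r N) : R[i] := hat (@tchar R p (bsize r N)) (samp (N:=N)) k.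

(** The point is that [M] does not depend on [N]. Among the [(N.+1 ^ 2) ^ p] shifts in a small box,
    pigeonhole finds a set of one colour whose density in the torus is at least
    [1 / (r.+1 ^ p * #|I|)], and [spectral_concentration] turns density into a number of
    frequencies. *)
Lemma bounded_frequencies (e : R) : 0 < e -> exists r M : nat, forall N,
  exists B : pred (box p r N), (#|B| <= M)%N /\ \sum_(k | ~~ B k) cabs (fhat k) ^+ 2 <= e.
Proof.
move=> e0; have [B hB] := tbdd_bounded hb.
have B0 : 0 <= B := le_trans (cabs_ge0 _) (hB 0).
pose e1 : R := Order.min 1 (e / 2).
have e10 : 0 < e1 by rewrite lt_min ltr01 divr_gt0.
have e11 : e1 ^+ 2 <= e / 2.
  apply: (@le_trans _ _ e1); last by rewrite ge_min lexx orbT.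
  by rewrite expr2 ger_pMr // ge_min lexx.
have [I [col colP]] := hb e10.
have e20 : 0 < e / 2 by rewrite divr_gt0.
(* The torus is made so much longer than the shifts that the points where one of two shifts wraps
   around, each costing at most [4 * B ^+ 2], contribute at most [e / 2] in mean. *)
have [r rP] := filter_ex (near_inv (8 * B ^+ 2 * p%:R) e20).
exists r, (2 * (r.+1 ^ p * #|I|))%N => N.
pose T : finType := 'rV['I_(N.+1 ^ 2)]_p.
have Lb : (N.+1 ^ 2 <= (bsize r N).+1)%N by rewrite bsizeE leq_pmull.
pose emb (t : T) : box p r N := \row_j widen_ord Lb (t 0 j).
have embI : injective emb.
  move=> t t' E; apply/rowP => j; have := congr1 (fun m : box p r N => (m 0 j : nat)) E.
  by rewrite !mxE /= => ?; exact: val_inj.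
have N2 : (0 < N.+1 ^ 2)%N by rewrite expn_gt0.
have [i iP] := pigeonhole (fun t => col (grid R (emb t))) (\row_j Ordinal N2 : T).
pose J : finType := {t : T | col (grid R (emb t)) == i}.
have cJ : #|{: J}| = #|[pred t : T | col (grid R (emb t)) == i]| by rewrite card_sig.
have cT : #|T| = ((N.+1 ^ 2) ^ p)%N by rewrite card_mx card_ord mul1n.
have cA : #|{: box p r N}| = ((r.+1 ^ p) * #|T|)%N.
  by rewrite card_mx card_ord mul1n bsizeE expnMn cT.
have J0 : (0 < #|{: J}|)%N.
  rewrite cJ; case: posnP => // E; move: iP; rewrite E mul0n cT leqn0.
  by rewrite expn_eq0 gtn_eqF.
have zE (t : T) : emb t = zshift r N (fun j => (t 0 j : nat)).
  by rewrite -[LHS]zshift_box; congr zshift; apply: funext => j; rewrite mxE.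
pose out (t : T) n : R := (~~ @inside p r N (fun j => (t 0 j : nat)) n)%:R.
have outA t : avgr (out t) <= p%:R / r.+1%:R.
  apply: (le_trans (outside_avg R r N _)).
  have -> : p%:R / r.+1%:R = \sum_(j < p) (r.+1%:R)^-1 :> R by rewrite sumr_const card_ord mulr_natl.
  apply: ler_sum => j _; rewrite /= bsizeE natrM ler_pdivrMr ?mulr_gt0 ?ltr0n ?expn_gt0 //.
  by rewrite mulKf ?pnatr_eq0 // ler_nat ltnW.
have gridE (t : T) n : @inside p r N (fun j => (t 0 j : nat)) n ->
    grid R (n + emb t) = grid R n + grid R (emb t).
  by move=> tn; rewrite zE (grid_shift R tn); congr (_ + _); apply/rowP => j; rewrite -zE !mxE.
have [|[t tP] [t' t'P]|S [S1 S2]] := spectral_concentration (@tcharD R p (bsize r N))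
    (@cabs_tchar R p (bsize r N)) (@tchar_sum R p (bsize r N)) (J := J)
    (s := fun t => emb (val t)) (u := samp (N := N)) (e := e) J0.
- by move=> t t' /embI /val_inj.
- rewrite /=; apply: (@le_trans _ _ (avgr (fun n => e1 ^+ 2 + 4 * B ^+ 2 * (out t n + out t' n)))).
    have big (b : bool) : (B + B) ^+ 2 <= e1 ^+ 2 + 4 * B ^+ 2 * (1%:R + b%:R).
      by have := sqr_ge0 e1; have := sqr_ge0 B; rewrite mulr1n; case: b; rewrite ?mulr1n ?mulr0n; nra.
    apply: le_avgr => n; rewrite /samp /out.
    case: (boolP (inside _ n)) => tn; last first.
      apply: (@le_trans _ _ ((B + B) ^+ 2)); last first.
        rewrite -[~~ false]/true; case: (~~ _); exact: big.
      by rewrite lerXn2r ?nnegrE ?addr_ge0 ?cabs_ge0 // (le_trans (cabsB _ _)) // lerD.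
    case: (boolP (inside _ n)) => t'n; last first.
      apply: (@le_trans _ _ ((B + B) ^+ 2)); last first.
        by rewrite [_%:R + _]addrC; exact: (big false).
      by rewrite lerXn2r ?nnegrE ?addr_ge0 ?cabs_ge0 // (le_trans (cabsB _ _)) // lerD.
    rewrite /= addr0 mulr0 addr0 lerXn2r ?nnegrE ?cabs_ge0 ?(ltW e10) // !gridE //.
    by apply: colP; rewrite (eqP tP) (eqP t'P).
  rewrite avgrD avgr_cst ?card_box_gt0 // avgrZ avgrD [leRHS]splitr lerD //.
  apply: le_trans rP; have := outA t; have := outA t'.
  move: (avgr _) (avgr _) => a b ha hb'.
  have -> : 8 * B ^+ 2 * p%:R / r.+1%:R = 4 * B ^+ 2 * (p%:R / r.+1%:R + p%:R / r.+1%:R) by ring.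
  by rewrite ler_wpM2l ?mulr_ge0 ?sqr_ge0 // lerD.
exists S; split; last exact: S2.
rewrite -!natrM ler_nat cA in S1.
rewrite -(leq_pmul2r J0); apply: (leq_trans S1).
by rewrite -!mulnA leq_mul2l /= leq_mul2l /= mulnC cJ orbC iP.
Qed.

(** The exceptional frequencies of [bounded_frequencies] are listed by an index in ['I_M], so that
    each index yields a sequence of frequencies in [N]. Those with coefficients below [ka]
    contribute at most [M * (4 * ka ^+ 2) <= e / 2] and join the error. *)
Lemma l2_frequencies (e : R) : 0 < e -> exists r M : nat,
  exists (kk : forall N, 'I_M -> box p r N) (V : pred 'I_M) (ka C : R),
  [/\ 0 < ka, 0 <= C, forall i, V i -> \forall N \near ultra, ka <= cabs (fhat (kk N i)) &
    \forall N \near ultra, forall a, avgr (fun n : box p r N => cabs (samp (n + a) - samp n) ^+ 2)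
      <= e + C * \sum_(i | V i) cabs (tchar R (kk N i) a - 1) ^+ 2].
Proof.
move=> e0; have [B hB] := tbdd_bounded hb.
have B0 : 0 <= B := le_trans (cabs_ge0 _) (hB 0).
have e80 : 0 < e / 8 by rewrite divr_gt0.
have [r [M HM]] := bounded_frequencies e80.
pose S N := sval (cid (HM N)); have SP N : _ := svalP (cid (HM N)).
have M0 : 0 < M.+1%:R :> R by rewrite ltr0n.
pose ka : R := Order.min 1 (e / (8 * M.+1%:R)).
have ka0 : 0 < ka by rewrite lt_min ltr01 divr_gt0 // mulr_gt0.
have kaM : M%:R * (4 * ka ^+ 2) <= e / 2.
  apply: (@le_trans _ _ (M.+1%:R * (4 * (e / (8 * M.+1%:R))))).
    apply: ler_pM => //; [by rewrite mulr_ge0 ?sqr_ge0|by rewrite ler_nat|rewrite ler_pM2l //].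
    apply: (@le_trans _ _ ka); last by rewrite ge_min lexx orbT.
    by rewrite expr2 ger_pMr // ge_min lexx.
  move: (M.+1%:R : R) M0 => m m0.
  have -> // : m * (4 * (e / (8 * m))) = e / 2 by field; rewrite gt_eqF.
pose sq N := fintype.enum (S N).
pose kk N (i : 'I_M) : box p r N := nth 0 (sq N) i.
pose ok N (i : 'I_M) := (i < size (sq N))%N && (ka <= cabs (fhat (kk N i))).
(* The ultrafilter decides for each of the finitely many indices whether the coefficient is large
   for almost every [N], so that [V] does not depend on [N]. Indices beyond the list, where [nth]
   returns its default, are excluded by [ok]. *)
pose V i := `[< \forall N \near ultra, ok N i >].
exists r, M, kk, V, ka, (B ^+ 2); split => //; first exact: sqr_ge0.
  by move=> i /asboolP; apply: filterS => N /andP[].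
have Vn : \forall N \near ultra, forall i, V i = ok N i.
  apply: filter_forall => i.
  have [H|H] := in_ultra_setVsetC [set N | ok N i] ultra_ultra.
    have -> : V i = true by apply/asboolP.
    by apply: filterS H => N /= ->.
  have -> : V i = false.
    apply/asboolP => H'; have [N [h1 h2]] := filter_ex (filterI H H').
    exact: h1.
  by apply: filterS H => N /= /negP/negbTE ->.
apply: filterS Vn => N VN a.
have Bhat k : cabs (fhat k) <= B.
  apply: cabs_avgc_le => [|n]; first exact: card_box_gt0.
  by rewrite cabsM cabs_conj cabs_tchar mulr1 hB.
have -> : avgr (fun n : box p r N => cabs (samp (n + a) - samp n) ^+ 2) =
    \sum_k cabs (fhat k) ^+ 2 * cabs (tchar R k a - 1) ^+ 2.
  have := l2_shift (@tcharD R p (bsize r N)) (@cabs_tchar R p (bsize r N))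
    (@tchar_sum R p (bsize r N)) (samp (N := N)) a 0.
  by under eq_fun do rewrite addr0; move=> ->; apply: eq_bigr => k _; rewrite tchar0.
have chi2 k : cabs (tchar R k a - 1) ^+ 2 <= 4.
  have : cabs (tchar R k a - 1) <= 2.
    by apply: le_trans (cabsB _ _) _; rewrite cabs_tchar cabs1.
  by have := cabs_ge0 (tchar R k a - 1); nra.
rewrite (bigID (S N)) /= addrC.
have [S1 S2] := SP N.
have -> : e = 4 * (e / 8) + e / 2 by field.
rewrite -addrA; apply: lerD.
  apply: le_trans (_ : 4 * \sum_(k | ~~ S N k) cabs (fhat k) ^+ 2 <= _); last by rewrite ler_pM2l.
  by rewrite mulr_sumr; apply: ler_sum => k _; rewrite mulrC ler_wpM2r ?sqr_ge0.
apply: (@le_trans _ _ (\sum_(i < M | (i < size (sq N))%N)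
   cabs (fhat (kk N i)) ^+ 2 * cabs (tchar R (kk N i) a - 1) ^+ 2)).
  rewrite -big_enum /= -/(sq N) (big_nth 0) big_mkord.
  have sM : (size (sq N) <= M)%N by rewrite -cardE.
  by rewrite (big_ord_widen _ (fun i => cabs (fhat (nth 0 (sq N) i)) ^+ 2 *
    cabs (tchar R (nth 0 (sq N) i) a - 1) ^+ 2) sM).
apply: (@le_trans _ _ (\sum_(i < M) (4 * ka ^+ 2) +
   \sum_(i | V i) B ^+ 2 * cabs (tchar R (kk N i) a - 1) ^+ 2)); last first.
  by rewrite -mulr_sumr lerD2r sumr_const card_ord -[_ *+ M]mulr_natl.
rewrite [X in _ <= _ + X]big_mkcond /= -big_split /= big_mkcond /=; apply: ler_sum => i _.
have c2 := sqr_ge0 (cabs (tchar R (kk N i) a - 1)); have h2 := chi2 (kk N i).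
rewrite VN /ok; case: ifP => //= si; last by rewrite addr0 mulr_ge0 ?sqr_ge0.
have f0 := cabs_ge0 (fhat (kk N i)).
case: ifP => kf.
  apply: ler_wpDl; first by rewrite mulr_ge0 ?sqr_ge0.
  by rewrite ler_wpM2r // lerXn2r ?nnegrE.
rewrite addr0 mulrC ler_pM ?sqr_ge0 // lerXn2r ?nnegrE ?(ltW ka0) //.
by rewrite leNgt; apply/negP => /ltW; rewrite kf.
Qed.

Section limit_character.
Hypothesis hc : ucont h.
Variables (r : nat) (kk : forall N, box p r N) (ka : R).
Hypothesis ka0 : 0 < ka.
Hypothesis kkP : \forall N \near ultra, ka <= cabs (fhat (kk N)).

(** Only the rounded shift acts on the torus, so this limit is neither visibly multiplicative nor
    visibly continuous; both properties come from the lower bound [ka] on the coefficients. *)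
Definition chi (t : 'rV[R]_p) : R[i] := culim (fun N => tchar R (kk N) (ashift r N t)).

Lemma chi_near t (e : R) : 0 < e ->
  \forall N \near ultra, cabs (tchar R (kk N) (ashift r N t) - chi t) <= e.
Proof. by apply: (@culimP _ _ 1) => N; rewrite cabs_tchar. Qed.

Lemma cabs_chi t : cabs (chi t) = 1.
Proof.
apply/eqP; rewrite -subr_eq0; apply/eqP/small_eq0 => e e0.
have [N hN] := filter_ex (chi_near t e0).
have := cabs_lB (chi t) (tchar R (kk N) (ashift r N t)).
have := cabs_lB (tchar R (kk N) (ashift r N t)) (chi t).
rewrite (cabsC (chi t)) cabs_tchar => h1 h2.
by rewrite ler_norml; apply/andP; split; lra.
Qed.

Lemma tchar_diff N (a b : box p r N) (d : R) : ka <= cabs (fhat (kk N)) ->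
  avgr (fun n => cabs (samp (n + a) - samp (n + b))) <= d ->
  ka * cabs (tchar R (kk N) a - tchar R (kk N) b) <= d.
Proof.
move=> kN; apply: le_trans.
have := cabs_hat_shiftB (@tcharD R p (bsize r N)) (@cabs_tchar R p (bsize r N))
  (samp (N := N)) a b (kk N).
apply: le_trans; rewrite mulrC ler_wpM2l ?cabs_ge0 //.
Qed.

(** On the torus [tchar_diff] bounds the difference of the characters by that of the shifted
    samples, divided by [ka]. The ultralimit keeps this because both rounded shifts approximate the
    true translations in mean. *)
Lemma chi_close t t' (d : R) : (forall x, cabs (h (x + t) - h (x + t')) <= d) ->
  ka * cabs (chi t - chi t') <= d.
Proof.
move=> ht; apply/ler_addgt0Pr => e e0.
have e40 : 0 < e / 4 by rewrite divr_gt0.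
have ek0 : 0 < e / (4 * ka) by rewrite divr_gt0 // mulr_gt0.
have hbd := tbdd_bounded hb.
have [N [[k1 [c1 c2]] [a1 a2]]] := filter_ex (filterI (filterI kkP (filterI (chi_near t ek0) (chi_near t' ek0)))
 (filterI (ultra_oo (ashift_close r t hc hbd e40)) (ultra_oo (ashift_close r t' hc hbd e40)))).
have td : ka * cabs (tchar R (kk N) (ashift r N t) - tchar R (kk N) (ashift r N t')) <= e / 4 + (d + e / 4).
  apply: tchar_diff => //; apply: (@le_trans _ _ (avgr (fun n : box p r N =>
    cabs (h (grid R (n + ashift r N t)) - h (grid R n + t)) +
    (d + cabs (h (grid R (n + ashift r N t')) - h (grid R n + t')))))).
    apply: le_avgr => n; apply: le_trans (cabs_dist _ _ (h (grid R n + t))) _; rewrite lerD2l.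
    apply: le_trans (cabs_dist _ _ (h (grid R n + t'))) _.
    by rewrite (cabsC (h (grid R n + t'))) lerD.
  by rewrite !avgrD avgr_cst ?card_box_gt0 // !lerD.
have ekE : ka * (e / (4 * ka)) = e / 4 by field; rewrite gt_eqF.
have := cabs_dist (chi t) (chi t') (tchar R (kk N) (ashift r N t)).
have := cabs_dist (tchar R (kk N) (ashift r N t)) (chi t') (tchar R (kk N) (ashift r N t')).
rewrite (cabsC (chi t) (tchar R _ _)) -(ler_pM2l ka0) => h1; rewrite -(ler_pM2l ka0) => h2.
rewrite -(ler_pM2l ka0) ekE in c1; rewrite -(ler_pM2l ka0) ekE in c2.
rewrite !mulrDr in h1 h2.
have eE : d + e = e / 4 + ((e / 4 + (d + e / 4)) + e / 4) by field.
apply: (le_trans h2); rewrite [leRHS]eE; apply: lerD => //.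
by apply: (le_trans h1); apply: lerD.
Qed.

(** Rounding is not additive, but the rounded shift of [t + t'] and the sum of the rounded shifts
    both approximate translation by [t + t'], so they move [h] almost equally in mean, and
    [tchar_diff] carries this over to the characters. *)
Lemma chiM t t' : chi (t + t') = chi t * chi t'.
Proof.
apply/eqP; rewrite -subr_eq0; apply/eqP; apply: csmall_eq0 => e e0.
have e40 : 0 < e / 4 by rewrite divr_gt0.
have ek0 : 0 < ka * (e / 4) / 3 by rewrite divr_gt0 // mulr_gt0.
have hbd := tbdd_bounded hb.
have hct : ucont (fun x => h (x + t')).
  by move=> e' /hc[d d0 hd]; exists d => // x u ud; rewrite addrAC; exact: hd.
have hbt : bounded (fun x => h (x + t')) by have [B hB] := hbd; exists B.
have [N [[k1 [c1 [c2 c3]]] [a1 [a2 a3]]]] := filter_ex (filterI (filterI kkP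
  (filterI (chi_near t e40) (filterI (chi_near t' e40) (chi_near (t + t') e40))))
 (filterI (ultra_oo (ashift_close r t hct hbt ek0)) (filterI
   (ultra_oo (ashift_close r t' hc hbd ek0)) (ultra_oo (ashift_close r (t + t') hc hbd ek0))))).
have td : cabs (tchar R (kk N) (ashift r N (t + t')) -
    tchar R (kk N) (ashift r N t + ashift r N t')) <= e / 4.
  rewrite -(ler_pM2l ka0); apply: tchar_diff => //.
  apply: (@le_trans _ _ (avgr (fun n : box p r N =>
    cabs (h (grid R (n + ashift r N (t + t'))) - h (grid R n + (t + t'))) +
    (cabs (h (grid R (n + ashift r N t) + t') - h (grid R n + t + t')) +
     cabs (h (grid R (n + ashift r N t + ashift r N t')) - h (grid R (n + ashift r N t) + t')))))).
    apply: le_avgr => n; apply: le_trans (cabs_dist _ _ (h (grid R n + (t + t')))) _; rewrite lerD2l.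
    apply: le_trans (cabs_dist _ _ (h (grid R (n + ashift r N t) + t'))) _.
    by rewrite (addrA (grid R n)) (cabsC (h (grid R n + t + t'))) lerD2l cabsC /samp addrA.
  have a2' := avgr_shift (fun n : box p r N =>
    cabs (h (grid R (n + ashift r N t')) - h (grid R n + t'))) (ashift r N t).
  rewrite avgrD avgrD.
  have -> : ka * (e / 4) = ka * (e / 4) / 3 + (ka * (e / 4) / 3 + ka * (e / 4) / 3) by field.
  by apply: lerD => //; apply: lerD => //; apply: (le_trans _ a2); rewrite -a2'.
rewrite tcharD in td.
have -> : chi (t + t') - chi t * chi t' = (chi (t + t') - tchar R (kk N) (ashift r N (t + t'))) +
  ((tchar R (kk N) (ashift r N (t + t')) -
    tchar R (kk N) (ashift r N t) * tchar R (kk N) (ashift r N t')) +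
   (tchar R (kk N) (ashift r N t) * (tchar R (kk N) (ashift r N t') - chi t') +
    (tchar R (kk N) (ashift r N t) - chi t) * chi t')) by ring.
apply: le_trans (cabsD _ _) _; rewrite cabsC.
have h1 := cabsD (tchar R (kk N) (ashift r N (t + t')) -
    tchar R (kk N) (ashift r N t) * tchar R (kk N) (ashift r N t'))
   (tchar R (kk N) (ashift r N t) * (tchar R (kk N) (ashift r N t') - chi t') +
    (tchar R (kk N) (ashift r N t) - chi t) * chi t').
have h2 := cabsD (tchar R (kk N) (ashift r N t) * (tchar R (kk N) (ashift r N t') - chi t'))
    ((tchar R (kk N) (ashift r N t) - chi t) * chi t').
rewrite !cabsM cabs_tchar cabs_chi mul1r mulr1 in h2.
have eE : e = e / 4 + (e / 4 + (e / 4 + e / 4)) by field.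
rewrite [leRHS]eE; apply: lerD => //; apply: (le_trans h1); apply: lerD => //.
exact: (le_trans h2 (lerD c2 c1)).
Qed.

Lemma chi_ucont : ucont chi.
Proof.
move=> e e0; have [d d0 hd] := hc (mulr_gt0 ka0 e0); exists d => // x t td.
rewrite -(ler_pM2l ka0); apply: chi_close => y; rewrite addrA; exact: hd.
Qed.

Lemma chi_tbdd : tbdd chi.
Proof.
move=> e e0; have [I [col cP']] := hb (mulr_gt0 ka0 e0); exists I, col => t t' /cP' H x.
rewrite -(ler_pM2l ka0); apply: chi_close => y; rewrite !addrA; exact: H.
Qed.

(** [mean_motion] applied to [chi] itself gives a logarithm [i <t, la> + g] with [g] bounded.
    Multiplicativity makes [g - g 0] additive, and a bounded additive function vanishes. *)
Lemma chi_exp : exists la, forall t, chi t = cexp (Complex 0 (ip t la)).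
Proof.
have c1 x : 1 <= cabs (chi x) by rewrite cabs_chi.
have [L [LE [d d0 LC]]] := rv_log chi_ucont ltr01 c1.
have Lc := ucont_log chi_ucont ltr01 c1 d0 LC.
have [la [G gG]] := mean_motion chi_tbdd ltr01 c1 Lc LE.
have n0 z : chi z != 0 by rewrite -cabs_gt0 cabs_chi.
have chi0 : chi 0 = 1.
  by have := chiM 0 0; rewrite addr0 => /(congr1 (fun w => w / chi 0)); rewrite divff // mulfK.
exists la; pose g x := L x - Complex 0 (ip x la).
have gE x : g x = L x - Complex 0 (ip x la) by [].
have gL t y : g (y + t) - g y - (g t - g 0) = L (y + t) - L y - (L t - L 0).
  rewrite !gE; have -> : Complex 0 (ip (y + t) la) = Complex 0 (ip y la) + Complex 0 (ip t la) :> R[i].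
    by apply: cP; rewrite /= ?ipDl ?addr0.
  have -> : Complex 0 (ip 0 la) = 0 :> R[i] by rewrite ip0l.
  by ring.
have [d1 d10 Ld] := Lc (1 / 4) ltac:(by rewrite divr_gt0).
have add t y : g (y + t) - g y = g t - g 0.
  apply/eqP; rewrite -subr_eq0 gL.
  rewrite (@const_of_cexp1 _ _ (fun y => L (y + t) - L y - (L t - L 0)) d1 d10) => [|x|x u ud].
  - by rewrite add0r subrr.
  -
  rewrite !cexpB !LE chiM.
    by rewrite chi0 divr1 [chi x * _]mulrC mulfK // divff.
  have := le_trans (normIm_le _) (Ld (x + t) u ud).
  have := le_trans (normIm_le _) (Ld x u ud).
  rewrite !cImB [x + u + t]addrAC; have := pi_ge2 R.
  move: (complex.Im (L (x + t + u))) (complex.Im (L (x + t))) (complex.Im (L (x + u)))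
    (complex.Im (L x)) (complex.Im (L t)) (complex.Im (L 0)) => a1 a2 a3 a4 a5 a6.
  rewrite !ltr_norml !ler_norml [pi *+ 2]mulr2n.
  by move=> ? /andP[? ?] /andP[? ?]; apply/andP; split; lra.
have G0 : 0 <= G := le_trans (cabs_ge0 _) (gG 0).
have gn t n : g (t *+ n) - g 0 = (g t - g 0) *+ n.
  elim: n => [|n IH]; first by rewrite !mulr0n subrr.
  by rewrite mulrSr [RHS]mulrSr -IH -(add t (t *+ n)); ring.
have gc t : g t = g 0.
  apply/eqP; rewrite -subr_eq0; apply/eqP; apply: csmall_eq0 => e e0.
  have [N hN] := filter_ex (near_inv (2 * G) e0).
  apply: le_trans hN; rewrite ler_pdivlMr ?ltr0n // mulrC -[N.+1%:R]cabs_nat -cabsM mulr_natl -gn.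
  by apply: le_trans (cabsB _ _) _; have := gG (t *+ N.+1); have := gG 0; rewrite -!gE; lra.
have g0 : cexp (g 0) = 1.
  rewrite gE ip0l cexpB LE chi0.
  by rewrite (_ : Complex 0 0 = 0 :> R[i]) // cexp0 divr1.
move=> t; have -> : Complex 0 (ip t la) = L t - g t by rewrite gE; ring.
by rewrite gc cexpB g0 divr1 LE.
Qed.

(** This is what puts the limit frequency in the spectrum: its coefficient in the sense of means
    keeps the lower bound [ka] through the ultralimit. *)
Lemma chi_coefficient : ka <= cabs (Mean r (fun x => h x * (chi x)^*%C)) /\
  cmean (fun x => h x * (chi x)^*%C) (Mean r (fun x => h x * (chi x)^*%C)).
Proof.
set u := fun x => _; set m := Mean r u.
have [B hB] := tbdd_bounded hb.
have chib : bounded (fun x => (chi x)^*%C) by exists 1 => x; rewrite cabs_conj cabs_chi.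
have chib' : bounded chi by exists 1 => x; rewrite cabs_chi.
have conjM (a b : R[i]) : (a * b)^*%C = a^*%C * b^*%C by rewrite rmorphM.
have conjB (a b : R[i]) : cabs (a^*%C - b^*%C) = cabs (a - b) by rewrite -rmorphB cabs_conj.
have chic : ucont (fun x => (chi x)^*%C).
  by move=> e /chi_ucont[d d0 H]; exists d => // x t td; rewrite conjB H.
have chit : tbdd (fun x => (chi x)^*%C).
  by move=> e /chi_tbdd[I [c H]]; exists I, c => t t' tt x; rewrite conjB H.
have uc : ucont u by apply: ucontM => //; exists B.
have ut : tbdd u by exact: tbddM.
have um := cmean_exists r uc ut; split => //.
apply/ler_addgt0Pr => e e0; have e40 : 0 < e / 4 by rewrite divr_gt0.
have B0 : 0 <= B := le_trans (cabs_ge0 _) (hB 0).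
have B10 : 0 < B + 1 by rewrite ltr_wpDl.
have eB0 : 0 < e / (4 * (B + 1)) by rewrite divr_gt0 // mulr_gt0.
have [J [s [J0 HJ]]] := um _ e40.
have Hn : \forall N \near ultra, forall j : J,
    avgr (fun n : box p r N => cabs (h (grid R (n + ashift r N (s j))) - h (grid R n + s j))) <= e / 4 /\
    cabs (tchar R (kk N) (ashift r N (s j)) - chi (s j)) <= e / (4 * (B + 1)).
  apply: filter_forall => j; apply: filterI; last exact: chi_near.
  by apply: ultra_oo; apply: ashift_close => //; exists B.
have [N [k1 HN]] := filter_ex (filterI kkP Hn).
have hatB : cabs (fhat (kk N)) <= B.
  apply: cabs_avgc_le => [|n]; first exact: card_box_gt0.
  by rewrite cabsM cabs_conj cabs_tchar mulr1 hB.
pose tc n := (tchar R (kk N) n)^*%C.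
have chin x : chi x * (chi x)^*%C = 1 by rewrite mulcJ cabs_chi expr1n.
(* Compare the two evaluations of the average over [n] and [j] of
   h (grid n + s j) conj (chi (s j)) conj (tchar n). *)
pose W := avgc (fun n : box p r N => avgc (fun j : J => h (grid R n + s j) * (chi (s j))^*%C) * tc n).
have W1 : cabs W <= cabs m + e / 4.
  apply: cabs_avgc_le => [|n]; first exact: card_box_gt0.
  rewrite cabsM cabs_conj cabs_tchar mulr1.
  have -> : avgc (fun j : J => h (grid R n + s j) * (chi (s j))^*%C) =
     chi (grid R n) * avgc (fun j : J => u (grid R n + s j)).
    rewrite -avgcZ; congr avgc; apply: funext => j; rewrite /u chiM conjM -[LHS]mul1r -(chin (grid R n)).
    by move: (chi _) ((chi _)^*%C) ((chi _)^*%C) => *; ring.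
  rewrite cabsM cabs_chi mul1r; have := HJ (grid R n); have := cabs_lB (avgc (fun j => u (grid R n + s j))) m.
  by rewrite -/m; lra.
have W2 : cabs (W - fhat (kk N)) <= e / 4 + e / 4.
  have -> : W = avgc (fun j : J => (chi (s j))^*%C * avgc (fun n : box p r N => h (grid R n + s j) * tc n)).
    rewrite /W -[RHS](_ : avgc (fun j => avgc (fun n : box p r N => (h (grid R n + s j) * (chi (s j))^*%C) * tc n)) = _).
      rewrite avgc_exchange; congr avgc; apply: funext => n.
      by rewrite mulrC -avgcZ; congr avgc; apply: funext => j; rewrite mulrC.
    by congr avgc; apply: funext => j; rewrite -avgcZ; congr avgc; apply: funext => n; ring.
  have -> : fhat (kk N) = avgc (fun j : J => (chi (s j))^*%C * (chi (s j) * fhat (kk N))).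
    by under eq_fun => j do rewrite mulrA (mulrC (_^*)%C) chin mul1r; rewrite avgc_cst.
  rewrite -avgcB; apply: cabs_avgc_le => // j; have [hj1 hj2] := HN j.
  rewrite -mulrBr cabsM cabs_conj cabs_chi mul1r.
  apply: le_trans (cabs_dist _ _ (tchar R (kk N) (ashift r N (s j)) * fhat (kk N))) _.
  apply: lerD; last first.
    rewrite -mulrBl cabsM; apply: (@le_trans _ _ (e / (4 * (B + 1)) * (B + 1))).
      by rewrite ler_pM ?cabs_ge0 // (le_trans hatB) // lerDl.
    by rewrite le_eqVlt; apply/orP; left; apply/eqP; field; rewrite gt_eqF.
  have := hat_shift (@tcharD R p (bsize r N)) (@cabs_tchar R p (bsize r N))
    (samp (N := N)) (ashift r N (s j)) (kk N); rewrite /= -/(fhat (kk N)) => <-.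
  rewrite /hat -avgcB; apply: le_trans (cabs_avgc _) _; apply: le_trans hj1.
  by apply: le_avgr => n; rewrite -mulrBl cabsM cabs_conj cabs_tchar mulr1 cabsC.
have := cabs_lB (fhat (kk N)) W; rewrite cabsC; move: k1 W1 W2.
by move: (cabs (fhat (kk N))) (cabs W) (cabs _) => a b c *; lra.
Qed.

End limit_character.
End frequencies.

Lemma conj_cexp_imag (R : realType) (a : R) :
  (cexp (Complex 0 a))^*%C = cexp (Complex 0 (- a)).
Proof. by apply: cP; rewrite /cexp /= ?cosN ?sinN ?mulrN. Qed.

(** * Almost periods controlled by finitely many frequencies *)

Section bohr.
Variables (R : realType) (p : nat) (h : 'rV[R]_p -> R[i]).
Hypotheses (hc : ucont h) (hb : tbdd h).

(* A large value of [D x = h (x + t) - h x] at one point is repeated, up to a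
   finite set of shifts not depending on [t], at every point. *)
Lemma sup_of_l2 (de : R) : 0 < de -> exists2 e1 : R, 0 < e1 & forall r t,
  (\forall N \near ultra, avgr (fun n : box p r N => cabs (h (grid R n + t) - h (grid R n)) ^+ 2) <= e1) ->
  forall x, cabs (h (x + t) - h x) <= de.
Proof.
move=> de0; have de80 : 0 < de / 8 by rewrite divr_gt0.
have [I [s sP]] := tbdd_reps hb de80.
have K0 : 0 < (2 * (#|I|%:R + 1)) :> R by rewrite mulr_gt0 // ltr_wpDl.
(* If the difference exceeded [de] somewhere, the [#|I|] mean squares of its shifts would add up to
   at least [(de / 2) ^+ 2], while each is at most [3 / 2 * e1]; with this [e1] the total is
   smaller. *)
pose e1 := (de / 2) ^+ 2 / (2 * (#|I|%:R + 1)).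
have e10 : 0 < e1 by rewrite divr_gt0 // exprn_gt0 // divr_gt0.
exists e1 => // r t H x0; rewrite leNgt; apply/negP => big.
have [B hB] := tbdd_bounded hb.
have B0 : 0 <= B := le_trans (cabs_ge0 _) (hB 0).
pose u x : R[i] := (cabs (h (x + t) - h x) ^+ 2)%:C%C.
have D2 x : cabs (h (x + t) - h x) <= 2 * B.
  by apply: le_trans (cabsB _ _) _; have := hB (x + t); have := hB x; lra.
have ub : bounded u.
  exists ((2 * B) ^+ 2) => x; rewrite cabsR ger0_norm ?sqr_ge0 //.
  by rewrite lerXn2r ?nnegrE ?cabs_ge0 // mulr_ge0.
have uc : ucont u.
  move=> e e0; have C0 : 0 < 8 * (B + 1) by rewrite mulr_gt0 // ltr_wpDl.
  have [d d0 hd] := hc (divr_gt0 e0 C0); exists d => // x w wd.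
  rewrite /u -rmorphB /= cabsR; set a := cabs _; set b := cabs (h (x + t) - h x).
  have ab : `|a - b| <= 2 * (e / (8 * (B + 1))).
    have -> : 2 * (e / (8 * (B + 1))) = e / (8 * (B + 1)) + e / (8 * (B + 1)) by ring.
    have l1 : cabs (h (x + w + t) - h (x + w) - (h (x + t) - h x)) <= e / (8 * (B + 1)) + e / (8 * (B + 1)).
      have -> : h (x + w + t) - h (x + w) - (h (x + t) - h x) =
        (h (x + t + w) - h (x + t)) - (h (x + w) - h x) by rewrite [x + w + t]addrAC; ring.
      by apply: le_trans (cabsB _ _) _; apply: lerD; exact: hd.
    have := cabs_lB (h (x + w + t) - h (x + w)) (h (x + t) - h x).
    have := cabs_lB (h (x + t) - h x) (h (x + w + t) - h (x + w)).
    rewrite (cabsC (h (x + t) - h x)) -/a -/b => l2 l3.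
    by rewrite ler_norml; apply/andP; split; move: l1 l2 l3; move: (_ / _) => *; lra.
  have -> : a ^+ 2 - b ^+ 2 = (a - b) * (a + b) by ring.
  rewrite normrM; apply: (@le_trans _ _ (2 * (e / (8 * (B + 1))) * (4 * (B + 1)))).
    have ab0 : 0 <= a + b by rewrite addr_ge0 ?cabs_ge0.
    have := D2 (x + w); have := D2 x; rewrite -/a -/b => da db.
    by rewrite ler_pM // ger0_norm //; lra.
  by rewrite le_eqVlt; apply/orP; left; apply/eqP; field; rewrite gt_eqF // ltr_wpDl.
have uR N t' : complex.Re (gavg r N (fun x => u (x + t'))) =
    avgr (fun n : box p r N => cabs (h (grid R n + t' + t) - h (grid R n + t')) ^+ 2).
  by rewrite Re_avgc.
have M1 : complex.Re (Mean r u) <= e1.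
  apply/ler_addgt0Pr => e e0; have [N [h1 h2]] := filter_ex (filterI H (Mean_near r ub e0)).
  have := le_trans (normRe_le _) h2; rewrite cReB.
  have := uR N 0; under eq_fun do rewrite addr0; move=> ->.
  under eq_fun do rewrite addr0.
  rewrite ler_norml => /andP[h3 _]; move: h1 h3; move: (avgr _) => *; lra.
have Hn : \forall N \near ultra, forall i : I,
    cabs (gavg r N (fun x => u (x + (x0 - s i))) - Mean r u) <= e1 / 2.
  apply: filter_forall => i; rewrite -(Mean_shift r (x0 - s i) uc ub).
  apply: Mean_near; last by rewrite divr_gt0.
  by have [U hU] := ub; exists U.
have [N HN] := filter_ex Hn.
have pt x : (de / 2) ^+ 2 <= \sum_i cabs (h (x + (x0 - s i) + t) - h (x + (x0 - s i))) ^+ 2.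
  have [i iP] := sP x; rewrite (bigD1 i) //= ler_wpDr //; first by apply: sumr_ge0 => j _; exact: sqr_ge0.
  rewrite lerXn2r ?nnegrE ?cabs_ge0 ?divr_ge0 ?(ltW de0) //.
  have := iP (x0 - s i + t); have := iP (x0 - s i).
  have E1 : x0 - s i + x = x + (x0 - s i) by rewrite addrC.
  have E2 : x0 - s i + t + x = x + (x0 - s i) + t by rewrite addrAC E1.
  have E3 : x0 - s i + t + s i = x0 + t by rewrite addrAC subrK.
  rewrite E1 E2 E3 subrK => q1 q2.
  have := cabs_lB (h (x0 + t) - h x0) (h (x + (x0 - s i) + t) - h (x + (x0 - s i))).
  have -> : h (x0 + t) - h x0 - (h (x + (x0 - s i) + t) - h (x + (x0 - s i))) =
    (h (x + (x0 - s i)) - h x0) - (h (x + (x0 - s i) + t) - h (x0 + t)) by ring.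
  have := cabsB (h (x + (x0 - s i)) - h x0) (h (x + (x0 - s i) + t) - h (x0 + t)).
  by move: q1 q2 big; move: (cabs _) (cabs _) (cabs _) (cabs _) (cabs _) => *; lra.
have A1 : (de / 2) ^+ 2 <= \sum_(i : I) (e1 + e1 / 2).
  rewrite -(@avgr_cst R (box p r N) ((de / 2) ^+ 2) (card_box_gt0 p r N)).
  apply: (@le_trans _ _ (\sum_(i : I) complex.Re (gavg r N (fun x => u (x + (x0 - s i)))))).
    under eq_bigr do rewrite uR.
    by rewrite -avgr_sum; apply: le_avgr => n; exact: pt.
  apply: ler_sum => i _; have := le_trans (normRe_le _) (HN i); rewrite cReB.
  by rewrite ler_norml => /andP[_]; lra.
rewrite sumr_const -[X in _ <= X]mulr_natl in A1; move: A1; apply/negP; rewrite -ltNge.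
have -> : #|I|%:R * (e1 + e1 / 2) = (3 / 4) * (2 * #|I|%:R * e1) by field.
have h1 : 2 * #|I|%:R * e1 < (de / 2) ^+ 2.
  rewrite /e1 mulrA ltr_pdivrMr // mulrC ltr_pM2l ?exprn_gt0 ?divr_gt0 //; lra.
have h2 : 0 <= 2 * #|I|%:R * e1 by rewrite !mulr_ge0 // ltW.
by move: h1 h2; move: (2 * _ * e1) ((de / 2) ^+ 2) => *; lra.
Qed.

(** Bohr's description of almost periods by Diophantine inequalities. The inequalities bring the
    torus characters of the important frequencies close to 1, hence the mean square of the
    difference is small by [l2_frequencies], hence its supremum by [sup_of_l2]. *)
Lemma bohr_control (de : R) : 0 < de -> exists (I : finType) (la : I -> 'rV[R]_p) (eta : R),
  [/\ 0 < eta, forall i, exists m, m != 0 /\ cmean (fun x => h x * cexp (Complex 0 (- ip x (la i)))) m &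
   forall t, (forall i, cabs (cexp (Complex 0 (ip t (la i))) - 1) <= eta) ->
     forall x, cabs (h (x + t) - h x) <= de].
Proof.
move=> de0; have [e1 e10 He1] := sup_of_l2 de0.
have e80 : 0 < e1 / 8 by rewrite divr_gt0.
have [r [M [kk [V [ka [C [ka0 C0 kkP KP]]]]]]] := l2_frequencies hb e80.
have [B hB] := tbdd_bounded hb.
have B0 : 0 <= B := le_trans (cabs_ge0 _) (hB 0).
pose I : finType := {i : 'I_M | V i}.
have HI (i : I) : exists la, (forall t, chi (fun N => kk N (val i)) t = cexp (Complex 0 (ip t la))) /\
   exists m, m != 0 /\ cmean (fun x => h x * cexp (Complex 0 (- ip x la))) m.
  have kP := kkP (val i) (valP i).
  have [la laE] := chi_exp hb hc ka0 kP.
  exists la; split => //.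
  have [m1 m2] := chi_coefficient hb hc ka0 kP.
  have E : (fun x => h x * cexp (Complex 0 (- ip x la))) = (fun x => h x * (chi (fun N => kk N (val i)) x)^*%C).
    by apply: funext => x; rewrite laE conj_cexp_imag.
  rewrite E; eexists; split; last exact: m2.
  by rewrite -cabs_gt0 (lt_le_trans ka0).
have [la laP] := choice HI.
have CM0 : 0 < 32 * (C * M%:R + 1) by rewrite mulr_gt0 // ltr_wpDl // mulr_ge0.
pose eta := Order.min 1 (e1 / (32 * (C * M%:R + 1))).
have eta0 : 0 < eta by rewrite lt_min ltr01 divr_gt0.
have etaC : C * (M%:R * (2 * eta) ^+ 2) <= e1 / 8.
  have e2 : eta ^+ 2 <= e1 / (32 * (C * M%:R + 1)).
    apply: (@le_trans _ _ eta); last by rewrite ge_min lexx orbT.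
    by rewrite expr2 ger_pMr // ge_min lexx.
  have -> : C * (M%:R * (2 * eta) ^+ 2) = 4 * (C * M%:R) * eta ^+ 2 by ring.
  apply: (@le_trans _ _ (4 * (C * M%:R + 1) * (e1 / (32 * (C * M%:R + 1))))).
    by rewrite ler_pM ?sqr_ge0 ?mulr_ge0 // ler_pM2l // lerDl.
  have : 0 < C * M%:R + 1 by rewrite ltr_wpDl // mulr_ge0.
  move: (C * M%:R + 1) => c c0.
  by rewrite le_eqVlt; apply/orP; left; apply/eqP; field; rewrite gt_eqF.
exists I, la, eta; split => //; first by move=> i; case: (laP i).
move=> t Ht; apply: (He1 r).
have eB0 : 0 < e1 / (8 * (B + 1)) by rewrite divr_gt0 // mulr_gt0 // ltr_wpDl.
have hbd := tbdd_bounded hb.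
have Hn : \forall N \near ultra, forall i : I,
    cabs (tchar R (kk N (val i)) (ashift r N t) - chi (fun N => kk N (val i)) t) <= eta.
  apply: filter_forall => i; exact: (chi_near (fun N => kk N (val i))).
apply: filterS3 KP Hn (ultra_oo (ashift_close r t hc hbd eB0)) => N K1 K2 K3.
set a := ashift r N t in K2 K3.
have S1 : \sum_(i | V i) cabs (tchar R (kk N i) a - 1) ^+ 2 <= M%:R * (2 * eta) ^+ 2.
  have -> : M%:R * (2 * eta) ^+ 2 = \sum_(i < M) (2 * eta) ^+ 2 by rewrite sumr_const card_ord mulr_natl.
  rewrite big_mkcond /=; apply: ler_sum => i _; case: ifP => Vi; last exact: sqr_ge0.
  rewrite lerXn2r ?nnegrE ?cabs_ge0 ?mulr_ge0 ?(ltW eta0) //.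
  have := K2 (exist _ i Vi); have := Ht (exist _ i Vi); rewrite -(laP (exist _ i Vi)).1 /= => k1 k2.
  have := cabs_dist (tchar R (kk N i) a) 1 (chi (fun N => kk N i) t).
  by move: k1 k2; move: (cabs _) (cabs _) (cabs _) => *; lra.
have {}K1 := K1 a.
(* The torus shift [a] is replaced by the true translation [t]. The resulting error is small only in
   mean, so its square is first reduced to its modulus by the bound [2 * B]. The budget is
   [2 * (e1 / 8 + e1 / 8) + e1 / 2]. *)
apply: (@le_trans _ _ (avgr (fun n : box p r N => 2 * cabs (samp h (n + a) - samp h n) ^+ 2 +
   4 * B * cabs (h (grid R (n + a)) - h (grid R n + t))))).
  apply: le_avgr => n; rewrite /samp.
  have d1 := cabs_dist (h (grid R n + t)) (h (grid R n)) (h (grid R (n + a))).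
  rewrite (cabsC (h (grid R n + t)) (h (grid R (n + a)))) in d1.
  have c0 := cabs_ge0 (h (grid R n + t) - h (grid R n)).
  have c1 := cabs_ge0 (h (grid R (n + a)) - h (grid R n + t)).
  have c2 := cabs_ge0 (h (grid R (n + a)) - h (grid R n)).
  have c3 : cabs (h (grid R (n + a)) - h (grid R n + t)) <= 2 * B.
    by apply: le_trans (cabsB _ _) _; rewrite mulr2n mulrDl mul1r lerD.
  move: d1 c0 c1 c2 c3; move: (cabs _) (cabs _) (cabs _) => x y z d1 c0 c1 c2 c3.
  have k1 : z ^+ 2 <= (y + x) ^+ 2 by rewrite lerXn2r ?nnegrE ?addr_ge0.
  have k2 : (y + x) ^+ 2 <= 2 * x ^+ 2 + 2 * y ^+ 2 by have := sqr_ge0 (y - x); nra.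
  have k3 : y ^+ 2 <= 2 * B * y by rewrite expr2 ler_wpM2r.
  by nra.
rewrite avgrD !avgrZ.
have K3' : 4 * B * avgr (fun n : box p r N => cabs (h (grid R (n + a)) - h (grid R n + t))) <= e1 / 2.
  apply: (@le_trans _ _ (4 * (B + 1) * (e1 / (8 * (B + 1))))).
    have A0 : 0 <= avgr (fun n : box p r N => cabs (h (grid R (n + a)) - h (grid R n + t))).
      by apply: avgr_ge0 => n; exact: cabs_ge0.
    by apply: ler_pM => //; [rewrite mulr_ge0|rewrite ler_pM2l // lerDl].
  have : 0 < B + 1 by rewrite ltr_wpDl.
  move: (B + 1) => c c0.
  by rewrite le_eqVlt; apply/orP; left; apply/eqP; field; rewrite gt_eqF.
have S2 := ler_wpM2l C0 S1.
move: K1 K3' S2 etaC; move: (avgr _) (4 * B * _) (C * _) (C * _) => *; lra.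
Qed.

End bohr.

(** * The mean motion lies in the span of the spectrum *)

Section kernel.
Variables (R : realType) (p r : nat).
Implicit Types (u v : 'rV[R]_p -> R[i]) (x t mu la : 'rV[R]_p).

Definition ee (a : R) : R[i] := cexp (Complex 0 a).

Lemma eeD a b : ee (a + b) = ee a * ee b.
Proof. by rewrite /ee -cexpD; congr cexp; apply: cP; rewrite /= ?addr0. Qed.

Lemma cabs_ee a : cabs (ee a) = 1.
Proof. by rewrite /ee cabs_cexp expR0. Qed.

Lemma Re_ee a : complex.Re (ee a) = cos a.
Proof. by rewrite /ee /cexp /= expR0 mul1r. Qed.

Lemma Im_ee a : complex.Im (ee a) = sin a.
Proof. by rewrite /ee /cexp /= expR0 mul1r. Qed.

Lemma cabs_ee1 a : cabs (ee a - 1) ^+ 2 = 2 - 2 * cos a.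
Proof.
rewrite cabs_sqr cReB cImB Re_ee Im_ee /= subr0; have := cos2Dsin2 a.
have -> : (cos a - 1) ^+ 2 + sin a ^+ 2 = (cos a ^+ 2 + sin a ^+ 2) - 2 * cos a + 1 by ring.
by move=> ->; ring.
Qed.

Lemma ee_cos a : ee a + ee (- a) = 2 * (cos a)%:C%C.
Proof.
apply: cP; rewrite ?cReD ?cImD ?cReM ?cImM ?Re_ee ?Im_ee /= ?cosN ?sinN ?mulr0 ?mul0r ?addr0 ?addrN ?add0r ?mul0r //.
  by rewrite subr0; ring.
Qed.

Lemma ee_ucont la : ucont (fun x => ee (ip x la)).
Proof.
move=> e e0; have [d d0 hd] : exists2 d : R, 0 < d & forall a, `|a| < d -> cabs (ee a - 1) <= e.
  have e20 : 0 < e ^+ 2 / 2 by rewrite divr_gt0 // exprn_gt0.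
  have /cvgr_dist_le/(_ _ e20)[d d0 hd] := @continuous_cos R 0.
  exists d => // a ad; have := hd a; rewrite /= sub0r normrN => /(_ ad).
  rewrite cos0 ler_norml => /andP[h1 h2].
  rewrite -(@ler_pXn2r _ 2) ?nnegrE ?cabs_ge0 ?(ltW e0) // cabs_ee1; lra.
have A0 : 0 < \sum_j `|la 0 j| + 1 by rewrite ltr_wpDl // sumr_ge0.
exists (d / (\sum_j `|la 0 j| + 1)); first by rewrite divr_gt0.
move=> x t; rewrite ltr_pdivlMr // => td.
rewrite ipDl eeD -[X in _ - X]mulr1 -mulrBr cabsM cabs_ee mul1r; apply: hd.
apply: le_lt_trans (ip_norm _ _) _; apply: le_lt_trans td.
by rewrite ler_wpM2l // lerDl.
Qed.

Lemma ee_bounded la : bounded (fun x => ee (ip x la)).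
Proof. by exists 1 => x; rewrite cabs_ee. Qed.

Lemma bounded_mul u v : bounded u -> bounded v -> bounded (fun x => u x * v x).
Proof.
move=> [A uA] [B vB]; exists (A * B) => x; rewrite cabsM ler_pM ?cabs_ge0 //.
Qed.

(** A shift [t] with [ip t mu = pi] changes the sign of the exponential, while the mean is invariant
    under shifts. *)
Lemma Mean_ee mu : mu != 0 -> Mean r (fun x => ee (ip x mu)) = 0.
Proof.
move=> mu0; have [j muj] : exists j, mu 0 j != 0.
  apply/existsP; rewrite -[X in is_true X]negbK negb_exists; apply: contra mu0 => /forallP H.
  by apply/eqP/rowP => j; rewrite mxE; apply/eqP; have := H j; rewrite negbK.
pose t : 'rV[R]_p := (pi / mu 0 j) *: delta_mx 0 j.
have tmu : ip t mu = pi.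
  rewrite /ip (bigD1 j) //= big1 ?addr0 => [|k kj]; rewrite !mxE ?eqxx ?(negbTE kj) /= ?mulr0 ?mul0r //.
  by rewrite mulr1 divfK.
have pi1 : ee (pi : R) = -1.
  by apply: cP; rewrite ?cReN ?cImN ?Re_ee ?Im_ee ?cospi ?sinpi ?oppr0.
have := Mean_shift r t (ee_ucont mu) (ee_bounded mu).
have -> : (fun x => ee (ip (x + t) mu)) = (fun x => -1 * ee (ip x mu)).
  by apply: funext => x; rewrite ipDl eeD tmu pi1 mulrC.
rewrite MeanZ; last exact: ee_bounded.
move: (Mean _ _) => m; rewrite mulN1r => /eqP; rewrite eq_sym -subr_eq0 opprK -mulr2n mulrn_eq0.
by move=> /eqP.
Qed.

Lemma Mean_sum (I : Type) (s : seq I) (F : I -> 'rV[R]_p -> R[i]) :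
  (forall i, bounded (F i)) ->
  Mean r (fun x => \sum_(i <- s) F i x) = \sum_(i <- s) Mean r (F i).
Proof.
move=> Fb; have sb s' : bounded (fun x => \sum_(i <- s') F i x).
  elim: s' => [|i s' IH]; first by exists 0 => x; rewrite big_nil cabs0.
  by under eq_fun do rewrite big_cons; exact: boundedD.
elim: s => [|i s IH]; first by under eq_fun do rewrite big_nil; rewrite big_nil Mean_cst.
by under eq_fun do rewrite big_cons; rewrite MeanD // IH big_cons.
Qed.

(** The colour is the integer part of [(F t + B) / e]. With cosines and sines for [F] it discretises
    the circle in [bohr_span]. *)
Lemma interval_colour (T : Type) (F : T -> R) (B e : R) : (forall t : T, `|F t| <= B) -> 0 < e ->
  exists (I : finType) (col : T -> I), forall t t' : T, col t = col t' -> `|F t - F t'| <= e.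
Proof.
move=> FB e0; pose fl (t : T) := Num.floor ((F t + B) / e).
have fl0 (t : T) : 0 <= fl t.
  rewrite /fl floor_ge0 divr_ge0 ?(ltW e0) //.
  by have := FB t; rewrite ler_norml => /andP[]; lra.
pose N := `|Num.floor ((B + B) / e)|%N.
have flN (t : T) : (`|fl t|%N < N.+1)%N.
  have : fl t <= Num.floor ((B + B) / e).
    rewrite le_floor // ler_pM2r ?invr_gt0 // lerD2r.
    by have := FB t; rewrite ler_norml => /andP[].
  by have := fl0 t; rewrite /N; lia.
exists 'I_N.+1, (fun t : T => Ordinal (flN t)) => t t' /(congr1 val) /= E.
have {}E : fl t = fl t' by have := fl0 t; have := fl0 t'; lia.
have /andP[a1 a2] := floor_itv ((F t + B) / e); have /andP[b1 b2] := floor_itv ((F t' + B) / e).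
rewrite -/(fl t) E in a1 a2; rewrite -/(fl t') in b1 b2; rewrite intrD in a2 b2.
have -> : F t - F t' = ((F t + B) / e - (F t' + B) / e) * e by rewrite -mulrBl divfK ?gt_eqF //; ring.
rewrite normrM [`|e|]gtr0_norm // ger_pMl // ler_norml; apply/andP.
by move: a1 a2 b1 b2; move: ((F t + B) / e) ((F t' + B) / e) => *; split; lra.
Qed.

Section span.
Variables (I : finType) (la : I -> 'rV[R]_p).

Definition intspan mu := exists k : I -> int, mu = \sum_i la i *~ k i.

Lemma intspan0 : intspan 0.
Proof. by exists (fun=> 0); rewrite big1. Qed.

Lemma intspan_shift mu i (b : int) : intspan (mu + la i *~ b) -> intspan mu.
Proof.
case=> k E; exists (fun j => k j - (if j == i then b else 0)).
under eq_bigr do rewrite mulrzBr; rewrite sumrB -E.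
rewrite (bigD1 i) //= eqxx big1 ?addr0 ?addrK // => j ji; rewrite (negbTE ji).
by rewrite mulr0z.
Qed.

(** It lies between 0 and 1, equals 1 exactly where [ee (ip x (la i))] is 1, and has only the
    frequencies 0 and plus or minus [la i]. *)
Definition qfac i x : R[i] := ((1 + cos (ip x (la i))) / 2)%:C%C.

Lemma qfacE i x : qfac i x = 1 / 2 + 1 / 4 * ee (ip x (la i)) + 1 / 4 * ee (ip x (- la i)).
Proof.
rewrite ipNr -addrA -mulrDr ee_cos /qfac rmorphM rmorphD /= fmorphV rmorph_nat rmorph1.
by field.
Qed.

(** The last clause places the Fourier support in the integer span; boundedness and uniform
    continuity are carried along so that the rules for [Mean] apply. *)
Definition spectral_in u :=
  [/\ bounded u, ucont u & forall mu, ~ intspan mu -> Mean r (fun x => u x * ee (ip x mu)) = 0].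

Lemma qfac_bounded i : bounded (qfac i).
Proof.
exists 1 => x; rewrite cabsR ger0_norm ?divr_ge0 ?ler_pdivrMr //; have := cos_geN1 (ip x (la i));
  have := cos_le1 (ip x (la i)); lra.
Qed.

Lemma qfac_ucont i : ucont (qfac i).
Proof.
move=> e e0; have [d d0 hd] := ee_ucont (la i) e0; exists d => // x t td.
rewrite /qfac -rmorphB /= cabsR.
have -> : (1 + cos (ip (x + t) (la i))) / 2 - (1 + cos (ip x (la i))) / 2 =
  (cos (ip (x + t) (la i)) - cos (ip x (la i))) / 2 by field.
have := le_trans (normRe_le _) (hd x t td); rewrite cReB !Re_ee.
by rewrite normrM => h; rewrite [`|2^-1|]ger0_norm ?invr_ge0 // ler_pdivrMr //; lra.
Qed.

Lemma spectral_inM u i : spectral_in u -> spectral_in (fun x => u x * qfac i x).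
Proof.
move=> [ub uc um]; split.
- exact: bounded_mul (qfac_bounded i).
- exact: ucontM (qfac_bounded i) _ (qfac_ucont i).
move=> mu muS.
have E : (fun x => u x * qfac i x * ee (ip x mu)) = (fun x => 1 / 2 * (u x * ee (ip x mu)) +
   (1 / 4 * (u x * ee (ip x (mu + la i))) + 1 / 4 * (u x * ee (ip x (mu - la i))))).
  by apply: funext => x; rewrite qfacE !ipDr !eeD; ring.
have bb nu : bounded (fun x => u x * ee (ip x nu)) by apply: bounded_mul => //; exact: ee_bounded.
have h1 := um _ muS.
have h2 : Mean r (fun x => u x * ee (ip x (mu + la i))) = 0.
  by apply: um => H; apply: muS; apply: (@intspan_shift _ i 1); rewrite mulr1z.
have h3 : Mean r (fun x => u x * ee (ip x (mu - la i))) = 0.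
  by apply: um => H; apply: muS; apply: (@intspan_shift _ i (-1)); rewrite mulrNz mulr1z.
have b2 := boundedZ (1 / 4) (bb (mu + la i)); have b3 := boundedZ (1 / 4) (bb (mu - la i)).
rewrite E (MeanD r (boundedZ (1 / 2) (bb mu)) (boundedD b2 b3)) (MeanD r b2 b3).
by rewrite (MeanZ r _ (bb mu)) (MeanZ r _ (bb (mu + la i))) (MeanZ r _ (bb (mu - la i))) h1 h2 h3 !mulr0 !addr0.
Qed.

Definition qker x : R[i] := \prod_i qfac i x.

Lemma spectral_in_qker n : spectral_in (fun x => qker x ^+ n).
Proof.
elim: n => [|n IH].
  under eq_fun do rewrite expr0; split.
  - by exists 1 => x; rewrite cabs1.
  - by move=> e e0; exists 1 => // x t _; rewrite subrr cabs0 ltW.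
  move=> mu muS; under eq_fun do rewrite mul1r; apply: Mean_ee.
  by apply/eqP => mu0; apply: muS; rewrite mu0; exact: intspan0.
under eq_fun do rewrite exprSr.
suff H (s : seq I) u : spectral_in u -> spectral_in (fun x => u x * \prod_(i <- s) qfac i x).
  exact: H.
elim: s u => [|i s IHs] u us; first by under eq_fun do rewrite big_nil mulr1.
by under eq_fun do rewrite big_cons mulrA; apply/IHs/spectral_inM.
Qed.

(* The powers of the Riesz-type kernel concentrate on the Bohr set, where
   [ee (ip x c)] is close to 1; but if [c] is outside the span they have zero mean against it. *)
Lemma bohr_span c (eta : R) : 0 < eta ->
  (forall t, (forall i, cabs (ee (ip t (la i)) - 1) <= eta) -> cabs (ee (ip t c) - 1) <= 1) ->
  intspan c.
Proof.
move=> eta0 Hc; apply: contrapT => cS.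
pose qr x : R := \prod_i ((1 + cos (ip x (la i))) / 2).
have qE x : qker x = (qr x)%:C%C by rewrite /qker /qr rmorph_prod.
have f0 i x : 0 <= (1 + cos (ip x (la i))) / 2.
  by rewrite divr_ge0 //; have := cos_geN1 (ip x (la i)); lra.
have f1 i x : (1 + cos (ip x (la i))) / 2 <= 1.
  by rewrite ler_pdivrMr //; have := cos_le1 (ip x (la i)); lra.
have q0 x : 0 <= qr x by apply: prodr_ge0 => i _; exact: f0.
have q1 x : qr x <= 1 by apply: prodr_ile1 => i _; apply/andP.
(* By [cabs_ee1], a factor with [|ee a - 1| > eta] is below [1 - eta ^+ 2 / 4]. As all factors lie
   between 0 and 1, off the Bohr set the product is at most [rho = 1 - e2]. *)
pose e2 := Order.min (eta ^+ 2 / 4) (1 / 2).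
have e20 : 0 < e2 by rewrite lt_min !divr_gt0 // exprn_gt0.
have e21 : e2 <= 1 / 2 by rewrite ge_min lexx orbT.
have e2e : e2 <= eta ^+ 2 / 4 by rewrite ge_min lexx.
pose rho := 1 - e2.
have rho0 : 0 < rho by rewrite /rho; lra.
have qU x : rho < qr x -> forall i, cabs (ee (ip x (la i)) - 1) <= eta.
  move=> qx i; rewrite leNgt; apply/negP => H.
  have : eta ^+ 2 < cabs (ee (ip x (la i)) - 1) ^+ 2 by rewrite ltrXn2r ?nnegrE ?cabs_ge0 // ltW.
  rewrite cabs_ee1 => H2.
  have : qr x <= (1 + cos (ip x (la i))) / 2.
    rewrite /qr (bigD1 i) //= ler_piMr //; apply: prodr_ile1 => j _; by apply/andP.
  by move: qx; rewrite /rho; lra.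
(* On the Bohr set [cos (ip x c) >= 1 / 2]; off it the kernel is at most [rho ^+ n], and the loss at
   most [3 / 2] of that. *)
have pt n x : 1 / 2 * qr x ^+ n - 3 / 2 * rho ^+ n <= qr x ^+ n * cos (ip x c).
  have qn : 0 <= qr x ^+ n by rewrite exprn_ge0.
  have rn : 0 <= rho ^+ n by rewrite exprn_ge0 // ltW.
  case: (ltrP rho (qr x)) => H.
    have := Hc x (qU x H) => H1.
    have : cabs (ee (ip x c) - 1) ^+ 2 <= 1 by rewrite exprn_ile1 ?cabs_ge0.
    by rewrite cabs_ee1 => H2; nra.
  have : qr x ^+ n <= rho ^+ n by rewrite lerXn2r ?nnegrE // ltW.
  by have := cos_geN1 (ip x c); nra.
pose d : R := #|I|%:R.
(* Two rates are compared. If [c] is outside the span, the means of [qr ^+ n] are at most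
   [3 * rho ^+ n]; but at every point one of finitely many translates of [qr] is at least [rho'], so
   the means are at least [rho' ^+ n / K]. As [rho < rho'], a large [n] gives a contradiction. *)
pose rho' := 1 - e2 / 2.
have d10 : 0 < d + 1 by rewrite ltr_wpDl.
pose a := e2 / (2 * (d + 1)).
have a0 : 0 < a by rewrite divr_gt0 // mulr_gt0.
have bern (s : seq I) (g : I -> R) : (forall i, 1 - a <= g i) -> (forall i, 0 <= g i <= 1) ->
    1 - (size s)%:R * a <= \prod_(i <- s) g i.
  move=> g1 g2; elim: s => [|i s IH]; first by rewrite big_nil mul0r subr0.
  rewrite big_cons /= -natr1 mulrDl mul1r.
  have /andP[h1 h2] := g2 i; have := g1 i => h3.
  have : 0 <= \prod_(i <- s) g i <= 1.
    by rewrite prodr_ge0 ?prodr_ile1 // => j _; case/andP: (g2 j).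
  move=> /andP[k1 k2]; nra.
(* The colour of [x] records approximate cosines and sines of all [ip x (la i)]. If [s j] has the
   colour of [x], each [cos (ip (x - s j) (la i))] is near 1, and the Bernoulli inequality [bern]
   bounds the product from below; [a] is chosen so that all factors together lose at most
   [e2 / 2]. *)
have [J [s sP]] : exists (J : finType) (s : J -> 'rV[R]_p), forall x, exists j, rho' <= qr (x - s j).
  pose a1 := Order.min a 1.
  have a10 : 0 < a1 by rewrite lt_min a0 ltr01.
  have a1a : a1 ^+ 2 <= a.
    apply: (@le_trans _ _ a1); last by rewrite ge_min lexx.
    by rewrite expr2 ger_pMr // ge_min lexx orbT.
  pose F1 (v : I * 'rV[R]_p) : R := cos (ip v.2 (la v.1)).
  pose F2 (v : I * 'rV[R]_p) : R := sin (ip v.2 (la v.1)).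
  have F11 (v : I * 'rV[R]_p) : `|F1 v| <= 1 by rewrite ler_norml cos_geN1 cos_le1.
  have F21 (v : I * 'rV[R]_p) : `|F2 v| <= 1 by rewrite ler_norml sin_geN1 sin_le1.
  have [I1 [c1 H1]] := interval_colour F11 a10; have [I2 [c2 H2]] := interval_colour F21 a10.
  pose col (t : 'rV[R]_p) : {ffun I -> I1 * I2} := [ffun i => (c1 (i, t), c2 (i, t))].
  have C (j : {ffun I -> I1 * I2}) : exists t0, forall t, col t = j -> col t = col t0.
    have [[t0 t0j]|H] := pselect (exists t0, col t0 = j).
      by exists t0 => t ->; rewrite t0j.
    by exists 0 => t tj; case: H; exists t.
  have [s sP] := choice C; exists {ffun I -> I1 * I2}, s => x; exists (col x).
  have colE := sP (col x) x erefl.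
  have fac i : 1 - a <= (1 + cos (ip (x - s (col x)) (la i))) / 2.
    have := congr1 (fun j : {ffun I -> I1 * I2} => j i) colE; rewrite !ffunE => -[e1 e2'].
    have g1 := H1 _ _ e1; have g2 := H2 _ _ e2'; rewrite /F1 /F2 /= in g1 g2.
    have : cos (ip (x - s (col x)) (la i)) = cos (ip x (la i)) * cos (ip (s (col x)) (la i)) +
       sin (ip x (la i)) * sin (ip (s (col x)) (la i)) by rewrite ipBl cosB.
    move=> ->; have := cos2Dsin2 (ip x (la i)); have := cos2Dsin2 (ip (s (col x)) (la i)).
    move: g1 g2; move: (cos _) (sin _) (cos _) (sin _) => A1 B1 A2 B2 g1 g2 n1 n2.
    have : (A2 - A1) ^+ 2 <= a1 ^+ 2 by rewrite -real_normK ?num_real // lerXn2r ?nnegrE // ltW.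
    have : (B2 - B1) ^+ 2 <= a1 ^+ 2 by rewrite -real_normK ?num_real // lerXn2r ?nnegrE // ltW.
    nra.
  have := bern (enum I) _ fac; rewrite big_enum /= -/(qr _) -cardE => H.
  apply: (le_trans _ (H _)); last by move=> i; apply/andP.
  have : (d + 1) * a = e2 / 2 by rewrite /a; field; rewrite gt_eqF.
  by rewrite /rho' cardT -cardE -/d; lra.
have rho'0 : 0 < rho' by rewrite /rho'; lra.
have qs n := spectral_in_qker n.
pose m n := complex.Re (Mean r (fun x => qker x ^+ n)).
have bX n : bounded (fun x => qker x ^+ n * ee (ip x c)).
  by apply: bounded_mul; [case: (qs n)|exact: ee_bounded].
have bC (w : R[i]) : bounded (fun _ : 'rV[R]_p => w) by exists (cabs w).
have qX n x : qker x ^+ n = (qr x ^+ n)%:C%C by rewrite qE rmorphXn.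
have ub1 n : m n <= 3 * rho ^+ n.
  have [qb qc /(_ c cS) M0] := qs n.
  have b1 := boundedZ (1 / 2 : R)%:C%C qb; have b2 := bC (- (3 / 2 * rho ^+ n))%:C%C.
  have := Mean_le r (boundedD b1 b2) (bX n).
  rewrite M0 (MeanD r b1 b2) (MeanZ r _ qb) Mean_cst cReD cReM /= mul0r subr0 -/(m n) => H.
  suff : 1 / 2 * m n + - (3 / 2 * rho ^+ n) <= 0 by lra.
  apply: H => x; rewrite cReD !cReM Re_ee qX /= !mul0r !subr0.
  exact: pt.
pose K : R := #|J|%:R.
have lb n : rho' ^+ n <= K * m n.
  have [qb qc _] := qs n.
  have qbs j : bounded (fun x => qker (x - s j) ^+ n) by have [B hB] := qb; exists B.
  have sb : bounded (fun x => \sum_j qker (x - s j) ^+ n).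
    elim: (index_enum J) => [|j js IH]; first by exists 0 => x; rewrite big_nil cabs0.
    by under eq_fun do rewrite big_cons; exact: boundedD.
  have := Mean_le r (bC (rho' ^+ n)%:C%C) sb.
  rewrite Mean_cst Mean_sum // cRe_sum /=.
  have -> : \sum_j complex.Re (Mean r (fun x => qker (x - s j) ^+ n)) = K * m n.
    under eq_bigr do rewrite (Mean_shift r (- s _) qc qb).
    by rewrite sumr_const -[_ *+ _]mulr_natl.
  apply=> x; rewrite cRe_sum; have [j hj] := sP x.
  under eq_bigr do rewrite qX /=.
  rewrite (bigD1 j) //= ler_wpDr ?sumr_ge0 // => [k _|]; first by rewrite exprn_ge0.
  by rewrite lerXn2r ?nnegrE // ltW.
have K0 : 0 <= K by [].
have rr : `|rho / rho'| < 1.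
  by rewrite ger0_norm ?divr_ge0 ?ltr_pdivrMr ?mul1r ?(ltW rho0) ?(ltW rho'0) // /rho /rho'; lra.
have k0 : 0 < (3 * K + 1)^-1 by rewrite invr_gt0; lra.
have /cvgrPdist_lt/(_ _ k0) := cvg_expr rr.
move=> /filter_ex[n]; rewrite sub0r normrN ger0_norm ?exprn_ge0 ?divr_ge0 ?(ltW rho0) ?(ltW rho'0) //.
rewrite expr_div_n ltr_pdivrMr ?exprn_gt0 // mulrC ltr_pdivlMr; last by lra.
have rn : 0 < rho ^+ n by rewrite exprn_gt0.
have := ler_wpM2l K0 (ub1 n); have := lb n; nra.
Qed.

End span.
End kernel.

(** The relative error 1/64 gives by [slice_log] a number [w] with [cexp w = ee (ip t c)] and
    [|w| <= 1 / 16], hence [|ee (ip t c) - 1| <= 1], the tolerance that [bohr_span] asks for. *)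
Lemma mean_motion_span (R : realType) (p : nat) (h g : 'rV[R]_p -> R[i]) (c : 'rV[R]_p) (m : R) :
  ucont h -> tbdd h -> 0 < m -> (forall x, m <= cabs (h x)) ->
  ucont g -> bounded g -> (forall x, h x = cexp (g x + Complex 0 (ip x c))) ->
  exists (I : finType) (la : I -> 'rV[R]_p),
    (forall i, exists w, w != 0 /\ cmean (fun x => h x * cexp (Complex 0 (- ip x (la i)))) w) /\
    intspan la c.
Proof.
move=> hc hb m0 hm gc gb hE; have de0 : 0 < 1 / 64 * m by rewrite mulr_gt0.
have [I [la [eta [eta0 laP Heta]]]] := bohr_control hc hb de0.
exists I, la; split => //; apply: (bohr_span 0 eta0) => t /Heta Ht.
have [] := @slice_log _ _ h g c t 0 (1 / 64) gc gb hE; first by lra.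
  by move=> x; rewrite addr0; apply: le_trans (Ht x) _; rewrite ler_wpM2l // ltW.
rewrite subr0 => _ [w [w1 wE]]; rewrite /ee wE.
have w2 : cabs w <= 1 / 2 by apply: le_trans w1 _; lra.
have := cexp_order2 w2; have := cabs_lB (cexp w - 1) w.
have : cabs w ^+ 2 <= 1 / 16 by have := cabs_ge0 w; nra.
by rewrite -[_ *+ 6]mulr_natr => ? ? ?; lra.
Qed.

(** * Means over cubes *)

Section cube.
Variable R : realType.

Definition rucont p (F : 'rV[R]_p -> R) := forall e : R, 0 < e -> exists2 d : R, 0 < d &
  forall x t, `|t| < d -> `|F (x + t) - F x| <= e.

Lemma rucontL p (F G : 'rV[R]_p -> R) (a : R) : rucont F -> rucont G ->
  rucont (fun x => a * F x + G x).
Proof.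
move=> Fc Gc e e0; have A0 : 0 < `|a| + 1 by rewrite ltr_wpDl.
have e20 : 0 < e / 2 by rewrite divr_gt0.
have [d d0 H] := Fc _ (divr_gt0 e20 A0); have [d' d'0 K] := Gc _ e20.
exists (Order.min d d') => [|x t]; first by rewrite lt_min d0.
rewrite lt_min => /andP[/H h1 /K h2].
have -> : a * F (x + t) + G (x + t) - (a * F x + G x) = a * (F (x + t) - F x) + (G (x + t) - G x) by ring.
apply: le_trans (ler_normD _ _) _; rewrite [leRHS]splitr; apply: lerD; last exact: h2.
rewrite normrM; have -> : e / 2 = (`|a| + 1) * (e / 2 / (`|a| + 1)) by rewrite [RHS]mulrC divfK // gt_eqF.
by rewrite ler_pM // lerDl.
Qed.

Lemma rucont_cst p (a : R) : rucont (fun _ : 'rV[R]_p => a).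
Proof. by move=> e e0; exists 1 => // x t _; rewrite subrr normr0 ltW. Qed.

Lemma rucont_shift p (F : 'rV[R]_p -> R) t : rucont F -> rucont (fun x => F (x + t)).
Proof. by move=> Fc e /Fc[d d0 H]; exists d => // x u ud; rewrite addrAC; exact: H. Qed.

Lemma norm_row_mx p (a : R) (x : 'rV[R]_p) (e : R) : `|a| <= e -> `|x| <= e ->
  `|row_mx (\row_(_ < 1) a) x : 'rV[R]_p.+1| <= e.
Proof.
move=> ae xe; apply: ler_norm_coord => [|j]; first exact: le_trans ae.
case: (@split_ordP 1 p j) => k ->.
  by rewrite (@row_mxEl _ 1 1 p) mxE.
by rewrite (@row_mxEr _ 1 1 p); apply: le_trans xe; exact: ler_coord_norm.
Qed.

Lemma row_mxDl p (a b : R) (x y : 'rV[R]_p) :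
  row_mx (\row_(_ < 1) (a + b)) (x + y) =
  row_mx (\row_(_ < 1) a) x + row_mx (\row_(_ < 1) b) y :> 'rV[R]_p.+1.
Proof.
rewrite -[RHS]/(row_mx (\row_(_ < 1) a) x + row_mx (\row_(_ < 1) b) y : 'rV[R]_(1 + p)).
by rewrite add_row_mx; apply: (f_equal (fun z => @row_mx R 1 1 p z (x + y))); apply/rowP => j; rewrite !mxE.
Qed.

Lemma rucont_slice p (F : 'rV[R]_p.+1 -> R) (a : R) : rucont F ->
  rucont (fun x : 'rV[R]_p => F (row_mx (\row_(_ < 1) a) x)).
Proof.
move=> Fc e /Fc[d d0 H]; exists d => // x t td.
have -> : row_mx (\row_(_ < 1) a) (x + t) =
    row_mx (\row_(_ < 1) a) x + row_mx (\row_(_ < 1) 0) t :> 'rV[R]_p.+1 by rewrite -row_mxDl addr0.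
by apply: H; apply: le_lt_trans td; apply: norm_row_mx; rewrite ?normr0.
Qed.

Variable s : R.
Hypothesis s0 : 0 < s.

Let ss : - s <= s. Proof. by rewrite ge0_cp // ltW. Qed.

(** Both parts go through one induction: linearity in the next dimension needs continuity of the
    slice integrals, which comes from linearity and the bound in one dimension less. *)
Lemma cube_int_props p :
  (forall (F G : 'rV[R]_p -> R) a, rucont F -> rucont G ->
     cube_int s (fun x => a * F x + G x) = a * cube_int s F + cube_int s G) /\
  (forall (F : 'rV[R]_p -> R) K, rucont F -> (forall x, `|F x| <= K) ->
     `|cube_int s F| <= K * (2 * s) ^+ p).
Proof.
elim: p => [|p [IHL IHB]]; first by split=> [F G a _ _ //|F K _ FK /=]; rewrite expr0 mulr1.
have slice_cont (F : 'rV[R]_p.+1 -> R) : rucont F -> forall t,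
    rcont (fun t => cube_int s (fun x => F (row_mx (\row_(_ < 1) t) x))) t.
  move=> Fc t e e0; have S0 : 0 < (2 * s) ^+ p by rewrite exprn_gt0 // mulr_gt0.
  have [d d0 H] := Fc _ (divr_gt0 e0 S0); exists d => // y yt.
  have -> : cube_int s (fun x => F (row_mx (\row_(_ < 1) y) x)) -
      cube_int s (fun x => F (row_mx (\row_(_ < 1) t) x)) =
    cube_int s (fun x => -1 * F (row_mx (\row_(_ < 1) t) x) + F (row_mx (\row_(_ < 1) y) x)).
    by rewrite IHL ?mulN1r 1?addrC //; exact: rucont_slice.
  have := IHB (fun x => -1 * F (row_mx (\row_(_ < 1) t) x) + F (row_mx (\row_(_ < 1) y) x)) (e / (2 * s) ^+ p).
  rewrite divfK ?gt_eqF //; apply=> [|x]; first by apply: rucontL; exact: rucont_slice.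
  rewrite mulN1r addrC.
  have -> : row_mx (\row_(_ < 1) y) x =
    row_mx (\row_(_ < 1) t) x + row_mx (\row_(_ < 1) (y - t)) 0 :> 'rV[R]_p.+1.
    by rewrite -row_mxDl addr0 [t + _]addrC subrK.
  by apply: H; apply: le_lt_trans yt; apply: norm_row_mx; rewrite ?normr0.
split=> [F G a Fc Gc|F K Fc FK] /=.
  transitivity (rint (- s) s (fun t => a * cube_int s (fun x => F (row_mx (\row_(_ < 1) t) x)) +
     cube_int s (fun x => G (row_mx (\row_(_ < 1) t) x)))).
    by apply: eq_rint => t _; rewrite IHL //; exact: rucont_slice.
  rewrite rintD ?rintZ // => t _; last exact: slice_cont.
    exact: slice_cont.
  by apply: rcontZ; exact: slice_cont.
have -> : K * (2 * s) ^+ p.+1 = K * (2 * s) ^+ p * (s - - s) by rewrite exprSr; ring.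
apply: norm_rint_le => // [t _|t _]; first exact: slice_cont.
by apply: IHB => //; exact: rucont_slice.
Qed.

Lemma cube_intL p (F G : 'rV[R]_p -> R) a : rucont F -> rucont G ->
  cube_int s (fun x => a * F x + G x) = a * cube_int s F + cube_int s G.
Proof. exact: (cube_int_props p).1. Qed.

Lemma cube_int_le p (F : 'rV[R]_p -> R) K : rucont F -> (forall x, `|F x| <= K) ->
  `|cube_int s F| <= K * (2 * s) ^+ p.
Proof. exact: (cube_int_props p).2. Qed.

Lemma cube_int_dist p (F G : 'rV[R]_p -> R) K : rucont F -> rucont G ->
  (forall x, `|F x - G x| <= K) -> `|cube_int s F - cube_int s G| <= K * (2 * s) ^+ p.
Proof.
move=> Fc Gc FG; have -> : cube_int s F - cube_int s G = cube_int s (fun x => -1 * G x + F x).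
  by rewrite cube_intL // mulN1r addrC.
by apply: cube_int_le => [|x]; [exact: rucontL|rewrite mulN1r addrC].
Qed.

Lemma slice_rcont p (F : 'rV[R]_p.+1 -> R) : rucont F -> forall t,
  rcont (fun t => cube_int s (fun x => F (row_mx (\row_(_ < 1) t) x))) t.
Proof.
move=> Fc t e e0; have S0 : 0 < (2 * s) ^+ p by rewrite exprn_gt0 // mulr_gt0.
have [d d0 H] := Fc _ (divr_gt0 e0 S0); exists d => // y yt.
have -> : e = e / (2 * s) ^+ p * (2 * s) ^+ p by rewrite divfK ?gt_eqF.
apply: cube_int_dist => [||x]; try exact: rucont_slice.
have -> : row_mx (\row_(_ < 1) y) x =
  row_mx (\row_(_ < 1) t) x + row_mx (\row_(_ < 1) (y - t)) 0 :> 'rV[R]_p.+1.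
  by rewrite -row_mxDl addr0 [t + _]addrC subrK.
by apply: H; apply: le_lt_trans yt; apply: norm_row_mx; rewrite ?normr0.
Qed.

Lemma cube_int_cst p (a : R) : cube_int s (fun _ : 'rV[R]_p => a) = a * (2 * s) ^+ p.
Proof.
elim: p => [|p IH] /=; first by rewrite expr0 mulr1.
under eq_Rintegral do rewrite IH.
by rewrite -/(rint (- s) s _) rint_cst // exprSr; ring.
Qed.

(** The two intervals differ by two segments of length [|a|], whether or not they overlap. *)
Lemma rint_shift_dist (phi : R -> R) (a K : R) : (forall x, rcont phi x) -> (forall x, `|phi x| <= K) ->
  `|rint (- s) s (fun x => phi (x + a)) - rint (- s) s phi| <= 2 * `|a| * K.
Proof.
move=> pc pK; rewrite rint_shift //.
have cc x y : contin x y phi by move=> z _; exact: pc.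
have small x y : x <= y -> `|rint x y phi| <= K * (y - x) by move=> xy; exact: norm_rint_le.
have i2 : - s + a <= s + a by rewrite lerD2r.
case: (lerP 0 a) => a0.
  have i1 : - s <= - s + a by rewrite lerDl.
  have i3 : s <= s + a by rewrite lerDl.
  have E1 := @rint_split _ (- s) (- s + a) (s + a) phi i1 i2 (cc _ _).
  have E2 := @rint_split _ (- s) s (s + a) phi ss i3 (cc _ _).
  have -> : rint (- s + a) (s + a) phi - rint (- s) s phi = rint s (s + a) phi - rint (- s) (- s + a) phi.
    by rewrite E1 in E2; move: E2; move: (rint _ _ _) (rint _ _ _) (rint _ _ _) (rint _ _ _) => *; lra.
  apply: le_trans (ler_normB _ _) _.
  have := small s (s + a) i3; have := small (- s) (- s + a) i1.
  have -> : - s + a - - s = a by ring.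
  have -> : s + a - s = a by ring.
  rewrite (ger0_norm a0); move: `|_| `|_| => *; lra.
have i1 : - s + a <= - s by rewrite gerDl ltW.
have i3 : s + a <= s by rewrite gerDl ltW.
have E1 := @rint_split _ (- s + a) (s + a) s phi i2 i3 (cc _ _).
have E2 := @rint_split _ (- s + a) (- s) s phi i1 ss (cc _ _).
have -> : rint (- s + a) (s + a) phi - rint (- s) s phi = rint (- s + a) (- s) phi - rint (s + a) s phi.
  by rewrite E1 in E2; move: E2; move: (rint _ _ _) (rint _ _ _) (rint _ _ _) (rint _ _ _) => *; lra.
apply: le_trans (ler_normB _ _) _.
have := small (s + a) s i3; have := small (- s + a) (- s) i1.
have -> : - s - (- s + a) = - a by ring.
have -> : s - (s + a) = - a by ring.
rewrite (ltr0_norm a0); move: `|_| `|_| => *; lra.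
Qed.

(** A shifted cube differs from the cube in thin layers: each coordinate costs at most [B * |t| / s]
    times the volume, by [rint_shift_dist] in the first coordinate and by induction in the
    others. *)
Lemma cube_int_shift p (F : 'rV[R]_p -> R) (t : 'rV[R]_p) B : rucont F -> (forall x, `|F x| <= B) ->
  `|cube_int s (fun x => F (x + t)) - cube_int s F| <= p%:R * (B * `|t| / s) * (2 * s) ^+ p.
Proof.
elim: p F t => [|p IH] F t Fc FB.
  have -> : t = 0 by apply/rowP => -[].
  by rewrite /= addr0 subrr normr0 !mul0r.
have B0 : 0 <= B := le_trans (normr_ge0 _) (FB 0).
pose a := t 0 0; pose t' : 'rV[R]_p := rsubmx (t : 'rV_(1 + p)).
have tE : t = row_mx (\row_(_ < 1) a) t'.
  rewrite -[LHS](@hsubmxK _ 1 1 p t).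
  apply: (f_equal (fun z => @row_mx R 1 1 p z t')); apply/rowP => j; rewrite !mxE ord1.
  by congr (t _ _); apply: val_inj.
have at1 : `|a| <= `|t| := ler_coord_norm t 0.
have t't : `|t'| <= `|t|.
  by apply: ler_norm_coord => // j; rewrite mxE; exact: ler_coord_norm.
pose phi y := cube_int s (fun x => F (row_mx (\row_(_ < 1) y) x)).
have phiB y : `|phi y| <= B * (2 * s) ^+ p.
  by apply: cube_int_le => //; exact: rucont_slice.
have phic := slice_rcont Fc; rewrite -/phi in phic.
have Ac := slice_rcont (rucont_shift t Fc).
pose A y := cube_int s (fun x => F (row_mx (\row_(_ < 1) y) x + t)).
have pc y : rcont (fun y => phi (y + a)) y.
  move=> e /(phic (y + a))[d d0 H]; exists d => // z zy; apply: H.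
  by have -> : z + a - (y + a) = z - y by ring.
have AP y : `|A y - phi (y + a)| <= p%:R * (B * `|t'| / s) * (2 * s) ^+ p.
  have -> : A y = cube_int s (fun x => F (row_mx (\row_(_ < 1) (y + a)) (x + t'))).
    by congr (cube_int _); apply: funext => x; rewrite {1}tE -row_mxDl.
  by apply: (IH (fun x => F (row_mx (\row_(_ < 1) (y + a)) x))) => //; exact: rucont_slice.
have S0 : 0 < (2 * s) ^+ p by rewrite exprn_gt0 // mulr_gt0.
have D1 : `|rint (- s) s A - rint (- s) s (fun y => phi (y + a))| <=
    p%:R * (B * `|t'| / s) * (2 * s) ^+ p * (s - - s).
  have -> : rint (- s) s A - rint (- s) s (fun y => phi (y + a)) =
      rint (- s) s (fun y => A y + -1 * phi (y + a)).
    by rewrite rintD ?rintZ ?mulN1r // => y _; apply: rcontZ; exact: pc.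
  apply: norm_rint_le => // y _; last by rewrite mulN1r; exact: AP.
  by apply: rcontD; [exact: Ac|apply: rcontZ; exact: pc].
have D2 := rint_shift_dist a phic phiB.
rewrite -/(rint (- s) s A) -[X in `|_ - X|]/(rint (- s) s phi) -natr1.
have -> : rint (- s) s A - rint (- s) s phi =
  (rint (- s) s A - rint (- s) s (fun y => phi (y + a))) +
  (rint (- s) s (fun y => phi (y + a)) - rint (- s) s phi) by rewrite addrA subrK.
apply: le_trans (ler_normD _ _) _.
have -> : (p%:R + 1) * (B * `|t| / s) * (2 * s) ^+ p.+1 =
  p%:R * (B * `|t| / s) * (2 * s) ^+ p * (s - - s) + 2 * `|t| * (B * (2 * s) ^+ p).
  by rewrite exprSr; field; rewrite gt_eqF.
apply: lerD; [apply: le_trans D1 _|apply: le_trans D2 _].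
  rewrite opprK ler_pM2r ?addr_gt0 //.
  by rewrite ler_pM2r // ler_wpM2l // ler_pM2r ?invr_gt0 // ler_wpM2l.
by rewrite ler_wpM2r ?mulr_ge0 ?(ltW S0) // ler_pM2l.
Qed.

(** Averaging [F] over the shifts [t j] changes its cube mean by a boundary term of order [1 / s],
    and the averaged function is uniformly within [e] of [m]. *)
Lemma cube_mean_near p (F : 'rV[R]_p -> R) (J : finType) (t : J -> 'rV[R]_p) (B m e : R) :
  (0 < #|J|)%N -> rucont F -> (forall x, `|F x| <= B) ->
  (forall x, `|avgr (fun j => F (x + t j)) - m| <= e) ->
  `|cube_mean s F - m| <= e + p%:R * (B * (\sum_j `|t j|) / s).
Proof.
move=> J0 Fc FB H; have S0 : 0 < (2 * s) ^+ p by rewrite exprn_gt0 // mulr_gt0.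
have B0 : 0 <= B := le_trans (normr_ge0 _) (FB 0).
have sumc (js : seq J) : rucont (fun x => \sum_(j <- js) F (x + t j)) /\
    cube_int s (fun x => \sum_(j <- js) F (x + t j)) = \sum_(j <- js) cube_int s (fun x => F (x + t j)).
  elim: js => [|j js [IH1 IH2]].
    by under eq_fun do rewrite big_nil; rewrite big_nil cube_int_cst mul0r; split=> //; exact: rucont_cst.
  under eq_fun do rewrite big_cons -[F _]mul1r; rewrite big_cons; split.
    by apply: rucontL => //; exact: rucont_shift.
  by rewrite cube_intL ?IH2 ?mul1r //; exact: rucont_shift.
pose G x := avgr (fun j => F (x + t j)).
have GE : G = (fun x => (#|J|%:R)^-1 * (\sum_j F (x + t j)) + 0).
  by apply: funext => x; rewrite addr0.
have Gc : rucont G by rewrite GE; apply: rucontL; [exact: (sumc _).1|exact: rucont_cst].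
have GI : cube_int s G = avgr (fun j => cube_int s (fun x => F (x + t j))).
  rewrite GE cube_intL; [|exact: (sumc _).1|exact: rucont_cst].
  by rewrite cube_int_cst mul0r addr0 (sumc _).2.
have h1 : `|cube_int s G - m * (2 * s) ^+ p| <= e * (2 * s) ^+ p.
  by rewrite -cube_int_cst; apply: cube_int_dist => //; exact: rucont_cst.
have h2 : `|cube_int s F - cube_int s G| <= p%:R * (B * (\sum_j `|t j|) / s) * (2 * s) ^+ p.
  have -> : cube_int s F - cube_int s G = - avgr (fun j => cube_int s (fun x => F (x + t j)) + - cube_int s F).
    by rewrite GI avgrD avgr_cst // opprD opprK addrC.
  rewrite normrN /avgr normrM normfV [`|#|J|%:R|]ger0_norm ?ler0n // ler_pdivrMl ?ltr0n //.
  apply: le_trans (ler_norm_sum _ _ _) _.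
  set X := p%:R * _ * _; have -> : #|J|%:R * X = \sum_(j : J) X by rewrite sumr_const mulr_natl.
  apply: ler_sum => j _.
  apply: le_trans (cube_int_shift (t j) Fc FB) _.
  rewrite ler_pM2r // ler_wpM2l // ler_pM2r ?invr_gt0 // ler_wpM2l //.
  by rewrite (bigD1 j) //= lerDl sumr_ge0.
rewrite -(ler_pM2r S0) [leRHS]mulrDl.
have -> : `|cube_mean s F - m| * (2 * s) ^+ p = `|cube_int s F - m * (2 * s) ^+ p|.
  rewrite -{1}(gtr0_norm S0) -normrM /cube_mean mulrBl; congr `|_ - _|.
  by rewrite mulrAC mulVf ?mul1r // gt_eqF.
have -> : cube_int s F - m * (2 * s) ^+ p = (cube_int s G - m * (2 * s) ^+ p) + (cube_int s F - cube_int s G) by ring.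
by apply: le_trans (ler_normD _ _) _; exact: lerD.
Qed.

End cube.

Lemma ucont_Re (R : realType) p (u : 'rV[R]_p -> R[i]) : ucont u -> rucont (fun x => complex.Re (u x)).
Proof. by move=> uc e /uc[d d0 H]; exists d => // x t /(H x); rewrite -cReB; apply: le_trans (normRe_le _). Qed.

Lemma ucont_Im (R : realType) p (u : 'rV[R]_p -> R[i]) : ucont u -> rucont (fun x => complex.Im (u x)).
Proof. by move=> uc e /uc[d d0 H]; exists d => // x t /(H x); rewrite -cImB; apply: le_trans (normIm_le _). Qed.

Lemma cube_mean_cvg (R : realType) p (F : 'rV[R]_p -> R) (m B : R) : rucont F -> (forall x, `|F x| <= B) ->
  (forall e : R, 0 < e -> exists (J : finType) (t : J -> 'rV[R]_p), (0 < #|J|)%N /\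
     forall x, `|avgr (fun j => F (x + t j)) - m| <= e) ->
  (fun s => cube_mean s F) @ +oo --> m.
Proof.
move=> Fc FB H; apply/cvgrPdist_le => e e0; have e20 : 0 < e / 2 by rewrite divr_gt0.
have [J [t [J0 HJ]]] := H _ e20.
have B0 : 0 <= B := le_trans (normr_ge0 _) (FB 0).
pose C := p%:R * (B * \sum_j `|t j|).
have C0 : 0 <= C by rewrite mulr_ge0 ?mulr_ge0 ?sumr_ge0.
exists (2 * C / e + 1); split => [|s /= sC]; first exact: num_real.
have Ce : 0 <= 2 * C / e by apply: divr_ge0; [rewrite mulr_ge0|exact: ltW].
have s0 : 0 < s by apply: le_lt_trans sC; rewrite addr_ge0.
rewrite distrC; apply: (le_trans (cube_mean_near s0 J0 Fc FB HJ)).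
rewrite [leRHS]splitr lerD2l mulrA -/C ler_pdivrMr //.
have : 2 * C / e < s by apply: le_lt_trans sC; rewrite lerDl.
by rewrite ltr_pdivrMr // => ?; lra.
Qed.

Lemma cube_mean_Re (R : realType) p (u : 'rV[R]_p -> R[i]) m : ucont u -> bounded u -> cmean u m ->
  (fun s => cube_mean s (fun x => complex.Re (u x))) @ +oo --> complex.Re m.
Proof.
move=> uc [B uB] um; apply: (@cube_mean_cvg _ _ _ _ B) => [|x|e /um[J [t [J0 H]]]]; first exact: ucont_Re.
  exact: le_trans (normRe_le _) (uB x).
by exists J, t; split => // x; rewrite -Re_avgc -cReB; apply: le_trans (normRe_le _) (H x).
Qed.

Lemma cube_mean_Im (R : realType) p (u : 'rV[R]_p -> R[i]) m : ucont u -> bounded u -> cmean u m ->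
  (fun s => cube_mean s (fun x => complex.Im (u x))) @ +oo --> complex.Im m.
Proof.
move=> uc [B uB] um; apply: (@cube_mean_cvg _ _ _ _ B) => [|x|e /um[J [t [J0 H]]]]; first exact: ucont_Im.
  exact: le_trans (normIm_le _) (uB x).
by exists J, t; split => // x; rewrite -Im_avgc -cImB; apply: le_trans (normIm_le _) (H x).
Qed.

Lemma ccube_mean_cvg (R : realType) p (u : 'rV[R]_p -> R[i]) m : ucont u -> bounded u -> cmean u m ->
  (fun s : R => ccube_mean s u) @ +oo --> m.
Proof.
move=> uc ub um; have /cvgrPdist_le h1 := cube_mean_Re uc ub um.
have /cvgrPdist_le h2 := cube_mean_Im uc ub um.
apply/cvgrPdist_le => e; rewrite ltcE /= => /andP[/eqP ei er].
have er2 : 0 < complex.Re e / 2 by rewrite divr_gt0.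
near=> s.
have k1 : `|complex.Re m - cube_mean s (fun x => complex.Re (u x))| <= complex.Re e / 2 by near: s; exact: h1.
have k2 : `|complex.Im m - cube_mean s (fun x => complex.Im (u x))| <= complex.Re e / 2 by near: s; exact: h2.
have -> : e = (complex.Re e)%:C%C by apply: cP.
rewrite normrcE lecR; apply: le_trans (cabs_le_ReIm _) _; rewrite cReB cImB /=; lra.
Unshelve. all: by end_near.
Qed.

HB.instance Definition _ (U : choiceType) (V : puniformType) (fam : set U -> Prop) :=
  isPointed.Build {family fam, U -> V} (fun=> point).

(** * Functions on tubes *)

Section tubes.
Import finmap.
Variables (R : realType) (p : nat).
Implicit Types (f g : 'rV[R[i]]_p -> R[i]) (x y t : 'rV[R]_p) (D Om : set 'rV[R]_p).

Lemma mkzD x y x' y' : mkz (x + x') (y + y') = mkz x y + mkz x' y' :> 'rV[R[i]]_p.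
Proof. by apply/rowP => j; rewrite !mxE. Qed.

Lemma mkzDx x y t : mkz (x + t) y = mkz x y + cvec t :> 'rV[R[i]]_p.
Proof. by rewrite /cvec -mkzD addr0. Qed.

Definition rev (z : 'rV[R[i]]_p) : 'rV[R]_p := \row_j complex.Re (z 0 j).

Lemma mkz_eta z : mkz (rev z) (imv z) = z.
Proof. by apply/rowP => j; rewrite !mxE; case: (z 0 j). Qed.

Lemma imv_mkz x y : imv (mkz x y) = y.
Proof. by apply/rowP => j; rewrite !mxE. Qed.

Lemma rev_mkz x y : rev (mkz x y) = x.
Proof. by apply/rowP => j; rewrite !mxE. Qed.

Lemma tube_mkz D x y : tube D (mkz x y) = D y.
Proof. by rewrite /tube /= imv_mkz. Qed.

Lemma ball_mkz x y x' y' (e : R) : 0 < e -> `|x' - x| < e / 2 -> `|y' - y| < e / 2 ->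
  ball (mkz x y) (e%:C%C : R[i]) (mkz x' y').
Proof.
move=> e0 xe ye; split => [|i j]; first by rewrite ltcR.
rewrite ord1 -ball_normE /= normrcE ltcR !mxE.
apply: le_lt_trans (cabs_le_ReIm _) _ => /=.
have := ler_coord_norm (x' - x) j; have := ler_coord_norm (y' - y) j; rewrite !mxE.
by rewrite (distrC (x 0 j)) (distrC (y 0 j)) => h1 h2; move: xe ye h1 h2; move: `|_| `|_| `|_| `|_| => *; lra.
Qed.

Lemma nbhs_mkz (P : set 'rV[R[i]]_p) x y : nbhs (mkz x y) P -> exists2 d : R, 0 < d &
  forall x' y', `|x' - x| < d -> `|y' - y| < d -> P (mkz x' y').
Proof.
rewrite -nbhs_ballE /= => -[e /= e0 sP]; pose r := complex.Re e.
(* A positive element of [R[i]] is real, so radii in the complex normed space are real numbers. *)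
have eE : e = r%:C%C by move: e0; rewrite ltcE /= => /andP[/eqP ? _]; apply: cP.
have r0 : 0 < r by rewrite eE ltcR in e0.
by exists (r / 2) => [|x' y' hx hy]; [rewrite divr_gt0|apply: sP; rewrite eE; exact: ball_mkz].
Qed.

Lemma differentiable_cont f x y : differentiable f (mkz x y) -> forall e : R, 0 < e ->
  exists2 d : R, 0 < d & forall x' y', `|x' - x| < d -> `|y' - y| < d ->
    cabs (f (mkz x' y') - f (mkz x y)) <= e.
Proof.
move=> /differentiable_continuous/cvgrPdist_le fc e e0.
have e0' : 0 < (e%:C%C : R[i]) by rewrite ltcR.
have [d d0 H] := nbhs_mkz (fc _ e0'); exists d => // x' y' hx hy.
by have := H x' y' hx hy; rewrite /= normrcE lecR cabsC.
Qed.

(** The bridge from Frechet differentiability in several variables to [cdiff] on complex lines,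
    where Cauchy's theorem applies. *)
Lemma line_cdiff f z0 v (w : R[i]) : differentiable f (z0 + w *: v) ->
  exists al, cdiff (fun w => f (z0 + w *: v)) w al.
Proof.
move=> df; have /(@diff_derivable _ _ _ _ _ v)/cvg_ex[al alP] := df.
exists al => e e0; have e0' : 0 < (e%:C%C : R[i]) by rewrite ltcR.
have /cvgrPdist_le/(_ _ e0') := alP.
rewrite near_withinE -nbhs_ballE /= => -[r /= r0 H].
have rE : r = (complex.Re r)%:C%C by move: r0; rewrite ltcE /= => /andP[/eqP ? _]; apply: cP.
exists (complex.Re r) => [|u ur]; first by rewrite rE ltcR in r0.
have [->|u0] := eqVneq u 0; first by rewrite addr0 subrr mulr0 subrr cabs0 mulr0.
have := H u; rewrite /= -ball_normE /= sub0r normrN {1}rE normrcE ltcR => /(_ ur u0).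
rewrite normrcE lecR => h.
have -> : f (z0 + (w + u) *: v) - f (z0 + w *: v) - al * u =
   - u * (al - u^-1 *: (f (u *: v + (z0 + w *: v)) - f (z0 + w *: v))).
  have -> : z0 + (w + u) *: v = u *: v + (z0 + w *: v) by rewrite scalerDl addrA addrC.
  by rewrite -[u^-1 *: _]/(u^-1 * _); move: (f _ - f _) => X; field.
by rewrite cabsM cabsN mulrC ler_wpM2r ?cabs_ge0.
Qed.

(** This is [tbdd] uniformly in the imaginary part; it replaces compactness of the closure of the
    translates in all later estimates. *)
Definition colour D f := forall e : R, 0 < e -> exists (I : finType) (col : 'rV[R]_p -> I),
  forall t t', col t = col t' -> forall x y, D y -> cabs (f (mkz (x + t) y) - f (mkz (x + t') y)) <= e.

Lemma family_nbhs D Om (g : {family tau_fam Om, 'rV[R[i]]_p -> R[i]}) (e : R) : 0 < e -> relcpt_in D Om ->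
  nbhs g [set h : {family tau_fam Om, 'rV[R[i]]_p -> R[i]} | forall z, tube D z -> cabs (h z - g z) <= e].
Proof.
move=> e0 DOm; have : {family tau_fam Om, nbhs g --> g} by apply: cvg_id.
move=> /fam_cvgP/(_ (tube D)) H; apply: H; first by exists D.
apply/uniform_nbhs; exists [set xy | ball xy.1 (e%:C%C : R[i]) xy.2]; split.
  by rewrite -entourage_ballE; exists e%:C%C => //=; rewrite ltcR.
move=> h /= H z Dz; have := H z Dz; rewrite -ball_normE /= normrcE ltcR => /ltW.
by rewrite cabsC.
Qed.

(** The compact closure of the translates is covered by finitely many sets of radius [e / 2] for the
    uniform distance on the tube; the colour of [t] is the index of one that contains its
    translate. *)
Lemma AP_colour D Om f : AP Om f -> relcpt_in D Om -> colour D f.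
Proof.
move=> [_ fc] DOm e e0; have e20 : 0 < e / 2 by rewrite divr_gt0.
pose T : Type := {family tau_fam Om, 'rV[R[i]]_p -> R[i]}.
pose U (g : T) : set T := [set h | forall z, tube D z -> cabs (h z - g z) <= e / 2].
have Un (g : T) : nbhs g (U g) by exact: family_nbhs.
move: fc; rewrite (@compact_cover {family tau_fam Om, 'rV[R[i]]_p -> R[i]}) => /(_ _ (closure (range (translate Om f))) (fun g => (U g)°)) [].
- by move=> g _; exact: open_interior.
- by move=> g gK; exists g => //; exact: Un.
move=> I _ cov.
have rep t : exists g : I, U (val g) (translate Om f t).
  have [|g gI /interior_subset gU] := cov (translate Om f t).
    by apply: subset_closure; exists t.
  by exists (FSetSub gI).
have [col colP] := choice rep.
exists I, col => t t' tt x y Dy.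
have h1 := colP t (mkz x y); have h2 := colP t' (mkz x y).
rewrite -tt in h2; rewrite tube_mkz in h1 h2.
rewrite !mkzDx; apply: le_trans (cabs_dist _ _ (val (col t) (mkz x y))) _.
by rewrite [leRHS]splitr; apply: lerD; [exact: h1|rewrite cabsC; exact: h2].
Qed.

Lemma colour_reps D f : colour D f -> forall e : R, 0 < e -> exists (I : finType) (s : I -> 'rV[R]_p),
  forall t, exists i, forall x y, D y -> cabs (f (mkz (x + t) y) - f (mkz (x + s i) y)) <= e.
Proof.
move=> fc e /fc[I [col H]].
have C i : exists t0, forall t, col t = i -> col t = col t0.
  have [[t0 t0i]|N] := pselect (exists t0, col t0 = i); first by exists t0 => t ->; rewrite t0i.
  by exists 0 => t ti; case: N; exists t.
have [s sP] := choice C; exists I, s => t; exists (col t) => x y Dy.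
by apply: H Dy; exact: sP.
Qed.

Definition jointuc D f := forall e : R, 0 < e -> exists2 d : R, 0 < d &
  forall x y x' y', D y -> D y' -> `|x' - x| < d -> `|y' - y| < d ->
    cabs (f (mkz x' y') - f (mkz x y)) <= e.

(** Almost periodicity lets every [x] be imitated by one of finitely many [s i], so uniform
    continuity along the unbounded real directions reduces to neighbourhoods of the points
    [(s i, y)] with [y] in the compact closure of [D]. *)
Lemma AP_jointuc D Om f : AP Om f -> relcpt_in D Om -> jointuc D f.
Proof.
move=> fAP DOm e e0; have e30 : 0 < e / 3 by rewrite divr_gt0.
have [I [s sP]] := colour_reps (AP_colour fAP DOm) e30.
have [[_ df] _] := fAP; have [Dc DO] := DOm.
pose P (d : R) y := forall i y' t, `|y' - y| < d -> `|t| < d ->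
  cabs (f (mkz (s i + t) y') - f (mkz (s i) y)) <= e / 3.
have [] := @compact_uniform R _ (closure D) P Dc.
- by move=> d d' y dd Py i y' t h1 h2; apply: Py; apply: lt_le_trans dd.
- move=> y Dy; have e60 : 0 < e / 6 by rewrite divr_gt0.
  have C i : exists d : R, 0 < d /\ forall x' y', `|x' - s i| < d -> `|y' - y| < d ->
    cabs (f (mkz x' y') - f (mkz (s i) y)) <= e / 6.
    have [|d d0 H] := @differentiable_cont f (s i) y _ _ e60; last by exists d.
    by apply: df; rewrite tube_mkz; exact: DO.
  have [d dP] := choice C.
  have [d0 d00 d0P] : exists2 d0 : R, 0 < d0 & forall i, d0 <= d i.
    exists (\big[Order.min/1]_i d i) => [|i]; last exact: bigmin_le.
    by apply/bigmin_gtP; split => // i _; case: (dP i).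
  exists (d0 / 2); first by rewrite divr_gt0.
  move=> y1; rewrite -ball_normE /= distrC => y1y i y' t h1 h2.
  have k1 : cabs (f (mkz (s i + t) y') - f (mkz (s i) y)) <= e / 6.
    apply: (dP i).2; apply: lt_le_trans (d0P i).
      by rewrite addrC addKr (lt_le_trans h2) // ler_pdivrMr //; lra.
    have -> : y' - y = (y' - y1) + (y1 - y) by rewrite addrA subrK.
    by apply: le_lt_trans (ler_normD _ _) _; rewrite [ltRHS]splitr ltrD.
  have k2 : cabs (f (mkz (s i) y1) - f (mkz (s i) y)) <= e / 6.
    apply: (dP i).2; apply: lt_le_trans (d0P i); rewrite ?subrr ?normr0 //.
    by rewrite (lt_le_trans y1y) // ler_pdivrMr //; lra.
  apply: le_trans (cabs_dist _ _ (f (mkz (s i) y))) _; rewrite (cabsC (f (mkz (s i) y))).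
  by move: k1 k2; move: (cabs _) (cabs _) => *; lra.
move=> d d0 HP; exists d => // x y x' y' Dy Dy' hx hy.
have [i iP] := sP x.
have xE : x' = (x' - x) + x by rewrite subrK.
have h1 := iP (x' - x) y' Dy'; have h2 := iP 0 y Dy; rewrite subrK !add0r in h1 h2.
have h3 := HP y (subset_closure Dy) i y' (x' - x) hy hx; rewrite [s i + _]addrC in h3.
apply: le_trans (cabs_dist _ _ (f (mkz (x' - x + s i) y'))) _.
have h4 := cabs_dist (f (mkz (x' - x + s i) y')) (f (mkz x y)) (f (mkz (s i) y)).
rewrite (cabsC (f (mkz (s i) y))) in h4.
by move: h1 h2 h3 h4; move: (cabs _) (cabs _) (cabs _) (cabs _) => *; lra.
Qed.

End tubes.

(** * Lower bounds off the amoeba and means along lines *)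

Section lower.
Variables (R : realType) (p : nat).
Implicit Types (f g : 'rV[R[i]]_p -> R[i]) (x y t : 'rV[R]_p) (D Om : set 'rV[R]_p).

Lemma colour_bounded D f : colour D f -> compact (closure D) ->
  (forall x y, closure D y -> differentiable f (mkz x y)) ->
  exists M : R, forall x y, D y -> cabs (f (mkz x y)) <= M.
Proof.
move=> fc Dc df; have [I [s sP]] := colour_reps fc ltr01.
have C i : exists M : R, forall y, closure D y -> cabs (f (mkz (s i) y)) <= M.
  apply: (@compact_upper R _ (closure D) (fun y => f (mkz (s i) y)) Dc) => y Dy e e0.
  have [d d0 H] := differentiable_cont (df (s i) y Dy) e0; exists d => // y'.
  by rewrite -ball_normE /= distrC => ?; apply: H; rewrite ?subrr ?normr0.
have [M MP] := choice C; exists (1 + \sum_i `|M i|) => x y Dy.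
have [i /(_ 0 y Dy)] := sP x; rewrite !add0r => h1.
have h2 := MP i y (subset_closure Dy).
have h3 := cabs_lB (f (mkz x y)) (f (mkz (s i) y)).
have h4 : `|M i| <= \sum_i `|M i| by rewrite (bigD1 i) //= lerDl sumr_ge0.
have h5 := ler_norm (M i); lra.
Qed.

(* Harnack's inequality along complex segments joining a nearby point where [|f|]
   is not small, which exists at bounded distance by almost periodicity. *)
Lemma lower_bound f y (r M : R) : 0 < r -> colour (ball y r) f ->
  (forall x y', ball y r y' -> [/\ differentiable f (mkz x y'), f (mkz x y') != 0 & cabs (f (mkz x y')) <= M]) ->
  exists2 m : R, 0 < m & forall x y', ball y (r / 4) y' -> m <= cabs (f (mkz x y')).
Proof.
move=> r0 fc H; have ry : ball y r y by apply: ballxx.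
have r4 : r / 4 < r by lra.
have aux (A B E1 E2 E3 : R) : A - B <= E1 - E2 -> E3 <= E2 -> A - (E1 - E3) <= B by lra.
pose a := cabs (f (mkz 0 y)).
have a0 : 0 < a by rewrite cabs_gt0; have [] := H 0 y ry.
have a20 : 0 < a / 2 by rewrite divr_gt0.
have [I [s sP]] := colour_reps fc a20.
pose S : R := \sum_i `|s i| + 1.
have S0 : 0 < S by rewrite ltr_wpDl // sumr_ge0.
have sS i : `|s i| <= S.
  by rewrite /S (bigD1 i) //= -addrA lerDl addr_ge0 // sumr_ge0.
pose rho := Order.min (1 / 2) (r / (8 * S)).
have rho0 : 0 < rho by rewrite lt_min !divr_gt0 // mulr_gt0.
have rho1 : rho <= 1 / 2 by rewrite ge_min lexx.
have rhoS : rho * S <= r / 8.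
  apply: (@le_trans _ _ (r / (8 * S) * S)); first by rewrite ler_pM2r // ge_min lexx orbT.
  by rewrite le_eqVlt; apply/orP; left; apply/eqP; field; rewrite gt_eqF.
pose E := expR (4 / rho).
exists (expR (ln M - E * (ln M - ln (a / 2)))); first exact: expR_gt0.
move=> x y'; rewrite -ball_normE /= distrC => yy.
have [i iP] := sP x; have := iP (- s i) y ry; rewrite addNr => h1.
(* The segment runs from [(x - s i, y)], where [|f|] is at least [a / 2] by the choice of [i], to
   [(x, y')]. The complexified segment stays over the ball because
   [2 * (r / 4) + 2 * rho * S < r]. *)
pose z0 := mkz (x - s i) y; pose v : 'rV[R[i]]_p := mkz (s i) (y' - y).
pose phi w := f (z0 + w *: v).
have zE w : z0 + w *: v = mkz (x - s i + (complex.Re w *: s i - complex.Im w *: (y' - y)))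
    (y + (complex.Re w *: (y' - y) + complex.Im w *: s i)).
  by apply/rowP => j; rewrite !mxE; apply: cP; rewrite ?cReD ?cImD ?cReM ?cImM /=; ring.
have in_ball w : inrect (- (2 * rho)) (1 + 2 * rho) (- (2 * rho)) (2 * rho) w ->
    ball y r (y + (complex.Re w *: (y' - y) + complex.Im w *: s i)).
  move=> [/andP[w1 w2] /andP[w3 w4]]; rewrite -ball_normE /= opprD addrA subrr add0r normrN.
  apply: le_lt_trans (ler_normD _ _) _; rewrite !normrZ.
  have k1 : `|complex.Re w| <= 2 by rewrite ler_norml; apply/andP; split; lra.
  have k2 : `|complex.Im w| <= 2 * rho by rewrite ler_norml; apply/andP; split; lra.
  have k3 : `|complex.Re w| * `|y' - y| <= 2 * (r / 4) by rewrite ler_pM // ltW.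
  have k4 : `|complex.Im w| * `|s i| <= 2 * rho * S by rewrite ler_pM.
  lra.
have := @harnack_segment R phi rho M rho0 => /(_ _) hs.
have {}hs : ln M - ln (cabs (phi 1)) <= E * (ln M - ln (cabs (phi 0))).
  apply: hs => w /in_ball wr; 
  have [h2 h3 h4] := H (x - s i + (complex.Re w *: s i - complex.Im w *: (y' - y))) _ wr; split.
  - by apply: line_cdiff; rewrite zE; exact: h2.
  - by rewrite /phi zE; exact: h3.
  by rewrite /phi zE; exact: h4.
have p1 : phi 1 = f (mkz x y').
  congr f; rewrite zE /= !scale1r !scale0r subr0 addr0 subrK.
  by rewrite [y + _]addrC subrK.
have p0 : a / 2 <= cabs (phi 0).
  have -> : phi 0 = f (mkz (- s i + x) y) by congr f; rewrite zE /= !scale0r subr0 !addr0 addrC.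
  have := cabs_lB (f (mkz 0 y)) (f (mkz (- s i + x) y)); rewrite -/a cabsC.
  move=> h2; have := le_trans h2 h1; rewrite lerBlDr -lerBlDl; apply: le_trans.
  by rewrite [X in _ <= X - _]splitr addrK.
have f0 : 0 < cabs (f (mkz x y')).
  rewrite cabs_gt0; have [|//] := H x y' _.
  by rewrite -ball_normE /= distrC (lt_trans yy).
rewrite -[leRHS](lnK f0) ler_expR -p1.
have : ln (a / 2) <= ln (cabs (phi 0)) by rewrite ler_ln ?posrE // (lt_le_trans a20).
have E0 : 0 < E by apply: expR_gt0.
move=> l1; have := ler_wpM2l (ltW E0) l1; move: hs; rewrite !mulrBr.
exact: aux.
Qed.

Lemma ccontin_avgc (J : finType) (F : J -> R -> R[i]) (a b : R) : (forall j, ccontin a b (F j)) ->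
  ccontin a b (fun s => avgc (F^~ s)).
Proof.
move=> Fc x xab; apply: ccontZ; elim: (index_enum J) => [|j js IH].
  by under eq_fun do rewrite big_nil; exact: ccont_cst.
by under eq_fun do rewrite big_cons; apply: ccontD => //; exact: Fc.
Qed.

Lemma cint_avgc (J : finType) (F : J -> R -> R[i]) (a b : R) : (forall j, ccontin a b (F j)) ->
  cint a b (fun s => avgc (F^~ s)) = avgc (fun j => cint a b (F j)).
Proof.
move=> Fc; rewrite /avgc.
have H (js : seq J) : ccontin a b (fun s => \sum_(j <- js) F j s) /\
    cint a b (fun s => \sum_(j <- js) F j s) = \sum_(j <- js) cint a b (F j).
  elim: js => [|j js [IH1 IH2]].
    under eq_fun do rewrite big_nil; rewrite big_nil; split; first by move=> x _; exact: ccont_cst.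
    have -> : (fun=> 0) = (fun s : R => 0 * (0 : R[i])) by apply: funext => s; rewrite mul0r.
    by rewrite cintZ ?mul0r // => x _; exact: ccont_cst.
  under eq_fun do rewrite big_cons; rewrite big_cons; split.
    by move=> x xab; apply: ccontD; [exact: Fc|exact: IH1].
  by rewrite cintD // IH2.
by rewrite cintZ ?(H _).2 //; exact: (H _).1.
Qed.

(** The integral over a segment of length [2 * S] of a finite average of translates is at most [C],
    while its integrand is uniformly near [mu]; this is impossible for large [S] unless [mu] is
    small. *)
Lemma line_mean_zero (d : 'rV[R]_p -> R[i]) (v : 'rV[R]_p) (C : R) (mu : R[i]) : ucont d -> cmean d mu ->
  (forall x (S : R), 0 <= S -> cabs (cint (- S) S (fun s => d (x + s *: v))) <= C) -> mu = 0.
Proof.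
move=> dc dm H; apply: csmall_eq0 => e e0; have e40 : 0 < e / 4 by rewrite divr_gt0.
have [J [s [J0 HJ]]] := dm _ e40.
have C0 : 0 <= C := le_trans (cabs_ge0 _) (H 0 0 (lexx 0)).
pose S := C / e + 1.
have S0 : 0 < S by rewrite ltr_wpDl // divr_ge0 // ltW.
have SS : - S <= S by rewrite ge0_cp // ltW.
have dl j : ccontin (- S) S (fun s0 => d (s j + s0 *: v)).
  move=> s0 _ e1 /dc[d1 d10 D]; have A0 : 0 < `|v| + 1 by rewrite ltr_wpDl.
  exists (d1 / (`|v| + 1)) => [|s1]; first by rewrite divr_gt0.
  rewrite ltr_pdivlMr // => hs.
  have -> : s j + s1 *: v = s j + s0 *: v + (s1 - s0) *: v by rewrite -addrA -scalerDl [s0 + _]addrC subrK.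
  by apply: D; rewrite normrZ; apply: le_lt_trans hs; rewrite ler_wpM2l // lerDl.
have cc : ccontin (- S) S (fun _ : R => mu) by move=> x _; exact: ccont_cst.
have ac := ccontin_avgc dl.
have E : cint (- S) S (fun s0 => avgc (fun j => d (s j + s0 *: v)) - mu) =
   avgc (fun j => cint (- S) S (fun s0 => d (s j + s0 *: v))) - mu * (S - - S)%:C%C.
  by rewrite cintB // cint_cst // cint_avgc.
have h1 : cabs (cint (- S) S (fun s0 => avgc (fun j => d (s j + s0 *: v)) - mu)) <= 2 * (e / 4) * (S - - S).
  apply: cabs_cint_le => // [x xS|x _]; first by apply: ccontB; [exact: ac|exact: cc].
  by have := HJ (x *: v); under eq_fun do rewrite addrC.
have h2 : cabs (avgc (fun j => cint (- S) S (fun s0 => d (s j + s0 *: v)))) <= C.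
  by apply: cabs_avgc_le => // j; apply: H; exact: ltW.
have S20 : 0 < S - - S by rewrite opprK addr_gt0.
rewrite -(ler_pM2r S20) -[X in _ * X <= _](ger0_norm (ltW S20)) -cabsR -cabsM.
have := cabs_lB (mu * (S - - S)%:C%C) (avgc (fun j => cint (- S) S (fun s0 => d (s j + s0 *: v)))).
rewrite (cabsC (mu * _)) -E => h3.
have Se : S * e = C + e by rewrite /S mulrDl divfK ?gt_eqF // mul1r.
have -> : e * (S - - S) = 2 * (S * e) by ring.
have h4 : 2 * (e / 4) * (S - - S) = S * e by field.
rewrite h4 in h1; rewrite Se in h1 *; move: h1 h2 h3; move: (cabs _) (cabs _) (cabs _) => *; lra.
Qed.

End lower.

Section differentiability.
Variables (R : realType) (p : nat).
Implicit Types (f g : 'rV[R[i]]_p -> R[i]).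

Lemma differentiable_near (K : numFieldType) (V W : normedModType K) (f g : V -> W) z :
  (\forall u \near z, f u = g u) -> differentiable g z -> differentiable f z /\ 'd f z = 'd g z :> (V -> W).
Proof.
move=> fg dg; have fz : f z = g z := nbhs_singleton fg.
have H : f \o shift z = cst (f z) + 'd g z +o_ 0 id.
  apply/eqaddoP => e e0; have := diff_locally dg => /eqaddoP/(_ e e0) G.
  have S : \forall h \near 0, f (h + z) = g (h + z).
    have := fg; rewrite (near_shift 0 z) /= => -H; apply: filterS H => h.
    by rewrite /= subr0.
  apply: filterS2 G S => h /= h1 h2.
  by move: h1; rewrite /= !fctE /= h2 fz.
have E : 'd f z = 'd g z :> (V -> W) by apply: diff_unique => //; exact: diff_continuous.
split=> //; apply/diff_locallyP; split; first by rewrite E; exact: diff_continuous.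
by rewrite E.
Qed.

Lemma differentiable_clog1 : differentiable (@clog R) (1 : R[i]).
Proof.
apply/derivable1_diffP/cvg_ex; exists 1; apply/cvgrPdist_le => e e0.
have rE : e = (complex.Re e)%:C%C by move: e0; rewrite ltcE /= => /andP[/eqP ? _]; apply: cP.
have r0 : 0 < complex.Re e by rewrite rE ltcR in e0.
have [d d0 H] := cdiff_clog1 r0; rewrite near_withinE -nbhs_ballE /=; exists d%:C%C; first by rewrite /= ltcR.
move=> u; rewrite /= -ball_normE /= sub0r normrN normrcE ltcR => ud u0.
rewrite [X in _ <= X]rE normrcE lecR; have := H u ud; rewrite mul1r => h.
have u1 : 0 < cabs u by rewrite cabs_gt0.
rewrite -(ler_pM2r u1) -cabsM.
have -> // : cabs ((1 - u^-1 *: (clog (u *: 1 + 1) - clog 1)) * u) = cabs (clog (1 + u) - clog 1 - u).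
rewrite -[u *: 1]/(u * 1) mulr1 [u + 1]addrC cabsC; congr cabs.
by rewrite -[_ *: _]/(_ * _); move: (clog _ - clog _) => X; field.
Qed.

Lemma differentiable_cip (c : 'rV[R]_p) z : differentiable (fun z : 'rV[R[i]]_p => cip z c) z.
Proof.
have -> : (fun z : 'rV[R[i]]_p => cip z c) = \sum_(j < p) (fun z : 'rV[R[i]]_p => Complex (c 0 j) 0 *: (z 0 j : R[i])).
  by apply: funext => u; rewrite fct_sumE; apply: eq_bigr => j _; rewrite -[_ *: _]/(_ * _) mulrC.
apply: differentiable_sum => j; apply: differentiableZ; exact: differentiable_coord.
Qed.

End differentiability.

Lemma mkz_nbhs (R : realType) (p : nat) (P : set 'rV[R[i]]_p) (x y : 'rV[R]_p) (d : R) : 0 < d ->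
  (forall x' y', `|x' - x| < d -> `|y' - y| < d -> P (mkz x' y')) -> nbhs (mkz x y) P.
Proof.
move=> d0 H; rewrite -nbhs_ballE /=; exists (d / 2)%:C%C; first by rewrite /= ltcR divr_gt0.
move=> z [_ zb]; rewrite -(mkz_eta z); apply: H.
  apply: (@le_lt_trans _ _ (d / 2)); last by rewrite ltr_pdivrMr //; lra.
  apply: ler_norm_coord => [|j]; first by rewrite divr_ge0 ?ltW.
  have := zb 0 j; rewrite -ball_normE /= normrcE ltcR => /ltW; rewrite cabsC.
  by apply: le_trans; rewrite !mxE; apply: le_trans (normRe_le _); rewrite cReB.
apply: (@le_lt_trans _ _ (d / 2)); last by rewrite ltr_pdivrMr //; lra.
apply: ler_norm_coord => [|j]; first by rewrite divr_ge0 ?ltW.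
have := zb 0 j; rewrite -ball_normE /= normrcE ltcR => /ltW; rewrite cabsC.
by apply: le_trans; rewrite !mxE; apply: le_trans (normIm_le _); rewrite cImB.
Qed.

Lemma icip (R : realType) (p : nat) (c x y : 'rV[R]_p) : 'i%C * cip (mkz x y) c = Complex (- ip y c) (ip x c).
Proof.
have -> : cip (mkz x y) c = Complex (ip x c) (ip y c).
  rewrite /cip /ip; apply: cP; rewrite ?cRe_sum ?cIm_sum /=; apply: eq_bigr => j _.
    by rewrite cReM !mxE /= mulr0 subr0.
  by rewrite cImM !mxE /= mulr0 add0r.
by apply: cP; rewrite ?cReM ?cImM /=; ring.
Qed.

(** * The logarithm of [f] on the tube over a small ball *)

Section local.
Variables (R : realType) (p : nat) (f : 'rV[R[i]]_p -> R[i]) (y : 'rV[R]_p) (r m : R).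
Local Notation D := (ball y r).
Hypotheses (r0 : 0 < r) (m0 : 0 < m) (fuc : jointuc D f) (fcol : colour D f).
Hypothesis fm : forall x y', D y' -> m <= cabs (f (mkz x y')).
Hypothesis df : forall x y', D y' -> differentiable f (mkz x y').

Lemma ball_segment y' (s : R) : 0 <= s <= 1 -> D y' -> D (y + s *: (y' - y)).
Proof.
move=> /andP[s0 s1]; rewrite -!ball_normE /= opprD addrA subrr add0r normrN normrZ distrC => h.
by rewrite (ger0_norm s0); apply: le_lt_trans h; rewrite ler_piMl.
Qed.

Lemma local_lift : exists L : 'rV[R]_p -> 'rV[R]_p -> R[i],
  (forall x y', D y' -> cexp (L x y') = f (mkz x y')) /\
  exists2 d : R, 0 < d & forall x y1 x' y2, D y1 -> D y2 -> `|x' - x| < d -> `|y2 - y1| < d ->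
    L x' y2 = L x y1 + clog (f (mkz x' y2) / f (mkz x y1)).
Proof.
have ry : D y by apply: ballxx.
have fne x y' : D y' -> f (mkz x y') != 0 by move=> Dy; rewrite -cabs_gt0 (lt_le_trans m0) // fm.
have [l0 l0E] := cexp_surj (fne 0 y ry).
pose X : Type := ('rV[R]_p * 'rV[R]_p)%type.
pose g (v : X) (s : R) := f (mkz (s *: v.1) (y + s *: (v.2 - y))).
have [|v Dv|v Dv|L [LE LC]] := @lift_family R X (fun v => D v.2) g (fun=> l0).
- move=> [x y'] /= Dy e /fuc[d d0 H].
  have A0 : 0 < `|x| + `|y' - y| + 1 by rewrite ltr_wpDl // addr_ge0.
  exists (d / (`|x| + `|y' - y| + 1)); first by rewrite divr_gt0.
  move=> s s' s01 s'01; rewrite ltr_pdivlMr // => hs; rewrite /g /=.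
  apply: H; [exact: ball_segment|exact: ball_segment| |].
    rewrite -scalerBl normrZ; apply: le_lt_trans hs; rewrite ler_wpM2l //.
    by rewrite -addrA lerDl addr_ge0.
  rewrite opprD addrACA subrr add0r -scalerBl normrZ; apply: le_lt_trans hs; rewrite ler_wpM2l //.
  by rewrite addrAC lerDr addr_ge0.
- by exists m => // s s01; apply: fm; exact: ball_segment.
- by rewrite /g !scale0r addr0.
exists (fun x y' => L (x, y')); split => [x y' Dy|].
  by rewrite LE // /g /= !scale1r [y + _]addrC subrK.
have m20 : 0 < 1 / 2 * m by rewrite mulr_gt0.
have [d d0 H] := fuc m20; exists d => // x y1 x' y2 D1 D2 hx hy.
have := LC (x, y1) (x', y2) D1 D2.
rewrite /g /= !scale1r ![y + _]addrC !subrK; apply.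
  move=> s /andP[s0 s1]; have s01 : 0 <= s <= 1 by rewrite s0.
  apply: (ratio_close m0); first by apply: fm; exact: ball_segment.
  apply: H; [exact: ball_segment|exact: ball_segment| |].
    by rewrite -scalerBr normrZ ger0_norm //; apply: le_lt_trans hx; rewrite ler_piMl.
  rewrite opprD addrACA subrr add0r -scalerBr normrZ ger0_norm //.
  by rewrite opprD opprK addrACA [- y + y]addrC subrr addr0; apply: le_lt_trans hy; rewrite ler_piMl.
by rewrite !scale0r add0r divff ?clog1 ?addr0 ?fne.
Qed.

Lemma local_lift_uc (L : 'rV[R]_p -> 'rV[R]_p -> R[i]) (d : R) : 0 < d ->
  (forall x y1 x' y2, D y1 -> D y2 -> `|x' - x| < d -> `|y2 - y1| < d ->
    L x' y2 = L x y1 + clog (f (mkz x' y2) / f (mkz x y1))) ->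
  forall e : R, 0 < e -> exists2 d : R, 0 < d & forall x y1 x' y2, D y1 -> D y2 ->
    `|x' - x| < d -> `|y2 - y1| < d -> cabs (L x' y2 - L x y1) <= e.
Proof.
move=> d0 LC e e0; pose e1 := Order.min (1 / 2) (e / 4).
have e10 : 0 < e1 by rewrite lt_min !divr_gt0.
have e12 : e1 <= 1 / 2 by rewrite ge_min lexx.
have e14 : e1 <= e / 4 by rewrite ge_min lexx orbT.
have [d' d'0 H] := fuc (mulr_gt0 e10 m0).
exists (Order.min d d'); first by rewrite lt_min d0.
move=> x y1 x' y2 D1 D2; rewrite !lt_min => /andP[x1 x2] /andP[y3 y4].
rewrite (LC x y1 x' y2) // addrAC subrr add0r.
have q : cabs (f (mkz x' y2) / f (mkz x y1) - 1) <= e1.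
  by apply: (ratio_close m0); [exact: fm|exact: H].
apply: le_trans (cabs_clog _) _; [exact: le_trans q e12|lra].
Qed.

Lemma local_log : exists (c : 'rV[R]_p) (w : R[i]) (G : 'rV[R[i]]_p -> R[i]) (M : R),
  [/\ w != 0, forall x y', D y' -> f (mkz x y') = w * cexp (G (mkz x y') + 'i%C * cip (mkz x y') c),
    forall x y', D y' -> cabs (G (mkz x y')) <= M,
    forall x y', D y' -> differentiable G (mkz x y') &
    forall y', D y' -> ucont (fun x => G (mkz x y')) /\ cmean (fun x => G (mkz x y')) 0].
Proof.
have ry : D y by apply: ballxx.
have fne x y' : D y' -> f (mkz x y') != 0 by move=> Dy; rewrite -cabs_gt0 (lt_le_trans m0) // fm.
have [L [LE [d d0 LC]]] := local_lift.
have Luc := local_lift_uc d0 LC.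
have huc y' : D y' -> ucont (fun x => f (mkz x y')).
  move=> Dy e /fuc[d1 d10 H]; exists d1 => // x t td; apply: H => //; rewrite ?subrr ?normr0 //.
  by rewrite addrAC subrr add0r.
have hL y' : D y' -> ucont (fun x => L x y').
  move=> Dy e /Luc[d1 d10 H]; exists d1 => // x t td; apply: H => //; rewrite ?subrr ?normr0 //.
  by rewrite addrAC subrr add0r.
have htb : tbdd (fun x => f (mkz x y)).
  by move=> e /fcol[I [col H]]; exists I, col => t t' tt x; exact: H.
have [c [B cB]] := mean_motion htb m0 (fun x => fm x ry) (hL y ry) (fun x => LE x y ry).
pose G1 z := L (rev z) (imv z) - 'i%C * cip z c.
have G1E x y' : G1 (mkz x y') = L x y' - Complex (- ip y' c) (ip x c).
  by rewrite /G1 rev_mkz imv_mkz icip.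
have [d1 d10 HL] := Luc 1 ltr01.
have [N1 N1d] := archi_inv (divr_gt0 d10 r0).
(* The three terms are [N1.+1] steps of size at most 1 from the central slice, the bound [B] there,
   and the size of [ip y' c] over the ball. *)
pose M := N1.+1%:R + B + (`|y| + r) * \sum_j `|c 0 j|.
have Dn y' : D y' -> `|y'| <= `|y| + r.
  rewrite -ball_normE /= distrC => h; rewrite -(subrK y y') addrC; apply: le_trans (ler_normD _ _) _.
  by rewrite lerD2l ltW.
have LL x y' : D y' -> cabs (L x y' - L x y) <= N1.+1%:R.
  move=> Dy; pose yk k := y + (k%:R / N1.+1%:R) *: (y' - y).
  have N0 : 0 < N1.+1%:R :> R by rewrite ltr0n.
  have ykD k : (k <= N1.+1)%N -> D (yk k).
    by move=> kN; apply: ball_segment => //; rewrite divr_ge0 //= ler_pdivrMr // mul1r ler_nat.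
  have H k : (k <= N1.+1)%N -> cabs (L x (yk k) - L x y) <= k%:R.
    elim: k => [|k IH kN]; first by rewrite /yk mul0r scale0r addr0 subrr cabs0.
    apply: le_trans (cabs_dist _ _ (L x (yk k))) _.
    rewrite -[k.+1%:R]natr1 [k%:R + 1]addrC; apply: lerD; last by apply: IH; exact: ltnW.
    apply: HL; [by apply: ykD; exact: ltnW|exact: ykD|by rewrite subrr normr0|].
    rewrite /yk opprD addrACA subrr add0r -scalerBl -mulrBl -natr1 addrAC subrr add0r mul1r.
    rewrite normrZ normfV ger0_norm //; move: Dy; rewrite -ball_normE /= distrC => Dy.
    rewrite ltr_pdivlMr // in N1d; apply: le_lt_trans N1d.
    by rewrite ler_wpM2l ?invr_ge0 // ltW.
  by have := H N1.+1 (leqnn _); rewrite /yk divff ?gt_eqF // scale1r [y + _]addrC subrK.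
have G1M x y' : D y' -> cabs (G1 (mkz x y')) <= M.
  move=> Dy; have -> : G1 (mkz x y') = (L x y' - L x y) + (L x y - Complex 0 (ip x c)) + (ip y' c)%:C%C.
    rewrite G1E; have -> : Complex (- ip y' c) (ip x c) = Complex 0 (ip x c) - (ip y' c)%:C%C.
      by apply: cP; rewrite /= ?add0r ?oppr0 ?addr0.
    by ring.
  apply: le_trans (cabsD _ _) _; rewrite /M; apply: lerD; last first.
    by rewrite cabsR; apply: le_trans (ip_norm _ _) _; rewrite ler_wpM2r ?sumr_ge0 ?Dn.
  by apply: le_trans (cabsD _ _) _; apply: lerD; [exact: LL|exact: cB].
have G1f x y' : D y' -> f (mkz x y') = cexp (G1 (mkz x y') + 'i%C * cip (mkz x y') c).
  by move=> Dy; rewrite /G1 subrK rev_mkz imv_mkz LE.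
have G1d x y' : D y' -> differentiable G1 (mkz x y').
  move=> Dy.
  (* [L] comes from lifting along paths and carries no holomorphy by itself; near the given point it
     is a constant plus [clog] of the ratio of values of [f], which is differentiable. *)
  pose H z := (L x y' - 'i%C * cip z c) + clog ((f (mkz x y'))^-1 * f z).
  have HG : \forall z \near mkz x y', G1 z = H z.
    apply: (@mkz_nbhs _ _ _ _ _ (Order.min d (r - `|y' - y|))) => [|x1 y1 hx].
      by move: Dy; rewrite -ball_normE /= distrC lt_min d0 subr_gt0.
    rewrite lt_min => /andP[hy1 hy2]; rewrite lt_min in hx; have /andP[hx1 _] := hx.
    have D1 : D y1.
      rewrite -ball_normE /= distrC; have -> : y1 - y = (y1 - y') + (y' - y) by rewrite addrA subrK.
      by apply: le_lt_trans (ler_normD _ _) _; rewrite -ltrBrDr.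
    by rewrite /G1 /H rev_mkz imv_mkz (LC x y' x1 y1) // addrAC [(f _)^-1 * _]mulrC.
  apply: (differentiable_near HG _).1.
  apply: differentiableD; last first.
    apply: (@differentiable_comp _ _ _ _ (fun z => (f (mkz x y'))^-1 * f z)).
      by apply: differentiableZ; exact: df.
    by rewrite mulVf ?fne //; exact: differentiable_clog1.
  apply: differentiableB; first exact: differentiable_cst.
  by apply: differentiableZ; exact: differentiable_cip.
clearbody G1.
have sl y' : D y' -> [/\ ucont (fun x => G1 (mkz x y')), tbdd (fun x => G1 (mkz x y')) &
    cmean (fun x => G1 (mkz x y')) (Mean 0 (fun x => G1 (mkz x y')))].
  move=> Dy.
  have guc : ucont (fun x => G1 (mkz x y')).
    move=> e e0; have e20 : 0 < e / 2 by rewrite divr_gt0.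
    have C0 : 0 < \sum_j `|c 0 j| + 1 by rewrite ltr_wpDl // sumr_ge0.
    have [d2 d20 H2] := hL y' Dy _ e20; exists (Order.min d2 (e / 2 / (\sum_j `|c 0 j| + 1))).
      by rewrite lt_min d20 divr_gt0.
    move=> x t; rewrite lt_min => /andP[t1 t2]; rewrite !G1E.
    have -> : L (x + t) y' - Complex (- ip y' c) (ip (x + t) c) - (L x y' - Complex (- ip y' c) (ip x c)) =
       (L (x + t) y' - L x y') - Complex 0 (ip t c).
      have -> : Complex (- ip y' c) (ip (x + t) c) = Complex (- ip y' c) (ip x c) + Complex 0 (ip t c).
        by apply: cP; rewrite /= ?addr0 ?ipDl.
      by ring.
    apply: le_trans (cabsB _ _) _; rewrite [leRHS]splitr; apply: lerD; first exact: H2.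
    apply: le_trans (cabs_le_ReIm _) _; rewrite /= normr0 add0r; apply: le_trans (ip_norm _ _) _.
    rewrite ltr_pdivlMr // in t2; apply: le_trans (ltW t2).
    by rewrite ler_wpM2l // lerDl.
  have gtb : tbdd (fun x => G1 (mkz x y')).
    move=> e e0; pose de := Order.min (1 / 2) (e / 8).
    have de0 : 0 < de by rewrite lt_min !divr_gt0.
    have de2 : de <= 1 / 2 by rewrite ge_min lexx.
    have de8 : de <= e / 8 by rewrite ge_min lexx orbT.
    have [I [col H]] := fcol (mulr_gt0 de0 m0); exists I, col => t t' tt x.
    pose g x := G1 (mkz x y') + (- ip y' c)%:C%C.
    have hE x1 : f (mkz x1 y') = cexp (g x1 + Complex 0 (ip x1 c)).
      have -> : g x1 + Complex 0 (ip x1 c) = G1 (mkz x1 y') + Complex (- ip y' c) (ip x1 c).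
        by rewrite /g -addrA; congr (_ + _); apply: cP; rewrite /= ?addr0 ?add0r.
      by rewrite -icip; exact: G1f.
    have gB a b : g a - g b = G1 (mkz a y') - G1 (mkz b y') by rewrite /g; ring.
    have gc : ucont g by move=> e1 /guc[d2 d20 H2]; exists d2 => // x1 t1 t1d; rewrite gB H2.
    have gb : bounded g.
      exists (M + cabs (- ip y' c)%:C%C) => x1; apply: le_trans (cabsD _ _) _.
      by rewrite lerD2r G1M.
    have [|s1 _] := @slice_log _ _ (fun x => f (mkz x y')) g c t t' de gc gb hE de2.
      move=> x1; apply: le_trans (H t t' tt x1 y' Dy) _.
      by rewrite ler_pM2l // fm.
    have := s1 x; rewrite gB => /le_trans; apply; lra.
  by split => //; exact: cmean_exists.
(* Along complex lines in the direction [y' - y] the function is holomorphic and bounded on a strip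
   of height 1, so by [strip_bound] the integrals of the difference of two slices over real segments
   stay bounded, and [line_mean_zero] applies. *)
have mE y' : D y' -> Mean 0 (fun x => G1 (mkz x y')) = Mean 0 (fun x => G1 (mkz x y)).
  move=> Dy; have [u1 _ c1] := sl y ry; have [u2 _ c2] := sl y' Dy.
  apply/eqP; rewrite eq_sym -subr_eq0; apply/eqP.
  pose dd x := G1 (mkz x y) - G1 (mkz x y').
  have duc : ucont dd.
    move=> e e0; have e20 : 0 < e / 2 by rewrite divr_gt0.
    have [da da0 Ha] := u1 _ e20; have [db db0 Hb] := u2 _ e20.
    exists (Order.min da db) => [|x t]; first by rewrite lt_min da0.
    rewrite lt_min => /andP[ta tb].
    have -> : dd (x + t) - dd x = (G1 (mkz (x + t) y) - G1 (mkz x y)) - (G1 (mkz (x + t) y') - G1 (mkz x y')).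
      by rewrite /dd; ring.
    by apply: le_trans (cabsB _ _) _; rewrite [leRHS]splitr; apply: lerD; [exact: Ha|exact: Hb].
  apply: (@line_mean_zero _ _ dd (y' - y) (4 * M * 1) _ duc (cmeanB c1 c2)) => x S S0.
  pose v := y' - y.
  pose ph (w : R[i]) := G1 (mkz x y + w *: cvec v).
  have lE (s t : R) : mkz x y + Complex s t *: cvec v = mkz (x + s *: v) (y + t *: v).
    by apply/rowP => j; rewrite !mxE; apply: cP; rewrite /= ?mulr0 ?subr0 ?add0r ?mul0r.
  have -> : (fun s => dd (x + s *: v)) = (fun s => ph (Complex s 0) - ph (Complex s 1)).
    by apply: funext => s; rewrite /ph !lE scale0r scale1r addr0 [y + v]addrC subrK.
  apply: strip_bound => // s t t01.
    by apply: line_cdiff; rewrite lE; apply: G1d; exact: ball_segment.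
  by rewrite /ph lE; apply: G1M; exact: ball_segment.
set mu := Mean 0 (fun x => G1 (mkz x y)) in mE.
(* Subtracting [mu] normalises all slices at once, since they have the same mean; the factor
   [cexp mu] is then independent of the slice. *)
exists c, (cexp mu), (fun z => G1 z - mu), (M + cabs mu); split.
- exact: cexp_neq0.
- by move=> x y' Dy; rewrite G1f // -cexpD; congr cexp; ring.
- by move=> x y' Dy; apply: le_trans (cabsB _ _) _; rewrite lerD2r G1M.
- by move=> x y' Dy; apply: differentiableB; [exact: G1d|exact: differentiable_cst].
move=> y' Dy; have [u1 _ c1] := sl y' Dy; split.
  move=> e /u1[d2 d20 H]; exists d2 => // x t td; have -> : forall a b : R[i], a - mu - (b - mu) = a - b by move=> *; ring.
  exact: H.
by have := cmeanB c1 (cmean_cst _ mu); rewrite mE // subrr.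
Qed.

End local.

(** * From colourings back to almost periodicity *)

Section converse.
Variables (R : realType) (p : nat).
Implicit Types (f g : 'rV[R[i]]_p -> R[i]) (x y t : 'rV[R]_p) (D Om : set 'rV[R]_p).

Lemma relcpt_ball y D : nbhs y D -> exists2 r : R, 0 < r & relcpt_in (ball y r) D.
Proof.
rewrite -nbhs_ballE => -[r /= r0 rD].
have cl : closure (ball y (r / 2)) `<=` ball y r.
  move=> z /(_ (ball z (r / 2))) []; first by apply: nbhsx_ballx; rewrite divr_gt0.
  move=> w [wy wz]; rewrite (splitr r); apply: ball_triangle wy _; exact: ball_sym.
exists (r / 2); first by rewrite divr_gt0.
split; last exact: subset_trans cl rD.
apply: bounded_closed_compact; last exact: closed_closure.
exists (`|y| + r); split => [|M yM z /cl]; first exact: num_real.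
rewrite -ball_normE /= distrC => zy; apply: le_trans (ltW yM).
by rewrite -(subrK y z) addrC; apply: le_trans (ler_normD _ _) _; rewrite lerD2l ltW.
Qed.

Lemma open_tube D : open D -> open (tube D).
Proof.
rewrite !openE => Do z Dz; have := Do _ Dz; rewrite /interior -nbhs_ballE => -[r /= r0 rD].
rewrite /= -(mkz_eta z); apply: (mkz_nbhs r0) => x' y' _ hy.
by rewrite tube_mkz; apply: rD; rewrite -ball_normE /= distrC.
Qed.

(** Compactness by ultrafilters: the colouring puts sets of arbitrarily small uniform diameter into
    every ultrafilter on the closure of the translates, and pointwise ultralimits provide the limit
    function. *)
Lemma AP_of_colour D g : open D -> (forall x y, D y -> differentiable g (mkz x y)) ->
  colour D g -> AP D g.
Proof.
move=> Do dg gcol; split.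
  split; first exact: open_tube.
  by move=> z Dz; rewrite -(mkz_eta z); exact: dg.
pose T : Type := {family tau_fam D, 'rV[R[i]]_p -> R[i]}.
have clnear (A : set T) (h : T) z (e : R) : 0 < e -> closure A h -> tube D z ->
    exists2 h', A h' & cabs (h' z - h z) <= e.
  move=> e0 hA Dz; have [r r0 rD] := relcpt_ball (open_nbhs_nbhs (conj Do Dz)).
  have [h' [Ah' hh']] := hA _ (family_nbhs h e0 rD).
  by exists h' => //; apply: hh'; exact: ballxx.
rewrite compact_ultra => F FU FK; pose K := range (translate D g).
have diam (e : R) : 0 < e -> exists A : set T, F A /\ forall h h' z, A h -> A h' -> tube D z -> cabs (h z - h' z) <= e.
  move=> e0; have [I [col H]] := gcol e e0.
  pose Ki i := [set h : T | exists t, col t = i /\ h = translate D g t].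
  (* The closures of the finitely many colour classes cover the closure of the translates, so the
     ultrafilter selects one of them. *)
  have [i Fi] : exists i, F (closure (Ki i)).
    apply: contrapT => N; have Fn : F [set h | forall i, ~ closure (Ki i) h].
      apply: filter_forall => i; have [Fi|//] := in_ultra_setVsetC (closure (Ki i)) FU.
      by case: N; exists i.
    have [h [hK hN]] := filter_ex (filterI FK Fn).
    have C i : exists B : set T, nbhs h B /\ ~ (Ki i `&` B !=set0).
      apply: contrapT => NB; apply: (hN i) => B hB; apply: contrapT => NB'.
      by apply: NB; exists B.
    have [B BP] := choice C.
    have nB : \forall h' \near h, forall i, B i h'.
      exact: (@filter_forall T I B (nbhs h) (nbhs_filter h) (fun i => (BP i).1)).
    have [_ [[t _ <-] tB]] := hK _ nB.
    have [_ []] := BP (col t); exists (translate D g t); split; last exact: tB.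
    by exists t.
  exists (closure (Ki i)); split => // h h' z hi h'i Dz.
  apply/ler_addgt0Pr => e1 e10; have e20 : 0 < e1 / 2 by rewrite divr_gt0.
  have [_ [t [ti ->]] h1] := clnear _ _ z _ e20 hi Dz.
  have [_ [t' [t'i ->]] h2] := clnear _ _ z _ e20 h'i Dz.
  have h3 : cabs (translate D g t z - translate D g t' z) <= e.
    have := H t t' (etrans ti (esym t'i)) (rev z) (imv z) Dz.
    by rewrite !mkzDx mkz_eta.
  have := cabs_dist (h z) (h' z) (translate D g t z).
  have := cabs_dist (translate D g t z) (h' z) (translate D g t' z).
  rewrite (cabsC (h z) (translate _ _ _ _)).
  by move: h1 h2 h3; move: (cabs _) (cabs _) (cabs _) (cabs _) (cabs _); clear=> *; lra.
have lim z : exists w, tube D z -> forall e : R, 0 < e -> F [set h : T | cabs (h z - w) <= e].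
  have [Dz|//] := pselect (tube D z); last by exists 0.
  have [A [FA HA]] := diam 1 ltr01; have [h0 Ah0] := filter_ex FA.
  have [|w wP] := @ultra_climit _ _ F (fun h => h z) (1 + cabs (h0 z)) FU.
    apply: filterS FA => h Ah /=; have := HA h h0 z Ah Ah0 Dz; have := cabs_lB (h z) (h0 z); lra.
  by exists w.
have [q qP] := choice lim.
(* [q] is built pointwise; the members of [F] of small uniform diameter upgrade this to uniform
   convergence. *)
have Fq : F --> (q : T).
  have : {family tau_fam D, F --> q}; last by [].
  apply/fam_cvgP => A [D1 [[D1c D1D] ->]] Q /uniform_nbhs[E [entE EQ]].
  move: entE; rewrite -entourage_ballE => -[e /= e0 eE].
  have rE : e = (complex.Re e)%:C%C by move: e0; rewrite ltcE /= => /andP[/eqP ? _]; apply: cP.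
  have r0 : 0 < complex.Re e by rewrite rE ltcR in e0.
  have r20 : 0 < complex.Re e / 4 by rewrite divr_gt0.
  have [A1 [FA1 HA1]] := diam _ r20.
  apply: (filterS _ FA1) => h Ah; apply: EQ => z Dz /=; apply: eE.
  have Dz' : tube D z by apply: D1D; exact: subset_closure.
  have [h' [Ah' hq]] := filter_ex (filterI FA1 (qP z Dz' _ r20)).
  rewrite /= -ball_normE /= {1}rE normrcE ltcR cabsC.
  have := HA1 h h' z Ah Ah' Dz'; have := cabs_dist (h z) (q z) (h' z); move: hq => /=.
  by move: (cabs _) (cabs _) (cabs _) r0; clear=> *; lra.
exists q; split=> //; apply: closed_closure => B /Fq FB.
by have [h [hK hB]] := filter_ex (filterI FK FB); exists h.
Qed.

End converse.

(** * Normalised decompositions on a slice and their uniqueness *)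

Section slices.
Variables (R : realType) (p : nat).
Implicit Types (c x y t : 'rV[R]_p) (ga h u : 'rV[R]_p -> R[i]).

Lemma cmeanZ (a : R[i]) u m : cmean u m -> cmean (fun x => a * u x) (a * m).
Proof.
move=> um e e0; have A0 : 0 < cabs a + 1 by rewrite ltr_wpDl ?cabs_ge0.
have [J [s [J0 H]]] := um _ (divr_gt0 e0 A0); exists J, s; split => // x.
rewrite avgcZ -mulrBr cabsM.
have -> : e = (cabs a + 1) * (e / (cabs a + 1)) by rewrite mulrC divfK // gt_eqF.
by rewrite ler_pM ?cabs_ge0 // lerDl.
Qed.

Lemma ucontZ (a : R[i]) u : ucont u -> ucont (fun x => a * u x).
Proof.
move=> uc e e0; have A0 : 0 < cabs a + 1 by rewrite ltr_wpDl ?cabs_ge0.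
have [d d0 H] := uc _ (divr_gt0 e0 A0); exists d => // x t /H h.
rewrite -mulrBr cabsM; have -> : e = (cabs a + 1) * (e / (cabs a + 1)) by rewrite mulrC divfK // gt_eqF.
by rewrite ler_pM ?cabs_ge0 // lerDl.
Qed.

Lemma ucont_addc (a : R[i]) u : ucont u -> ucont (fun x => u x + a).
Proof.
move=> uc e /uc[d d0 H]; exists d => // x t td.
have -> : u (x + t) + a - (u x + a) = u (x + t) - u x by ring.
exact: H.
Qed.

Lemma bounded_addc (a : R[i]) u : bounded u -> bounded (fun x => u x + a).
Proof.
by move=> [B uB]; exists (B + cabs a) => x; apply: le_trans (cabsD _ _) _; rewrite lerD2r.
Qed.

Lemma cmean_addc (a : R[i]) u m : cmean u m -> cmean (fun x => u x + a) (m + a).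
Proof.
move=> /cmeanB/(_ (cmean_cst p (- a))); by rewrite opprK.
Qed.

Variable f : 'rV[R[i]]_p -> R[i].

(** The exponent contains [mkz x y] and not [x] alone, so that [c] and [w] can be constant in [y];
    the vanishing mean of [ga] fixes how the constant is shared between [w] and [ga]. *)
Definition slice y c (w : R[i]) ga :=
  [/\ w != 0, ucont ga, bounded ga, cmean ga 0 &
    forall x, f (mkz x y) = w * cexp (ga x + 'i%C * cip (mkz x y) c)].

(** Two decompositions differ by a continuous logarithm of 1, which is constant. Boundedness then
    forces equal vectors, vanishing means force equal remainders, and the constant factors agree in
    turn. *)
Lemma slice_unique y c w ga c' w' ga' : slice y c w ga -> slice y c' w' ga' ->
  [/\ c = c', w = w' & ga = ga'].
Proof.
move=> [w0 u1 [B1 b1] m1 E1] [w'0 u2 [B2 b2] m2 E2].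
have [l lE] := cexp_surj w0; have [l' l'E] := cexp_surj w'0.
pose d x := ga x - ga' x + Complex 0 (ip x (c - c')).
pose k : R[i] := l - l' - (ip y (c - c'))%:C%C.
have d1 x : cexp (d x + k) = 1.
  have := E1 x; rewrite E2 -lE -l'E -!cexpD => E.
  have -> : d x + k = (l + (ga x + 'i%C * cip (mkz x y) c)) - (l' + (ga' x + 'i%C * cip (mkz x y) c')).
    have i1 : Complex 0 (ip x (c - c')) - (ip y (c - c'))%:C%C = 'i%C * cip (mkz x y) c - 'i%C * cip (mkz x y) c'.
      by rewrite !icip !ipBr; apply: cP => /=; ring.
    rewrite /d /k; have -> : forall a b l1 l2 e1 e2 : R[i], a - b + e1 + (l1 - l2 - e2) = l1 - l2 + (a - b) + (e1 - e2).
      by move=> *; ring.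
    by rewrite i1; ring.
  by rewrite cexpB -E divff // cexp_neq0.
have e40 : 0 < 1 / 4 :> R by rewrite divr_gt0.
have [d2 d20 H2] := u1 _ e40; have [d3 d30 H3] := u2 _ e40.
have C0 : 0 < \sum_j `|(c - c') 0 j| + 1 by rewrite ltr_wpDl // sumr_ge0.
have dk x : d x = d 0.
  pose de := Order.min (Order.min d2 d3) (1 / 4 / (\sum_j `|(c - c') 0 j| + 1)).
  have de0 : 0 < de by rewrite !lt_min d20 d30 divr_gt0.
  have := @const_of_cexp1 _ _ (fun x => d x + k) de de0 d1 => /(_ _ x) H.
  apply: (@addIr _ k); apply: H => x1 t; rewrite !lt_min => /andP[/andP[t2 t3] t4].
  have -> : d (x1 + t) + k - (d x1 + k) = (ga (x1 + t) - ga x1) - (ga' (x1 + t) - ga' x1) + Complex 0 (ip t (c - c')).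
    rewrite /d; have -> : Complex 0 (ip (x1 + t) (c - c')) = Complex 0 (ip x1 (c - c')) + Complex 0 (ip t (c - c')) :> R[i].
      by apply: cP; rewrite /= ?addr0 ?ipDl.
    by ring.
  have k1 := le_trans (normIm_le _) (H2 x1 t t2); have k2 := le_trans (normIm_le _) (H3 x1 t t3).
  have k3 : `|ip t (c - c')| <= 1 / 4.
    apply: le_trans (ip_norm _ _) _; rewrite ltr_pdivlMr // in t4; apply: le_trans (ltW t4).
    by rewrite ler_wpM2l // lerDl.
  rewrite cImD cImB /=; apply: le_lt_trans (ler_normD _ _) _; have := ler_normB (complex.Im (ga (x1 + t) - ga x1)) (complex.Im (ga' (x1 + t) - ga' x1)).
  have := pi_ge2 R; rewrite [pi *+ 2]mulr2n; move: k1 k2 k3.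
  by move: `|_| `|_| `|_| `|_| pi; clear=> *; lra.
(* As [d] is constant while [ga] and [ga'] are bounded, [ip x (c - c')] is bounded in [x]; large
   multiples of the basis vectors then make each coordinate of [c - c'] zero. *)
have cc : c = c'.
  apply/rowP => j; apply/eqP; rewrite -subr_eq0; apply/eqP/small_eq0 => e e0.
  have [N hN] := filter_ex (near_inv (2 * (B1 + B2)) e0).
  apply: le_trans hN; rewrite ler_pdivlMr ?ltr0n //.
  pose t : 'rV[R]_p := N.+1%:R *: delta_mx 0 j.
  have tE : ip t (c - c') = (c 0 j - c' 0 j) * N.+1%:R.
    rewrite /ip (bigD1 j) //= big1 ?addr0 => [|i ij]; rewrite !mxE ?eqxx ?(negbTE ij) /= ?mulr0 ?mul0r //.
    by rewrite mulr1 mulrC.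
  have := dk t; rewrite /d ip0l => E.
  have E' : Complex 0 (ip t (c - c')) = (ga 0 - ga' 0) - (ga t - ga' t) :> R[i].
    have -> : ga 0 - ga' 0 = ga 0 - ga' 0 + Complex 0 0 by rewrite (_ : Complex 0 0 = 0) ?addr0.
    by rewrite -E; ring.
  rewrite -[X in _ * X]ger0_norm // -normrM -tE.
  have -> : `|ip t (c - c')| = cabs (Complex 0 (ip t (c - c'))).
    by rewrite /cabs /= expr0n /= add0r sqrtr_sqr.
  rewrite E'; apply: le_trans (cabsB _ _) _.
  have := cabsB (ga 0) (ga' 0); have := cabsB (ga t) (ga' t).
  have := b1 0; have := b1 t; have := b2 0; have := b2 t.
  by move: (cabs _) (cabs _) (cabs _) (cabs _) (cabs _) (cabs _); clear=> *; lra.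
subst c'.
have dE x : ga x - ga' x = d 0.
  by rewrite -(dk x) /d subrr /ip big1 => [|j _]; rewrite ?mxE ?mulr0 // (_ : Complex 0 0 = 0 :> R[i]) ?addr0.
have d00 : d 0 = 0.
  have := cmeanB m1 m2; rewrite subrr; under eq_fun do rewrite dE.
  by move/cmean_unique => /(_ _ (cmean_cst p (d 0))).
have gg : ga = ga' by apply: funext => x; apply/eqP; rewrite -subr_eq0 dE d00.
split=> //; subst ga'; have := E1 0; rewrite E2 => /mulIf -> //.
exact: cexp_neq0.
Qed.

End slices.

(** * Gluing over a component of the complement of the amoeba *)

Section component.
Variables (R : realType) (p : nat).
Implicit Types (c x y t : 'rV[R]_p) (D Om A : set 'rV[R]_p) (f : 'rV[R[i]]_p -> R[i]).

(** A ball is joined to its centre by segments, so a component of an open set contains a ball around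
    each of its points. *)
Lemma component_open A y : open A -> open (connected_component A y).
Proof.
move=> Ao; rewrite openE => z zC; have Az := connected_component_sub zC.
have : nbhs z A by apply: open_nbhs_nbhs.
rewrite -nbhs_ballE => -[r /= r0 rA].
rewrite /interior -nbhs_ballE; exists r => // u uz.
apply: (connected_component_trans zC).
have sc : connected ((fun s : R => z + s *: (u - z)) @` `[0, 1]).
  apply: connected_continuous_connected; first exact: segment_connected.
  apply: continuous_subspaceT => s; apply: cvgD; first exact: cvg_cst.
  exact: scalel_continuous.
apply: (connected_component_max _ _ sc).
- by exists 0; rewrite /= ?in_itv /= ?lexx ?ler01 // scale0r addr0.
- by move=> v [s /= + <-]; rewrite in_itv /= => s01; apply: rA; exact: ball_segment.
by exists 1; rewrite /= ?in_itv /= ?lexx ?ler01 // scale1r addrC subrK.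
Qed.

Lemma amoeba_open Om f : open Om -> open (Om `\` amoeba Om f).
Proof.
move=> Oo; have -> : Om `\` amoeba Om f = Om `&` ~` closure [set y | Om y /\ exists x, f (mkz x y) = 0].
  by apply/seteqP; split=> y [Oy N]; split=> // H; apply: N; [split|case: H].
by apply: openI => //; rewrite openC; exact: closed_closure.
Qed.

Lemma amoeba_nonzero Om f x y : (Om `\` amoeba Om f) y -> f (mkz x y) != 0.
Proof.
move=> [Oy N]; apply/eqP => fxy; apply: N; split => //.
by apply: subset_closure; split => //; exists x.
Qed.

Lemma colour_sub D D' f : D' `<=` D -> colour D f -> colour D' f.
Proof. by move=> DD fc e /fc[I [col H]]; exists I, col => t t' tt x y /DD; exact: H. Qed.

Lemma jointuc_sub D D' f : D' `<=` D -> jointuc D f -> jointuc D' f.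
Proof.
move=> DD fc e /fc[d d0 H]; exists d => // x y x' y' D1 D2; apply: H; exact: DD.
Qed.

(* Near every point of the complement of the amoeba the slice decompositions
   come from one holomorphic function, with locally constant [c] and [w]. *)
Lemma local_slices Om f y : AP Om f -> nbhs y (Om `\` amoeba Om f) ->
  exists (r : R) c (w : R[i]) (G : 'rV[R[i]]_p -> R[i]), 0 < r /\
    forall y', ball y r y' -> slice f y' c w (fun x => G (mkz x y')) /\
      forall x, [/\ differentiable G (mkz x y'), cabs (G (mkz x y')) <= r^-1 & r <= cabs (f (mkz x y'))].
Proof.
move=> fAP yU; have [r1 r10 rc1] := relcpt_ball yU.
have rc : relcpt_in (ball y r1) Om.
  by case: rc1 => c1 c2; split => // z /c2[].
have fcol := AP_colour fAP rc; have fuc := AP_jointuc fAP rc.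
have [[_ df] _] := fAP; have [clc clO] := rc.
have dfc x y' : closure (ball y r1) y' -> differentiable f (mkz x y').
  by move=> Cy; apply: df; rewrite tube_mkz; exact: clO.
have [M MP] := colour_bounded fcol clc dfc.
have H x y' : ball y r1 y' -> [/\ differentiable f (mkz x y'), f (mkz x y') != 0 & cabs (f (mkz x y')) <= M].
  move=> By; have Cy := subset_closure By; split; [exact: dfc| |exact: MP].
  by apply: (@amoeba_nonzero Om); apply: rc1.2.
have [m m0 mP] := lower_bound r10 fcol H.
have r20 : 0 < r1 / 4 by rewrite divr_gt0.
have bs : ball y (r1 / 4) `<=` ball y r1.
  by apply: le_ball; lra.
have [c [w [G [M2 [w0 Gf GM Gd Gs]]]]] := local_log r20 m0 (jointuc_sub bs fuc) (colour_sub bs fcol) mP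
   (fun x y' By => let: And3 d _ _ := H x y' (bs y' By) in d).
(* One number serves as radius, as lower bound for [|f|] and as reciprocal of the bound for [G]: a
   single parameter that may be decreased, ready for [compact_uniform]. *)
pose r := Order.min (r1 / 4) (Order.min m (`|M2| + 1)^-1).
have M20 : 0 < `|M2| + 1 by rewrite ltr_wpDl.
have r0 : 0 < r by rewrite !lt_min r20 m0 invr_gt0.
have rr : r <= r1 / 4 by rewrite ge_min lexx.
have rm : r <= m by rewrite !ge_min lexx orbT.
have rM : M2 <= r^-1.
  have : r <= (`|M2| + 1)^-1 by rewrite !ge_min lexx !orbT.
  move=> rM; apply: le_trans (ler_norm _) _; apply: (@le_trans _ _ (`|M2| + 1)); first by rewrite lerDl.
  by rewrite -[leLHS]invrK lef_pV2 ?posrE ?invr_gt0.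
exists r, c, w, G; split=> // y' By; have By4 : ball y (r1 / 4) y' by exact: le_ball By.
have [u1 m1] := Gs y' By4; split.
  split => //; first by exists M2 => x; exact: GM.
  by move=> x; exact: Gf.
move=> x; split; [exact: Gd|exact: le_trans (GM _ _ By4) rM|exact: le_trans rm (mP _ _ By4)].
Qed.

Lemma global_slices Om f y0 : domain Om -> AP Om f -> (Om `\` amoeba Om f) y0 ->
  exists c (w : R[i]) (G : 'rV[R[i]]_p -> R[i]), forall y,
    connected_component (Om `\` amoeba Om f) y0 y -> exists2 r : R, 0 < r &
    forall y', ball y r y' -> slice f y' c w (fun x => G (mkz x y')) /\
      forall x, [/\ differentiable G (mkz x y'), cabs (G (mkz x y')) <= r^-1 & r <= cabs (f (mkz x y'))].
Proof.
move=> [Oo _] fAP Uy0; set U := Om `\` amoeba Om f in Uy0 *; set D0 := connected_component U y0.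
have Uo : open U by exact: amoeba_open.
have Do : open D0 by exact: component_open.
have y0D : D0 y0 by exact: connected_component_refl.
have loc y : D0 y -> exists (r : R) c (w : R[i]) (G : 'rV[R[i]]_p -> R[i]), 0 < r /\
    forall y', ball y r y' -> D0 y' /\ (slice f y' c w (fun x => G (mkz x y')) /\
      forall x, [/\ differentiable G (mkz x y'), cabs (G (mkz x y')) <= r^-1 & r <= cabs (f (mkz x y'))]).
  move=> Dy; have yU : nbhs y U by apply: open_nbhs_nbhs; split => //; exact: connected_component_sub Dy.
  have : nbhs y D0 by apply: open_nbhs_nbhs.
  rewrite -nbhs_ballE => -[r1 /= r10 rD].
  have [r [c [w [G [r0 H]]]]] := local_slices fAP yU.
  have rr : Order.min r r1 <= r by rewrite ge_min lexx.
  have rr0 : 0 < Order.min r r1 by rewrite lt_min r0.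
  exists (Order.min r r1), c, w, G; split => // y' By; split.
    by apply: rD; apply: le_ball By; rewrite ge_min lexx orbT.
  have [s1 s2] := H y' (le_ball rr By); split => // x; have [d1 d2 d3] := s2 x.
  split => //; last exact: le_trans rr d3.
  by apply: le_trans d2 _; rewrite lef_pV2 ?posrE.
have [r0 [c [w [G0 [r00 H0]]]]] := loc y0 y0D.
(* By uniqueness the pair [(c, w)] is constant on the small balls of [loc], so both [E] and its
   complement in [D0] are open, and connectedness gives [E = D0]. *)
pose E := [set y | D0 y /\ exists ga, slice f y c w ga].
have [_ [s0 _]] := H0 y0 (ballxx y0 r00).
have Eo : open E.
  rewrite openE => y [Dy [ga sga]]; have [r [c1 [w1 [G1 [r10 H1]]]]] := loc y Dy.
  rewrite /interior -nbhs_ballE; exists r => // y' By; have [Dy' [s1 _]] := H1 y' By.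
  split => //; have [_ [sy _]] := H1 y (ballxx y r10).
  by have [<- <- _] := slice_unique sy sga; exists (fun x => G1 (mkz x y')).
have No : open (D0 `&` ~` E).
  rewrite openE => y [Dy Ey]; have [r [c1 [w1 [G1 [r10 H1]]]]] := loc y Dy.
  rewrite /interior -nbhs_ballE; exists r => // y' By; have [Dy' [s1 _]] := H1 y' By.
  split => // -[_ [ga sga]]; apply: Ey; split => //.
  have [_ [sy _]] := H1 y (ballxx y r10).
  by have [<- <- _] := slice_unique s1 sga; exists (fun x => G1 (mkz x y)).
have ED : E = D0.
  apply: (@component_connected _ U y0).
  - by exists y0; split => //; exists (fun x => G0 (mkz x y0)).
  - by exists E => //; apply/seteqP; split=> [y [Dy Ey]|y []].
  exists (~` (D0 `&` ~` E)); first exact: open_closedC.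
  apply/seteqP; split=> [y [Dy Ey]|y [Dy N]]; first by split => // -[_ N]; apply: N.
  by apply: contrapT => Ey; apply: N.
have gaP y : exists ga, D0 y -> slice f y c w ga.
  have [Dy|//] := pselect (D0 y); last by exists (fun=> 0).
  by move: Dy; rewrite -{1}ED => -[_ [ga sga]]; exists ga.
have [gam gamP] := choice gaP.
(* [gam] picks the slices independently of one another; uniqueness identifies them with the local
   functions [G1], which makes [G] differentiable. *)
pose G z := gam (imv z) (rev z).
have GE x y : G (mkz x y) = gam y x by rewrite /G imv_mkz rev_mkz.
exists c, w, G => y Dy; have [r [c1 [w1 [G1 [r10 H1]]]]] := loc y Dy.
exists r => // y' By; have [Dy' [s1 d1]] := H1 y' By.
have Gy : (fun x => G (mkz x y')) = gam y' by apply: funext => x; rewrite GE.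
split; first by rewrite Gy; exact: gamP.
have G11 y1 : ball y r y1 -> forall x, G (mkz x y1) = G1 (mkz x y1).
  move=> By1 x; have [D1 [s2 _]] := H1 y1 By1.
  by have [_ _ E1] := slice_unique s2 (gamP y1 D1); rewrite GE -E1.
move=> x; have [k1 k2 k3] := d1 x; split => //; last by rewrite G11.
apply: (differentiable_near _ k1).1.
have : nbhs y' (ball y r).
  by apply: open_nbhs_nbhs; split => //; exact: ball_open.
rewrite -nbhs_ballE => -[d /= d0 dB].
apply: (mkz_nbhs d0) => x1 y1 _ hy; rewrite G11 //; apply: dB.
by rewrite -ball_normE /= distrC.
Qed.

End component.

(** * Spectrum, Jessen function and conclusion *)

Section conclusion.
Variables (R : realType) (p : nat) (Om : set 'rV[R]_p) (f : 'rV[R[i]]_p -> R[i]).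
Implicit Types (c x y t la : 'rV[R]_p).

(** A nonzero coefficient in the sense of [cmean] on one slice gives a nonzero limit of cube means;
    the imaginary part [y] contributes only the constant factor [cexp (ip y la)]. *)
Lemma spectrum_intro y la (w : R[i]) : Om y -> ucont (fun x => f (mkz x y)) -> bounded (fun x => f (mkz x y)) ->
  w != 0 -> cmean (fun x => f (mkz x y) * cexp (Complex 0 (- ip x la))) w -> spectrum Om f la.
Proof.
move=> Oy fc fb w0 fm; exists y; split => //.
pose k : R[i] := cexp (ip y la)%:C%C.
exists (k * w); split; first by rewrite mulf_neq0 // cexp_neq0.
have E : (fun x => cexp (- Complex 0 1 * cip (mkz x y) la) * f (mkz x y)) =
    (fun x => k * (f (mkz x y) * cexp (Complex 0 (- ip x la)))).
  apply: funext => x; rewrite mulNr icip.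
  have -> : - Complex (- ip y la) (ip x la) = (ip y la)%:C%C + Complex 0 (- ip x la).
    by apply: cP; rewrite /= ?opprK ?addr0 ?add0r.
  by rewrite cexpD -/k; ring.
have ec : ucont (fun x => cexp (Complex 0 (- ip x la))).
  by have := ee_ucont (- la); under eq_fun do rewrite ipNr.
have eb : bounded (fun x => cexp (Complex 0 (- ip x la))) by exists 1 => x; rewrite cabs_ee.
rewrite E; apply: ccube_mean_cvg; last exact: cmeanZ.
  by apply: ucontZ; exact: ucontM.
by apply: boundedZ; exact: bounded_mul.
Qed.

(** The constant [k] merges [w] and the factor coming from [y] into the bounded part, which brings
    the slice to the form that [mean_motion_span] expects. *)
Lemma slice_Gf y c (w : R[i]) (ga : 'rV[R]_p -> R[i]) (m : R) : Om y -> slice f y c w ga ->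
  tbdd (fun x => f (mkz x y)) -> ucont (fun x => f (mkz x y)) -> 0 < m ->
  (forall x, m <= cabs (f (mkz x y))) -> Gf Om f c.
Proof.
move=> Oy [w0 gc gb gm fE] ft fc m0 fm; have [l lE] := cexp_surj w0.
pose k := l - (ip y c)%:C%C.
have hE x : f (mkz x y) = cexp (ga x + k + Complex 0 (ip x c)).
  rewrite fE -lE -cexpD icip; congr cexp; rewrite /k.
  have -> : Complex (- ip y c) (ip x c) = Complex 0 (ip x c) - (ip y c)%:C%C.
    by apply: cP; rewrite /= ?add0r ?oppr0 ?addr0.
  by ring.
have [I [la [laP [n cE]]]] := mean_motion_span fc ft m0 fm (ucont_addc k gc) (bounded_addc k gb) hE.
exists #|I|, (fun i => la (enum_val i)), (fun i => n (enum_val i)); split.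
  move=> i; have [v [v0 vm]] := laP (enum_val i).
  exact: (spectrum_intro Oy fc (tbdd_bounded ft) v0 vm).
by rewrite cE (reindex _ (onW_bij _ (enum_val_bij I))).
Qed.

(** [ln |f|] is the real part of the exponent, in which the part [ga] of mean zero drops out of the
    average and an affine function of [y] remains. *)
Lemma cvg_jessen y c (w l : R[i]) (ga : 'rV[R]_p -> R[i]) : cexp l = w -> slice f y c w ga ->
  jessen f y = complex.Re l - ip y c.
Proof.
move=> lE [w0 gc gb gm fE]; pose k := l - (ip y c)%:C%C.
have E : (fun x => ln (cabs (f (mkz x y)))) = (fun x => complex.Re (ga x + k)).
  apply: funext => x; rewrite fE -lE -cexpD cabs_cexp expRK icip /k.
  by rewrite !cReD cReN /=; ring.
have := cube_mean_Re (ucont_addc k gc) (bounded_addc k gb) (cmean_addc k gm).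
rewrite add0r -E => /cvg_lim; rewrite /jessen => -> //.
by rewrite /k cReB.
Qed.

(** Named so that it can carry a linear structure, which its identification as a differential
    needs. *)
Definition negip c (h : 'rV[R]_p) : R := - ip h c.

End conclusion.

Lemma negip_linear (R : realType) (p : nat) (c : 'rV[R]_p) : linear (negip c).
Proof.
move=> a u v; rewrite /negip ipDl opprD; congr (_ - _).
rewrite /ip scalerN; congr (- _); rewrite scaler_sumr; apply: eq_bigr => j _.
by rewrite mxE -mulrA.
Qed.

HB.instance Definition _ (R : realType) (p : nat) (c : 'rV[R]_p) :=
  GRing.isLinear.Build R 'rV[R]_p R _ (negip c) (negip_linear c).

Section conclusion.
Variables (R : realType) (p : nat).

Lemma negip_continuous (c : 'rV[R]_p) : continuous (negip c).
Proof.
move=> x; have FF : Filter (nbhs x) := nbhs_filter x; apply/cvgrPdist_le => e e0.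
have C0 : 0 < \sum_j `|c 0 j| + 1 by rewrite ltr_wpDl // sumr_ge0.
have d0 : 0 < e / (\sum_j `|c 0 j| + 1) by rewrite divr_gt0.
apply: (@filterS _ (nbhs x) FF _ _ _ (nbhsx_ballx (x : 'rV[R]_p) _ d0)) => z.
rewrite -ball_normE /= ltr_pdivlMr // => h.
rewrite /negip opprK addrC -ipBl -normrN -ipNl opprB; apply: le_trans (ip_norm _ _) _.
by apply: le_trans (ltW h); rewrite ler_wpM2l // lerDl.
Qed.

Lemma affine_diff (c : 'rV[R]_p) (F : 'rV[R]_p -> R) (a : R) y : (\forall u \near y, F u = a - ip u c) ->
  differentiable F y /\ forall h, 'd F y h = - ip h c.
Proof.
move=> FE; have H : (fun u => a - ip u c) \o shift y = cst (a - ip y c) + negip c +o_ 0 id.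
  apply/eqaddoP => e e0; near=> h.
  rewrite !fctE /= /negip ipDl.
  have -> : a - (ip h c + ip y c) - (a - ip y c - ip h c) = 0 by ring.
  by rewrite normr0 mulr_ge0 // ltW.
have dE : 'd (fun u => a - ip u c) y = negip c :> ('rV[R]_p -> R).
  by apply: diff_unique => //; exact: negip_continuous.
have d1 : differentiable (fun u => a - ip u c) y.
  by apply/diff_locallyP; rewrite dE; split => //; exact: negip_continuous.
have [d2 d3] := differentiable_near FE d1; split => // h.
by rewrite d3 dE.
Unshelve. all: by end_near.
Qed.

End conclusion.

Theorem mainTheorem1 (R : realType) (p : nat) (Om : set 'rV[R]_p)
  (f : 'rV[R[i]]_p -> R[i]) (y0 : 'rV[R]_p) :
  domain Om ->
  AP Om f ->
  (exists z, tube Om z /\ f z != 0) ->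
  (Om `\` amoeba Om f) y0 ->
  let D0 := connected_component (Om `\` amoeba Om f) y0 in
  exists c : 'rV[R]_p,
    Gf Om f c /\
    (forall D' : set 'rV[R]_p, domain D' -> relcpt_in D' D0 ->
       exists g : 'rV[R[i]]_p -> R[i],
         AP D' g /\
         (exists M : R, forall z, tube D' z -> cabs (g z) <= M) /\
         (forall z, tube D' z -> f z = cexp (g z + Complex 0 1 * cip z c))) /\
    (forall y, D0 y ->
       differentiable (jessen f) y /\
       forall h : 'rV[R]_p, 'd (jessen f) y h = - \sum_(j < p) h 0 j * c 0 j).
Proof.
move=> Od fAP _ Uy0 D0.
have [c [w [G GP]]] := global_slices Od fAP Uy0; rewrite -/D0 in GP.
have y0D : D0 y0 by exact: connected_component_refl.
have Oo : open Om by case: Od.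
have Do : open D0 by apply: component_open; exact: amoeba_open.
have DO : D0 `<=` Om by move=> y /connected_component_sub[].
have [r0 r00 H0] := GP y0 y0D.
have [[w0 _ _ _ _] _] := H0 y0 (ballxx y0 r00).
have [l lE] := cexp_surj w0.
exists c; split; [|split].
- have [r1 r10 rc] := relcpt_ball (open_nbhs_nbhs (conj Oo (DO _ y0D))).
  have b1 := ballxx y0 r10.
  have [s0 sx] := H0 y0 (ballxx y0 r00).
  apply: (slice_Gf (DO _ y0D) s0 _ _ r00 (fun x => let: And3 _ _ k := sx x in k)).
    by move=> e /(AP_colour fAP rc)[I [col H]]; exists I, col => t t' tt x; exact: H.
  move=> e /(AP_jointuc fAP rc)[d d0 H]; exists d => // x t td.
  by apply: H => //; rewrite ?subrr ?normr0 // addrAC subrr add0r.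
- move=> D' [D'o D'c] [D'k D'D].
  have rc : relcpt_in D' Om by split => //; exact: subset_trans D'D DO.
  have sl y : D' y -> slice f y c w (fun x => G (mkz x y)).
    move=> Dy; have Dy0 := D'D _ (subset_closure Dy); have [r r1 H] := GP y Dy0.
    by have [] := H y (ballxx y r1).
  have [m m0 mP] : exists2 m : R, 0 < m & forall y, closure D' y ->
      forall x, differentiable G (mkz x y) /\ cabs (G (mkz x y)) <= m^-1 /\ m <= cabs (f (mkz x y)).
    (* The guard [0 < d] lets [P] pass to all smaller [d], including nonpositive ones, for which
       [d^-1] bounds nothing. *)
    pose P (d : R) y := forall x, differentiable G (mkz x y) /\
      ((0 < d -> cabs (G (mkz x y)) <= d^-1) /\ d <= cabs (f (mkz x y))).
    have [|y Dy|m m0 mP] := @compact_uniform R _ (closure D') P D'k.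
    - move=> d d' y dd Py x; have [k1 [k2 k3]] := Py x; split => //; split; last exact: le_trans dd k3.
      move=> d'0; have d0 := lt_le_trans d'0 dd; apply: le_trans (k2 d0) _.
      by rewrite lef_pV2 ?posrE.
    - have [r r1 H] := GP y (D'D _ Dy); exists r => // y' By x.
      by have [_ /(_ x)[k1 k2 k3]] := H y' By.
    by exists m => // y Dy x; have [k1 [k2 k3]] := mP y Dy x; split => //; split => //; exact: k2.
  (* The logarithm [l] of the constant factor [w] is put back, so that [f] itself becomes an
     exponential. *)
  pose g z := l + G z.
  have fg z : tube D' z -> f z = cexp (g z + Complex 0 1 * cip z c).
    move=> Dz; have [_ _ _ _ E] := sl _ Dz; have := E (rev z).
    by rewrite mkz_eta => ->; rewrite -lE -cexpD addrA.
  exists g; split; last first.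
    split=> //; exists (cabs l + m^-1) => z Dz; apply: le_trans (cabsD _ _) _; rewrite lerD2l.
    have Dz' : D' (imv z) := Dz.
    by have [_ [k _]] := mP (imv z) (subset_closure Dz') (rev z); rewrite mkz_eta in k.
  apply: (AP_of_colour D'o) => [x y Dy|e e0].
    apply: differentiableD; first exact: differentiable_cst.
    by have [] := mP y (subset_closure Dy) x.
  (* [slice_log] turns a relative error [de] of [f] into an error [8 * de] of its logarithm. Since
     [|f| >= m] over [D'], shifts that are [de * m]-close for [f] are therefore [e]-close for
     [g]. *)
  pose de := Order.min (1 / 2) (e / 8).
  have de0 : 0 < de by rewrite lt_min !divr_gt0.
  have de2 : de <= 1 / 2 by rewrite ge_min lexx.
  have de8 : de <= e / 8 by rewrite ge_min lexx orbT.
  have [I [col H]] := AP_colour fAP rc (mulr_gt0 de0 m0); exists I, col => t t' tt x y Dy.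
  have [_ gc gb _ E] := sl y Dy.
  pose k := l - (ip y c)%:C%C.
  have hE x1 : f (mkz x1 y) = cexp (G (mkz x1 y) + k + Complex 0 (ip x1 c)).
    rewrite E -lE -cexpD icip; congr cexp; rewrite /k.
    have -> : Complex (- ip y c) (ip x1 c) = Complex 0 (ip x1 c) - (ip y c)%:C%C.
      by apply: cP; rewrite /= ?add0r ?oppr0 ?addr0.
    by ring.
  have [|s1 _] := slice_log (ucont_addc k gc) (bounded_addc k gb) hE de2 (t := t) (s := t').
    move=> x1; apply: le_trans (H t t' tt x1 y Dy) _.
    by rewrite ler_pM2l //; have [_ [_]] := mP y (subset_closure Dy) (x1 + t').
  have -> : g (mkz (x + t) y) - g (mkz (x + t') y) =
    G (mkz (x + t) y) + k - (G (mkz (x + t') y) + k) by rewrite /g; ring.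
  by apply: le_trans (s1 x) _; lra.
move=> y Dy; apply: (affine_diff (a := complex.Re l)).
have : nbhs y D0 by apply: open_nbhs_nbhs.
apply: filterS => u Du; have [r r1 H] := GP u Du; have [su _] := H u (ballxx u r1).
exact: cvg_jessen lE su.
Qed.
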